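(* Let a slab occupying $[0,a]$, with density $\rho'(x,\omega)$ and compressibility $C'(x,\omega)$ (damping allowed), be embedded in a uniform acoustic medium of density $\rho$ and compressibility $C$, with sound speed $c=(C\rho)^{-1/2}$. Let $R(\omega)$ be its reflection coefficient. Then $$\int_0^\infty \operatorname{Re} R(\omega)\,\frac{d\omega}{\omega^2}=\frac{\pi a}{4c}\left(\frac{\langle \rho_0'\rangle}{\rho}-\frac{\langle C_0'\rangle}{C}\right),$$ where $\rho_0'(x)=\rho'(x,0)$ and $C_0'(x)=C'(x,0)$ are the static values and $\langle f\rangle=\frac1a\int_0^a f(x)\,dx$.
   Context: Time dependence is $e^{-i\omega t}$. The constants $\rho,C,a>0$ are given; $c=(C\rho)^{-1/2}$, $z=(\rho/C)^{1/2}$, $k=\omega/c$. Slab properties: for $x\in[0,a]$ and $\operatorname{Im}\omega\ge 0$, $\rho'(x,\omega)$ and $C'(x,\omega)$ are bounded, measurable in $x$, continuous in $\omega$ on the closed upper half plane and analytic for $\operatorname{Im}\omega>0$ (causality), satisfy $\rho'(x,-\omega^* )=\rho'(x,\omega)^*$ and $C'(x,-\omega^* )=C'(x,\omega)^*$ (real-valued time-domain response), and $\operatorname{Im}(\omega\rho')\ge0$, $\operatorname{Im}(\omega C')\ge 0$ for $\operatorname{Im}\omega\ge0$ (passivity). The static values $\rho_0'(x)=\rho'(x,0)$, $C_0'(x)=C'(x,0)$ are real, positive and bounded away from zero, and $\rho'(x,\omega)=\rho_0'(x)+O(\omega)$, $C'(x,\omega)=C_0'(x)+O(\omega)$ uniformly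 in $x$ as $\omega\to0$. The undamped case is that of real positive $\rho',C'$ independent of $\omega$. Propagator: $\mathbf M(x,\omega)$ is the $2\times2$ matrix solution of $$\frac{d\mathbf M}{dx}=i\omega\,\mathbf Q\,\mathbf M,\quad \mathbf M(0,\omega)=\mathbf I,\quad \mathbf Q(x,\omega)=\begin{pmatrix}0&C'(x,\omega)\\ \rho'(x,\omega)&0\end{pmatrix},$$ which propagates the vector $(v,p)^T$ of particle velocity and pressure. Write $M_{ij}$ for the entries of $\mathbf M(a,\omega)$. Reflection coefficient: the pressure is $p=e^{ikx}+R\,e^{-ikx}$ for $x<0$ and $p=T\,e^{ikx}$ for $x>a$, with $p$ and $v$ continuous at $x=0,a$; equivalently $$R(\omega)=\frac{M_{11}-M_{22}+zM_{12}-z^{-1}M_{21}}{M_{11}+M_{22}-zM_{12}-z^{-1}M_{21}}.$$ *)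

(* Defs.v *)
From HB Require Import structures.
From mathcomp Require Import all_boot all_order all_algebra.
From mathcomp Require Import complex.
From mathcomp Require Import ring.
From mathcomp Require Import all_classical all_reals all_analysis.

Set Implicit Arguments.
Unset Strict Implicit.
Unset Printing Implicit Defensive.

Import Order.TTheory GRing.Theory Num.Theory.
Import numFieldNormedType.Exports.

Local Open Scope classical_set_scope.
Local Open Scope ring_scope.
Local Open Scope complex_scope.

Definition closed_uhp (R : realType) : set (R[i])^o :=
  [set w | 0 <= complex.Im w].

(* One material parameter f x w of a slab on [0, a]: x is the position and w
   the complex angular frequency.  Values of f for x outside [0, a] or for w
   outside the closed upper half plane are irrelevant. *)
Record slab_parameter (R : realType) (a : R) (f : R -> R[i] -> R[i]) : Prop := {
  slab_bounded : exists B : R, forall (x : R) (w : R[i]),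
    0 <= x <= a -> 0 <= complex.Im w -> `|f x w| <= B%:C;
  slab_measurable_Re : forall w : R[i], 0 <= complex.Im w ->
    measurable_fun `[0, a] (fun x => complex.Re (f x w));
  slab_measurable_Im : forall w : R[i], 0 <= complex.Im w ->
    measurable_fun `[0, a] (fun x => complex.Im (f x w));
  slab_continuous : forall x : R, 0 <= x <= a ->
    {within @closed_uhp R, continuous (f x : (R[i])^o -> (R[i])^o)};
  (* the regular module (R[i])^o makes this derivative the complex one *)
  slab_analytic : forall (x : R) (w : R[i]), 0 <= x <= a -> 0 < complex.Im w ->
    derivable (f x : (R[i])^o -> (R[i])^o) w 1;
  slab_real_response : forall (x : R) (w : R[i]),
    0 <= x <= a -> 0 <= complex.Im w -> f x (- w^*) = (f x w)^*;
  slab_passive : forall (x : R) (w : R[i]),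
    0 <= x <= a -> 0 <= complex.Im w -> 0 <= complex.Im (w * f x w);
  slab_static_real : forall x : R, 0 <= x <= a -> complex.Im (f x 0) = 0;
  slab_static_pos : exists2 m : R, 0 < m &
    forall x : R, 0 <= x <= a -> m <= complex.Re (f x 0);
  slab_low_freq : exists K d : R, 0 < d /\
    forall (x : R) (w : R[i]), 0 <= x <= a -> 0 <= complex.Im w ->
      `|w| < d%:C -> `|f x w - f x 0| <= K%:C * `|w|
}.

Definition static (R : realType) (f : R -> R[i] -> R[i]) (x : R) : R :=
  complex.Re (f x 0).

Definition slab_mean (R : realType) (a : R) (g : R -> R) : R :=
  a^-1 * \int[@lebesgue_measure R]_(x in `[0, a]) g x.

Definition cintegral (R : realType) (D : set R) (g : R -> R[i]) : R[i] :=
  (\int[@lebesgue_measure R]_(x in D) complex.Re (g x)) +i*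
  (\int[@lebesgue_measure R]_(x in D) complex.Im (g x)).

Definition slab_matrix (R : realType) (rho' C' : R -> R[i] -> R[i])
    (x : R) (w : R[i]) : 'M[R[i]]_2 :=
  \matrix_(i < 2, j < 2)
    if i == j then 0 else if i == 0 then C' x w else rho' x w.

(* dM/dx = i w Q M, M(0, w) = 1.  As Q is merely bounded and measurable in x,
   a solution is understood in the Caratheodory sense: M is continuous on
   [0, a] and satisfies the integrated equation there. *)
Definition is_propagator (R : realType) (a : R) (rho' C' : R -> R[i] -> R[i])
    (M : R -> R[i] -> 'M[R[i]]_2) : Prop :=
  forall w : R[i], 0 <= complex.Im w ->
    (forall i j : 'I_2,
       {within `[0, a], continuous (fun x : R => M x w i j : (R[i])^o)}) /\
    (forall (x : R) (i j : 'I_2), 0 <= x <= a ->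
       M x w i j = (1%:M : 'M[R[i]]_2) i j +
         cintegral `[0, x]
           (fun s => (0 +i* 1) * w * (slab_matrix rho' C' s w *m M s w) i j)).

Definition sound_speed (R : realType) (rho C : R) : R := (Num.sqrt (C * rho))^-1.

Definition impedance (R : realType) (rho C : R) : R := Num.sqrt (rho / C).

(* Here N is the propagator across the whole slab, N = M(a, w). *)
Definition reflection (R : realType) (z : R) (N : 'M[R[i]]_2) : R[i] :=
  (N 0 0 - N 1 1 + z%:C * N 0 1 - (z%:C)^-1 * N 1 0) /
  (N 0 0 + N 1 1 - z%:C * N 0 1 - (z%:C)^-1 * N 1 0).

(* The formula above is the solution of the matching problem: with
   v = +- p / z for waves going in the +-x direction, continuity of (v, p) at
   x = 0 and x = a reads N (v(0), p(0))^T = (v(a), p(a))^T, where t is the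
   transmitted pressure T e^{ika} at x = a. *)
Lemma reflection_matching (R : realType) (z : R) (N : 'M[R[i]]_2) (r t : R[i]) :
  z != 0 ->
  N 0 0 + N 1 1 - z%:C * N 0 1 - (z%:C)^-1 * N 1 0 != 0 ->
  N *m (\col_(i < 2) if i == 0 then (1 - r) / z%:C else 1 + r) =
    (\col_(i < 2) if i == 0 then t / z%:C else t) ->
  r = reflection z N.
Proof.
move=> z0 D0 /matrixP E.
have zC0 : z%:C != 0 :> R[i].
  by apply: contra z0 => /eqP/(congr1 (@complex.Re R))/= ->.
have := E 0 0; have := E 1 0.
rewrite !mxE !big_ord_recl !big_ord0 !mxE /= !addr0.
have -> : lift ord0 ord0 = 1 :> 'I_2 by apply/val_inj.
move=> E1 E0.
apply: (mulIf D0); rewrite /reflection mulfVK//.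
have {}E1 : t = N 1 0 * ((1 - r) / z%:C) + N 1 1 * (1 + r) by rewrite -E1.
have {}E0 : N 0 0 * ((1 - r) / z%:C) + N 0 1 * (1 + r) - t / z%:C = 0.
  by rewrite E0 subrr.
apply/eqP; rewrite eq_sym -subr_eq0; apply/eqP.
rewrite -[RHS](mulr0 z%:C) -{}E0 {}E1.
by field.
Qed.

(* Main.v *)
Require Import Defs.
From HB Require Import structures.
From mathcomp Require Import all_boot all_order all_algebra.
From mathcomp Require Import complex.
From mathcomp Require Import ring lra.
From mathcomp Require Import all_classical all_reals all_analysis.
From mathcomp Require Import measurable_realfun.

(* The reflection coefficient F(w) is bounded by 1 on the closed upper half plane, because
   passivity makes the energy flux decrease through the slab; it is continuous there,
   analytic inside, satisfies F(- conj w) = conj F(w), and F(w) = i al w + O(w^2) at 0 with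
   al = (z <C0'> - <rho0'> / z) a / 2.  In polar coordinates w = exp (s + i t), Cauchy's theorem
   for F(w) / w^2 on the half annulus exp (- N) <= |w| <= exp N gives
   2 * int Re F(w) / w^2 dw = - pi al + O(exp (- N)): the outer half circle contributes nothing
   in the limit, and the inner one gives half of the residue i al at the origin.

   Analyticity of the parameters is only pointwise in x, while differentiating the
   propagator under the integral in x needs uniform difference quotients; these come from
   Goursat's lemma through the Cauchy estimate.  The derivative of the propagator is then
   read off from the variation of constants formula by dominated convergence. *)

Set Implicit Arguments.
Unset Strict Implicit.
Unset Printing Implicit Defensive.

Import Order.TTheory GRing.Theory Num.Theory.
Import numFieldNormedType.Exports.
Import Normc.

Local Open Scope classical_set_scope.
Local Open Scope ring_scope.
Local Open Scope complex_scope.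

(** * Complex norm and convergence *)

Section ComplexNorm.
Context {R : realType}.
Implicit Types z w : R[i].

(** The coefficients are only bounded and measurable in [x], so the equation cannot be used
    pointwise there. The one calculus rule is a product rule for Lipschitz primitives, and the
    bilinear identity built on it yields everything about the propagator: unit determinant,
    uniqueness, the reality symmetry, the energy balance and the dependence on the frequency. The
    energy balance gives more than a bound on the reflection coefficient: the squared modulus of its
    denominator exceeds that of its numerator by at least 4, so there are no poles in the closed
    half plane. Logarithmic coordinates turn half annuli into rectangles, so Cauchy's theorem for
    rectangles suffices. Analyticity is given only off the real axis, hence the contour first stays
    at angle [e] from it. The integrand is integrable at 0 because the linear term i al w is
    imaginary for real w. The 1/2 in al comes from the value 2 of the denominator at zero frequency;
    a second 1/2 comes from folding the negative axis onto the positive one; together they give the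
    1/4 of the sum rule. *)

Lemma ReCD z w : complex.Re (z + w) = complex.Re z + complex.Re w.
Proof. by case: z; case: w. Qed.
Lemma ImCD z w : complex.Im (z + w) = complex.Im z + complex.Im w.
Proof. by case: z; case: w. Qed.
Lemma ReCN z : complex.Re (- z) = - complex.Re z.
Proof. by case: z. Qed.
Lemma ImCN z : complex.Im (- z) = - complex.Im z.
Proof. by case: z. Qed.
Lemma ReCM z w : complex.Re (z * w) =
  complex.Re z * complex.Re w - complex.Im z * complex.Im w.
Proof. by case: z; case: w. Qed.
Lemma ImCM z w : complex.Im (z * w) =
  complex.Re z * complex.Im w + complex.Im z * complex.Re w.
Proof. by case: z; case: w. Qed.
Lemma ReCJ z : complex.Re (z^*) = complex.Re z.
Proof. by case: z. Qed.
Lemma ImCJ z : complex.Im (z^*) = - complex.Im z.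
Proof. by case: z. Qed.

Lemma complex_eq z w :
  complex.Re z = complex.Re w -> complex.Im z = complex.Im w -> z = w.
Proof. by case: z => a b; case: w => c d /= -> ->. Qed.

Lemma normrcE z : `|z| = (normc z)%:C.
Proof. by []. Qed.

Lemma normc_ge0 z : 0 <= normc z.
Proof. by case: z => a b; exact: sqrtr_ge0. Qed.

Lemma normcD z w : normc (z + w) <= normc z + normc w.
Proof. exact: le_normcD. Qed.

Lemma normcNE z : normc (- z) = normc z.
Proof. exact: normcN. Qed.

Lemma normcBC z w : normc (z - w) = normc (w - z).
Proof. by rewrite -normcNE opprB. Qed.

Lemma normcJ z : normc (z^*) = normc z.
Proof. by case: z => a b /=; rewrite sqrrN. Qed.

Lemma normc_real (x : R) : normc x%:C = `|x|.
Proof. by rewrite /normc /= expr0n addr0 sqrtr_sqr. Qed.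

Lemma normc_i : normc (0 +i* 1 : R[i]) = 1.
Proof. by rewrite /normc expr0n/= add0r expr1n sqrtr1. Qed.

Lemma ler_Re_normc z : `|complex.Re z| <= normc z.
Proof.
case: z => a b /=; rewrite -sqrtr_sqr ler_sqrt ?addr_ge0 ?sqr_ge0//.
by rewrite lerDl sqr_ge0.
Qed.

Lemma ler_Im_normc z : `|complex.Im z| <= normc z.
Proof.
case: z => a b /=; rewrite -sqrtr_sqr ler_sqrt ?addr_ge0 ?sqr_ge0//.
by rewrite lerDr sqr_ge0.
Qed.

Lemma normc_le_ReIm z : normc z <= `|complex.Re z| + `|complex.Im z|.
Proof.
have -> : z = (complex.Re z)%:C + (0 +i* 1) * (complex.Im z)%:C.
  by case: z => a b; apply: complex_eq; rewrite ?ReCD ?ImCD ?ReCM ?ImCM /=; ring.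
apply: (le_trans (normcD _ _)); rewrite normcM normc_i mul1r !normc_real.
by rewrite !ReCD !ImCD !ReCM !ImCM /= !(mul0r, mul1r, subr0, addr0, add0r, oppr0).
Qed.

Lemma normc_sqr z : normc z ^+ 2 = complex.Re z ^+ 2 + complex.Im z ^+ 2.
Proof. by case: z => a b; rewrite /normc sqr_sqrtr // addr_ge0 ?sqr_ge0. Qed.

Lemma normc_eq0 z : (normc z == 0) = (z == 0).
Proof.
by apply/eqP/eqP => [/eq0_normc //|->]; exact: normc0.
Qed.

Lemma normc_gt0 z : (0 < normc z) = (z != 0).
Proof. by rewrite lt0r normc_eq0 normc_ge0 andbT. Qed.

Lemma subr_normc_le z w : normc z - normc w <= normc (z - w).
Proof. by rewrite lerBlDr (le_trans _ (normcD _ _)) // subrK. Qed.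

End ComplexNorm.

Section ComplexConvergence.
Context {R : realType}.
Notation Co := ((R[i])^o).

(** The norm of [R[i]] is itself complex-valued, and [0 < e] there forces [e] to be real; the
    equivalence trades it for a real norm and a real tolerance. *)
Lemma cvgcP (T : Type) (F : set_system T) {FF : Filter F} (f : T -> Co) (l : Co) :
  f @ F --> l <-> forall e : R, 0 < e -> \forall x \near F, normc (f x - l) < e.
Proof.
split=> [/cvgrPdist_lt fl e e0|H].
  have := fl e%:C; rewrite ltcR => /(_ e0); apply: filterS => x.
  by rewrite normrcE ltcR normcBC.
apply/cvgrPdist_lt => e; case: e => e1 e2; rewrite ltcE /= => /andP[/eqP -> e0].
apply: filterS (H _ e0) => x; rewrite normcBC normrcE.
by rewrite -[e1 +i* 0]/(e1%:C) ltcR.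
Qed.

Lemma cvg_Re (T : Type) (F : set_system T) {FF : Filter F} (f : T -> Co) (l : Co) :
  f @ F --> l -> complex.Re (f x) @[x --> F] --> complex.Re l.
Proof.
move=> /cvgcP H; apply/cvgrPdist_lt => e e0; apply: filterS (H e e0) => x.
by apply: le_lt_trans; rewrite distrC -ReCN -ReCD ler_Re_normc.
Qed.

Lemma cvg_Im (T : Type) (F : set_system T) {FF : Filter F} (f : T -> Co) (l : Co) :
  f @ F --> l -> complex.Im (f x) @[x --> F] --> complex.Im l.
Proof.
move=> /cvgcP H; apply/cvgrPdist_lt => e e0; apply: filterS (H e e0) => x.
by apply: le_lt_trans; rewrite distrC -ImCN -ImCD ler_Im_normc.
Qed.

Lemma cvg_ReIm (T : Type) (F : set_system T) {FF : Filter F} (f : T -> Co) (l : Co) :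
  complex.Re (f x) @[x --> F] --> complex.Re l ->
  complex.Im (f x) @[x --> F] --> complex.Im l -> f @ F --> l.
Proof.
move=> /cvgrPdist_lt Hr /cvgrPdist_lt Hi; apply/cvgcP => e e0.
have e2 : 0 < e / 2 by rewrite divr_gt0.
near=> x; apply: (le_lt_trans (normc_le_ReIm _)).
rewrite [e]splitr ReCD ImCD ReCN ImCN ltrD// distrC; near: x; [exact: Hr|exact: Hi].
Unshelve. all: by end_near. Qed.

Lemma near0_normcP (P : set Co) :
  (\forall h \near (0:Co), P h) <->
  exists2 d : R, 0 < d & forall h : Co, normc h < d -> P h.
Proof.
split=> [/nbhs_ballP[[d1 d2] /=]|[d d0 H]].
  rewrite ltcE /= => /andP[/eqP -> d0] H; exists d1 => // h hd; apply: H.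
  by rewrite /ball /= sub0r normrN normrcE -[d1 +i* 0]/(d1%:C) ltcR.
apply/nbhs_ballP; exists d%:C => /=; first by rewrite ltcR.
by move=> h; rewrite /ball /= sub0r normrN normrcE ltcR; exact: H.
Qed.

(** Dominated convergence works along sequences, while limits in the frequency are wanted in
    epsilon-delta form. A failure of the latter yields by choice a sequence of norms below 1/(n+1)
    on which the former fails too. [P] restricts to admissible increments, such as those that stay
    in the half plane. *)
Lemma seq_cvgc (P : set Co) (f : Co -> Co) (l : Co) :
  (forall h : nat -> Co, (forall n, P (h n)) -> h n @[n --> \oo] --> (0:Co) ->
     f (h n) @[n --> \oo] --> l) ->
  forall e : R, 0 < e -> exists2 d : R, 0 < d &
    forall h, P h -> normc h < d -> normc (f h - l) < e.
Proof.
move=> H e e0; apply: contrapT => /forall2NP N.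
have {}N n : exists h : Co, [/\ P h, normc h < n.+1%:R^-1 & ~ normc (f h - l) < e].
  have [|] := N (n.+1%:R^-1); first by rewrite invr_gt0.
  move=> /existsNP[h /not_implyP[Ph /not_implyP[h1 h2]]]; exists h; split => //.
have [h /all_and3[Ph hn hN]] := choice N.
have /cvgcP/(_ e e0)[n0 _ /(_ n0 (leqnn _))] : f (h n) @[n --> \oo] --> l.
  apply: H => //; apply/cvgcP => e' e'0; near=> n.
  rewrite subr0 (lt_trans (hn n)) //.
  by near: n; exact: near_infty_natSinv_lt (PosNum e'0).
by move=> /(hN n0).
Unshelve. all: by end_near. Qed.

Lemma cvgc_cst (T : Type) (F : set_system T) {FF : Filter F} (c : Co) :
  (fun=> c) @ F --> c.
Proof. by apply: cvg_ReIm; exact: cvg_cst. Qed.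

Lemma cvgcD (T : Type) (F : set_system T) {FF : Filter F} (f g : T -> Co) (k l : Co) :
  f @ F --> k -> g @ F --> l -> f x + g x @[x --> F] --> k + l.
Proof.
move=> fk gl; apply: cvg_ReIm.
- rewrite ReCD (_ : (fun x => _) = fun x => complex.Re (f x) + complex.Re (g x)).
    by apply: cvgD; exact: cvg_Re.
  by apply/funext => x; rewrite ReCD.
- rewrite ImCD (_ : (fun x => _) = fun x => complex.Im (f x) + complex.Im (g x)).
    by apply: cvgD; exact: cvg_Im.
  by apply/funext => x; rewrite ImCD.
Qed.

Lemma cvgcM (T : Type) (F : set_system T) {FF : Filter F} (f g : T -> Co) (k l : Co) :
  f @ F --> k -> g @ F --> l -> f x * g x @[x --> F] --> k * l.
Proof.
move=> fk gl; have [fr fi gr gi] := And4 (cvg_Re fk) (cvg_Im fk) (cvg_Re gl) (cvg_Im gl).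
apply: cvg_ReIm.
- rewrite ReCM (_ : (fun x => _) = fun x => complex.Re (f x) * complex.Re (g x) -
    complex.Im (f x) * complex.Im (g x)).
    by apply: cvgB; exact: cvgM.
  by apply/funext => x; rewrite ReCM.
- rewrite ImCM (_ : (fun x => _) = fun x => complex.Re (f x) * complex.Im (g x) +
    complex.Im (f x) * complex.Re (g x)).
    by apply: cvgD; exact: cvgM.
  by apply/funext => x; rewrite ImCM.
Qed.

Lemma cvgcN (T : Type) (F : set_system T) {FF : Filter F} (f : T -> Co) (k : Co) :
  f @ F --> k -> - f x @[x --> F] --> - k.
Proof.
move=> fk; apply: cvg_ReIm.
- rewrite ReCN (_ : (fun x => _) = fun x => - complex.Re (f x)).
    by apply: cvgN; exact: cvg_Re.
  by apply/funext => x; rewrite ReCN.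
- rewrite ImCN (_ : (fun x => _) = fun x => - complex.Im (f x)).
    by apply: cvgN; exact: cvg_Im.
  by apply/funext => x; rewrite ImCN.
Qed.

Lemma cvgcV (T : Type) (F : set_system T) {FF : Filter F} (f : T -> Co) (k : Co) :
  k != 0 -> f @ F --> k -> (f x)^-1 @[x --> F] --> k^-1.
Proof.
move=> k0 fk; have [fr fi] := (cvg_Re fk, cvg_Im fk).
have E (z : R[i]) : z^-1 = (complex.Re z / normc z ^+ 2) +i* (- complex.Im z / normc z ^+ 2).
  by rewrite normc_sqr; case: z => x y; rewrite mulNr.
have n0 : complex.Re k ^+ 2 + complex.Im k ^+ 2 != 0.
  by rewrite -normc_sqr expf_neq0 // normc_eq0.
have nc : complex.Re (f x) ^+ 2 + complex.Im (f x) ^+ 2 @[x --> F] -->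
    complex.Re k ^+ 2 + complex.Im k ^+ 2.
  by apply: cvgD; exact: cvgM.
apply: cvg_ReIm.
- rewrite E normc_sqr (_ : (fun x => _) = fun x => complex.Re (f x) *
    (complex.Re (f x) ^+ 2 + complex.Im (f x) ^+ 2)^-1).
    by apply: cvgM => //; exact: cvgV.
  by apply/funext => x; rewrite E normc_sqr.
- rewrite E normc_sqr (_ : (fun x => _) = fun x => - complex.Im (f x) *
    (complex.Re (f x) ^+ 2 + complex.Im (f x) ^+ 2)^-1).
    by apply: cvgM => //; [exact: cvgN|exact: cvgV].
  by apply/funext => x; rewrite E normc_sqr.
Qed.

End ComplexConvergence.

(** * Integrals of complex functions over intervals *)

Section IntervalIntegral.
Context {R : realType}.
Notation Co := ((R[i])^o).
Notation mu := (@lebesgue_measure R).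
Implicit Types (a b c K x : R) (f : R -> R) (g : R -> R[i]).

(** Carries what an integral over a compact interval needs: measurability of both parts and a bound,
    hence integrability. The bound stays a parameter because it enters later estimates and serves as
    the dominating constant. *)
Definition bounded_measurable a b g K :=
  [/\ measurable_fun `[a, b] (fun x => complex.Re (g x)),
      measurable_fun `[a, b] (fun x => complex.Im (g x)) &
      forall x, a <= x <= b -> normc (g x) <= K].

Definition cint a b g : R[i] := cintegral `[a, b] g.

Lemma integrable_bounded_itv a b f K :
  measurable_fun `[a, b] f -> (forall x, a <= x <= b -> `|f x| <= K) ->
  mu.-integrable `[a, b] (EFin \o f).
Proof.
move=> mf fK; apply: measurable_bounded_integrable => //.
  have := @lebesgue_measure_itv R `[a, b]; rewrite /= => ->.
  by case: ifP => _; rewrite ?ltry // -EFinB ltry.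
exists K; split; first by rewrite num_real.
by move=> M KM x /= xab; rewrite (le_trans _ (ltW KM)) // fK // -in_itv.
Qed.

Lemma bm_int_Re a b g K : bounded_measurable a b g K ->
  mu.-integrable `[a, b] (EFin \o (fun x => complex.Re (g x))).
Proof.
case=> mr _ gK; apply: (@integrable_bounded_itv _ _ _ K) => // x xab.
by rewrite (le_trans (ler_Re_normc _)) // gK.
Qed.

Lemma bm_int_Im a b g K : bounded_measurable a b g K ->
  mu.-integrable `[a, b] (EFin \o (fun x => complex.Im (g x))).
Proof.
case=> _ mi gK; apply: (@integrable_bounded_itv _ _ _ K) => // x xab.
by rewrite (le_trans (ler_Im_normc _)) // gK.
Qed.

Lemma bmD a b g1 g2 K1 K2 : bounded_measurable a b g1 K1 ->
  bounded_measurable a b g2 K2 ->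
  bounded_measurable a b (fun x => g1 x + g2 x) (K1 + K2).
Proof.
move=> [r1 i1 k1] [r2 i2 k2]; split.
- by under [X in measurable_fun _ X]eq_fun do rewrite ReCD; exact: measurable_funD.
- by under [X in measurable_fun _ X]eq_fun do rewrite ImCD; exact: measurable_funD.
- by move=> x xab; rewrite (le_trans (normcD _ _)) // lerD ?k1 ?k2.
Qed.

Lemma bmN a b g K : bounded_measurable a b g K ->
  bounded_measurable a b (fun x => - g x) K.
Proof.
move=> [r1 i1 k1]; split.
- by under [X in measurable_fun _ X]eq_fun do rewrite ReCN; exact: measurable_funN.
- by under [X in measurable_fun _ X]eq_fun do rewrite ImCN; exact: measurable_funN.
- by move=> x xab; rewrite normcNE k1.
Qed.

Lemma bmB a b g1 g2 K1 K2 : bounded_measurable a b g1 K1 ->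
  bounded_measurable a b g2 K2 ->
  bounded_measurable a b (fun x => g1 x - g2 x) (K1 + K2).
Proof. by move=> b1 b2; apply: bmD => //; exact: bmN. Qed.

Lemma bmM a b g1 g2 K1 K2 : bounded_measurable a b g1 K1 ->
  bounded_measurable a b g2 K2 ->
  bounded_measurable a b (fun x => g1 x * g2 x) (K1 * K2).
Proof.
move=> [r1 i1 k1] [r2 i2 k2]; split.
- under [X in measurable_fun _ X]eq_fun do rewrite ReCM.
  by apply: measurable_funB; exact: measurable_funM.
- under [X in measurable_fun _ X]eq_fun do rewrite ImCM.
  by apply: measurable_funD; exact: measurable_funM.
- by move=> x xab; rewrite normcM ler_pM ?normc_ge0 ?k1 ?k2.
Qed.

Lemma bm_cst a b (k : R[i]) : bounded_measurable a b (fun=> k) (normc k).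
Proof. by split. Qed.

Lemma bmZ a b k g K : bounded_measurable a b g K ->
  bounded_measurable a b (fun x => k * g x) (normc k * K).
Proof. by move=> bg; apply: bmM => //; exact: bm_cst. Qed.

Lemma bmJ a b g K : bounded_measurable a b g K ->
  bounded_measurable a b (fun x => (g x)^*) K.
Proof.
move=> [r1 i1 k1]; split.
- by under [X in measurable_fun _ X]eq_fun do rewrite ReCJ.
- by under [X in measurable_fun _ X]eq_fun do rewrite ImCJ; exact: measurable_funN.
- by move=> x xab; rewrite normcJ k1.
Qed.

Lemma bm_le a b g K K' : K <= K' -> bounded_measurable a b g K ->
  bounded_measurable a b g K'.
Proof. by move=> KK' [? ? k]; split=> // x /k /le_trans; apply. Qed.

Lemma bm_sub a b c d g K : a <= c -> d <= b -> bounded_measurable a b g K ->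
  bounded_measurable c d g K.
Proof.
move=> ac db [r1 i1 k1].
have S : `[c, d] `<=` `[a, b].
  by move=> x /=; rewrite !in_itv /= => /andP[? ?]; apply/andP; split; lra.
split; [exact: measurable_funS r1|exact: measurable_funS i1|].
by move=> x /andP[? ?]; apply: k1; apply/andP; split; lra.
Qed.

Lemma bm_eq a b g1 g2 K : (forall x, a <= x <= b -> g1 x = g2 x) ->
  bounded_measurable a b g1 K -> bounded_measurable a b g2 K.
Proof.
move=> E [r1 i1 k1]; split.
- apply: eq_measurable_fun r1 => x; rewrite inE /= in_itv /= => xab; by rewrite E.
- apply: eq_measurable_fun i1 => x; rewrite inE /= in_itv /= => xab; by rewrite E.
- by move=> x xab; rewrite -E // k1.
Qed.

Lemma bm_continuous a b (g : R -> Co) K :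
  {within `[a, b], continuous g} -> (forall x, a <= x <= b -> normc (g x) <= K) ->
  bounded_measurable a b g K.
Proof.
move=> cg gK; split=> //; apply: subspace_continuous_measurable_fun => //.
- move=> x; exact: cvg_Re (cg x).
- move=> x; exact: cvg_Im (cg x).
Qed.

Lemma within_continuous_bounded a b (g : R -> Co) :
  {within `[a, b], continuous g} ->
  exists K, forall x, a <= x <= b -> normc (g x) <= K.
Proof.
move=> cg; have [ab|ba] := leP a b; last first.
  by exists 0 => x /andP[ax xb]; lra.
have cn : {within `[a, b], continuous (fun x => normc (g x))}.
  move=> x; apply/cvgrPdist_lt => e e0.
  have /cvgcP/(_ e e0) := cg x; apply: filterS => y; apply: le_lt_trans.
  rewrite ler_norml; apply/andP; split.
  - by rewrite lerNl opprB subr_normc_le.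
  - by rewrite (le_trans (subr_normc_le _ _)) // normcBC.
have [c _ gc] := EVT_max ab cn; exists (normc (g c)) => x xab.
by apply: gc; rewrite in_itv.
Qed.

Lemma cintE a b g : cint a b g =
  (\int[mu]_(x in `[a, b]) complex.Re (g x)) +i*
  (\int[mu]_(x in `[a, b]) complex.Im (g x)).
Proof. by []. Qed.

Lemma cint_eq a b g1 g2 : (forall x, a <= x <= b -> g1 x = g2 x) ->
  cint a b g1 = cint a b g2.
Proof.
move=> E; rewrite /cint /cintegral; congr (_ +i* _);
  by apply: eq_Rintegral => x; rewrite inE /= in_itv /= => /E ->.
Qed.

Lemma cintD a b g1 g2 K1 K2 : bounded_measurable a b g1 K1 ->
  bounded_measurable a b g2 K2 ->
  cint a b (fun x => g1 x + g2 x) = cint a b g1 + cint a b g2.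
Proof.
move=> b1 b2; apply: complex_eq; rewrite ?ReCD ?ImCD /=.
- under eq_Rintegral do rewrite ReCD.
  by rewrite RintegralD //; [exact: bm_int_Re b1|exact: bm_int_Re b2].
- under eq_Rintegral do rewrite ImCD.
  by rewrite RintegralD //; [exact: bm_int_Im b1|exact: bm_int_Im b2].
Qed.

Lemma cintZ a b k g K : bounded_measurable a b g K ->
  cint a b (fun x => k * g x) = k * cint a b g.
Proof.
move=> b1; have i1 := bm_int_Re b1; have i2 := bm_int_Im b1.
have iZ (r : R) (f : R -> R) : mu.-integrable `[a, b] (EFin \o f) ->
    mu.-integrable `[a, b] (EFin \o (fun x => r * f x)).
  move=> fi; have := @integrableZl _ _ _ mu `[a, b]%classic (measurable_itv _) r _ fi.
  by apply: eq_integrable.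
apply: complex_eq; rewrite ?ReCM ?ImCM /=.
- under eq_Rintegral do rewrite ReCM.
  by rewrite RintegralB ?RintegralZl //; exact: iZ.
- under eq_Rintegral do rewrite ImCM.
  by rewrite RintegralD ?RintegralZl //; exact: iZ.
Qed.

Lemma cintN a b g K : bounded_measurable a b g K ->
  cint a b (fun x => - g x) = - cint a b g.
Proof.
move=> b1; rewrite -mulN1r -(cintZ _ b1).
by apply: cint_eq => x _; rewrite mulN1r.
Qed.

Lemma cintB a b g1 g2 K1 K2 : bounded_measurable a b g1 K1 ->
  bounded_measurable a b g2 K2 ->
  cint a b (fun x => g1 x - g2 x) = cint a b g1 - cint a b g2.
Proof.
by move=> b1 b2; rewrite (cintD b1 (bmN b2)) (cintN b2).
Qed.

Lemma Rintegral_itv_cst a b K : a <= b -> \int[mu]_(x in `[a, b]) K = K * (b - a).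
Proof.
move=> ab; rewrite Rintegral_cst //; congr (_ * _).
have := @lebesgue_measure_itv R `[a, b]; rewrite /= => ->.
move: ab; rewrite le_eqVlt => /orP[/eqP->|ab]; first by rewrite lte_fin ltxx subrr.
by rewrite lte_fin ab.
Qed.

Lemma cint_cst a b k : a <= b -> cint a b (fun=> k) = k * (b - a)%:C.
Proof.
move=> ab; apply: complex_eq; rewrite ?ReCM ?ImCM /= Rintegral_itv_cst //.
  by rewrite mulr0 subr0.
by rewrite mulr0 add0r.
Qed.

Lemma cintJ a b g K : bounded_measurable a b g K ->
  cint a b (fun x => (g x)^*) = (cint a b g)^*.
Proof.
move=> bg; apply: complex_eq; rewrite ?ReCJ ?ImCJ /=.
- by apply: eq_Rintegral => x _; rewrite ReCJ.
- under eq_Rintegral do rewrite ImCJ -mulN1r.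
  by rewrite RintegralZl ?mulN1r //; exact: bm_int_Im bg.
Qed.

(** The factor 2 comes from bounding real and imaginary part separately. It reappears in the rate
    [4 * K] of [gronwall] and in the constant of [cauchy_estimate]. *)
Lemma normc_cint_le_fun a b g K (k : R -> R) : bounded_measurable a b g K ->
  mu.-integrable `[a, b] (EFin \o k) -> (forall x, a <= x <= b -> normc (g x) <= k x) ->
  normc (cint a b g) <= 2 * \int[mu]_(x in `[a, b]) k x.
Proof.
move=> bg ik gk; apply: (le_trans (normc_le_ReIm _)) => /=.
have H (f : R -> R) : mu.-integrable `[a, b] (EFin \o f) ->
    (forall x, a <= x <= b -> `|f x| <= k x) ->
    `|\int[mu]_(x in `[a, b]) f x| <= \int[mu]_(x in `[a, b]) k x.
  move=> fi fk; apply: (le_trans (le_normr_Rintegral _ fi)) => //.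
  by apply: le_Rintegral => //; exact: (integrable_abse fi).
have h1 := H _ (bm_int_Re bg) (fun x xab => le_trans (ler_Re_normc _) (gk x xab)).
have h2 := H _ (bm_int_Im bg) (fun x xab => le_trans (ler_Im_normc _) (gk x xab)).
by apply: (le_trans (lerD h1 h2)); rewrite mulrDl mul1r.
Qed.

Lemma normc_cint_le a b g K : a <= b -> bounded_measurable a b g K ->
  normc (cint a b g) <= 2 * K * (b - a).
Proof.
move=> ab bg; have [_ _ gK] := bg.
rewrite -mulrA -Rintegral_itv_cst //; apply: (normc_cint_le_fun bg) => //.
exact: (@integrable_bounded_itv _ _ (fun=> K) `|K|).
Qed.

Lemma Rintegral_split a b c f : mu.-integrable `[a, c] (EFin \o f) ->
  a <= b -> b <= c ->
  \int[mu]_(x in `[a, c]) f x =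
  \int[mu]_(x in `[a, b]) f x + \int[mu]_(x in `[b, c]) f x.
Proof.
move=> fi ab bc; have := @Rintegral_itvB R f (BLeft a) (BRight c) b fi.
rewrite !bnd_simp => /(_ ab bc) /(canRL (subrK _)); rewrite addrC => ->.
rewrite Rintegral_itv_obnd_cbnd //.
apply: (integrableS _ _ _ fi); [exact: measurable_itv|exact: measurable_itv|].
by move=> x /=; rewrite !in_itv /= => /andP[? ?]; apply/andP; split; lra.
Qed.

Lemma cint_split a b c g K : bounded_measurable a c g K -> a <= b -> b <= c ->
  cint a c g = cint a b g + cint b c g.
Proof.
move=> bg ab bc; apply: complex_eq; rewrite ?ReCD ?ImCD /= (@Rintegral_split a b c) //.
- exact: bm_int_Re bg.
- exact: bm_int_Im bg.
Qed.

Lemma Rintegral_cvg a b K (f_ : nat -> R -> R) f :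
  (forall n, measurable_fun `[a, b] (f_ n)) ->
  (forall n x, a <= x <= b -> `|f_ n x| <= K) ->
  (forall x, a <= x <= b -> f_ n x @[n --> \oo] --> f x) ->
  measurable_fun `[a, b] f /\
  \int[mu]_(x in `[a, b]) f_ n x @[n --> \oo] --> \int[mu]_(x in `[a, b]) f x.
Proof.
move=> mf fK ff.
have ff' x : `[a, b]%classic x -> f_ ^~ x @ \oo --> f x.
  by rewrite /= in_itv /=; exact: ff.
have mlim : measurable_fun `[a, b] f by exact: measurable_fun_cvg mf ff'.
split=> //.
have iK : mu.-integrable `[a, b] (EFin \o (fun=> K)).
  exact: (@integrable_bounded_itv _ _ (fun=> K) `|K|).
have [] := @dominated_convergence _ _ _ mu `[a, b]%classic (measurable_itv _)
  (fun n => EFin \o f_ n) (EFin \o f) (EFin \o (fun=> K)).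
- by move=> n; apply/measurable_EFinP; exact: mf.
- by apply/measurable_EFinP; exact: mlim.
- by apply: aeW => x xab; apply/fine_cvgP; split; [exact: nearW|exact: ff'].
- exact: iK.
- apply: aeW => x n /=; rewrite in_itv /= => xab.
  by rewrite lee_fin fK.
move=> fi _; have mI : measurable (`[a, b]%classic : set (measurableTypeR R)) by [].
rewrite -(fineK (integrable_fin_num mI fi)) => /fine_cvgP[_]; exact: cvg_trans.
Qed.

Lemma cint_cvg a b K (g_ : nat -> R -> Co) (g : R -> Co) :
  (forall n, bounded_measurable a b (g_ n) K) ->
  (forall x, a <= x <= b -> g_ n x @[n --> \oo] --> g x) ->
  bounded_measurable a b g K /\
  (cint a b (g_ n) : Co) @[n --> \oo] --> (cint a b g : Co).
Proof.
move=> bg gg.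
have [mr cr] := @Rintegral_cvg a b K (fun n x => complex.Re (g_ n x)) (fun x => complex.Re (g x))
  (fun n => let: And3 r _ _ := bg n in r)
  (fun n x xab => le_trans (ler_Re_normc _) (let: And3 _ _ k := bg n in k x xab))
  (fun x xab => cvg_Re (gg x xab)).
have [mi ci] := @Rintegral_cvg a b K (fun n x => complex.Im (g_ n x)) (fun x => complex.Im (g x))
  (fun n => let: And3 _ i _ := bg n in i)
  (fun n x xab => le_trans (ler_Im_normc _) (let: And3 _ _ k := bg n in k x xab))
  (fun x xab => cvg_Im (gg x xab)).
split; last exact: cvg_ReIm.
split=> // x xab; apply/ler_addgt0Pr => e e0.
have /cvgcP/(_ e e0)[n0 _ /(_ n0 (leqnn _)) /= h] := gg x xab.
have [_ _ /(_ _ xab) k] := bg n0.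
have := normcD (g_ n0 x) (- (g_ n0 x - g x)).
by rewrite normcNE opprB addrC subrK => h'; lra.
Qed.

End IntervalIntegral.

(** * Linear systems with bounded measurable coefficients *)

Section LinearSystem.
Context {R : realType}.
Notation Co := ((R[i])^o).
Notation mu := (@lebesgue_measure R).
Implicit Types (a x y : R).

Lemma le0_halving (t c : R) : (forall n, t <= c / 2 ^+ n) -> t <= 0.
Proof.
move=> H; rewrite leNgt; apply/negP => t0.
have c0 : 0 <= c by have := H 0%N; rewrite expr0 divr1; apply: le_trans; exact: ltW.
have := archi_boundP (divr_ge0 c0 (ltW t0)); set n := Num.bound _ => hn.
have : c / t < 2 ^+ n.
  apply: (lt_le_trans hn); rewrite -natrX ler_nat; exact/ltnW/ltn_expl.
rewrite ltr_pdivrMr // mulrC -ltr_pdivrMr ?exprn_gt0 // ltNge.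
by rewrite H.
Qed.

(** Bisection: the two halves of an interval contribute a quarter of the bound each, so every
    bisection halves it. This takes the place of a vanishing derivative for functions that need not
    be differentiable everywhere. *)
Lemma constant_of_quadratic_increments a K (phi : R -> R[i]) :
  (forall x y, 0 <= x -> x <= y -> y <= a ->
    normc (phi y - phi x) <= K * (y - x) ^+ 2) ->
  forall x, 0 <= x <= a -> phi x = phi 0.
Proof.
move=> H x /andP[x0 xa].
have Hn n : forall x y, 0 <= x -> x <= y -> y <= a ->
    normc (phi y - phi x) <= K * (y - x) ^+ 2 / 2 ^+ n.
  elim: n => [|n IH] s t s0 st ta; first by rewrite expr0 divr1 H.
  pose m := (s + t) / 2.
  have h1 := IH s m s0 ltac:(rewrite /m; lra) ltac:(rewrite /m; lra).
  have h2 := IH m t ltac:(rewrite /m; lra) ltac:(rewrite /m; lra) ta.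
  have -> : phi t - phi s = (phi t - phi m) + (phi m - phi s) by rewrite addrA subrK.
  apply: (le_trans (normcD _ _)); apply: (le_trans (lerD h2 h1)).
  rewrite /m [2 ^+ n.+1]exprS le_eqVlt; apply/orP; left; apply/eqP; field.
  by rewrite expf_neq0.
apply/eqP; rewrite -subr_eq0 -normc_eq0 eq_le normc_ge0 andbT.
by apply: le0_halving => n; exact: Hn.
Qed.

Lemma bm_bound a b g K K' : @bounded_measurable R a b g K ->
  (forall x, a <= x <= b -> normc (g x) <= K') -> bounded_measurable a b g K'.
Proof. by case. Qed.

(** Caratheodory's reading of u' = f, with the initial value left free. *)
Definition primitive_of a (f u : R -> R[i]) :=
  forall x, 0 <= x <= a -> u x = u 0 + cint 0 x f.

Lemma primitive_increment a K f u x y : bounded_measurable 0 a f K ->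
  primitive_of a f u -> 0 <= x -> x <= y -> y <= a -> u y - u x = cint x y f.
Proof.
move=> bf pu x0 xy ya; rewrite (pu y) ?(pu x); try by apply/andP; split; lra.
rewrite (@cint_split _ 0 x y f K) //; first by ring.
exact: bm_sub bf.
Qed.

Lemma primitive_lipschitz a K f u x y : bounded_measurable 0 a f K ->
  primitive_of a f u -> 0 <= x -> x <= y -> y <= a ->
  normc (u y - u x) <= 2 * K * (y - x).
Proof.
move=> bf pu x0 xy ya; rewrite (primitive_increment bf pu) //.
by apply: normc_cint_le => //; exact: bm_sub bf.
Qed.

(** Product rule without derivatives. The defect [phi] grows between [x] and [y] by the integral of
    [f s * (w y - w s) + (u x - u s) * g s]; as [u] and [w] are Lipschitz, this integrand is O(y -
    x), so the increments of [phi] are quadratic and [phi] is constant. *)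
Lemma primitive_mul a Kf Kg Ku Kw f g u w :
  bounded_measurable 0 a f Kf -> bounded_measurable 0 a g Kg ->
  bounded_measurable 0 a u Ku -> bounded_measurable 0 a w Kw ->
  primitive_of a f u -> primitive_of a g w ->
  primitive_of a (fun s => f s * w s + u s * g s) (fun s => u s * w s).
Proof.
move=> bf bg bu bw pu pw x /andP[x0 xa].
pose h s := f s * w s + u s * g s.
have bh : bounded_measurable 0 a h (Kf * Kw + Ku * Kg) by apply: bmD; exact: bmM.
pose phi x := u x * w x - cint 0 x h.
have Kf0 : 0 <= Kf.
  by case: bf => _ _ /(_ 0); rewrite lexx (le_trans x0 xa) => /(_ isT); apply: le_trans; exact: normc_ge0.
have Kg0 : 0 <= Kg.
  by case: bg => _ _ /(_ 0); rewrite lexx (le_trans x0 xa) => /(_ isT); apply: le_trans; exact: normc_ge0.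
suff : phi x = phi 0.
  rewrite /phi => E.
  have -> : u x * w x = (u x * w x - cint 0 x h) + cint 0 x h by rewrite subrK.
  rewrite E; congr (_ + _).
  rewrite -[RHS]subr0; congr (_ - _); apply/eqP; rewrite -normc_eq0 eq_le normc_ge0 andbT.
  apply: (le_trans (normc_cint_le (lexx 0) (bm_sub (lexx 0) (le_trans x0 xa) bh))).
  by rewrite subrr mulr0.
(* The 8 is the 4 of [bb] below times the factor 2 of [normc_cint_le]. *)
apply: (@constant_of_quadratic_increments a (8 * Kf * Kg)); last by rewrite x0.
move=> {xa x0} {}x y x0 xy ya.
have B k K : bounded_measurable 0 a k K -> bounded_measurable x y k K.
  by move=> bk; exact: bm_sub bk.
have E : phi y - phi x = cint x y (fun s => f s * (w y - w s) + (u x - u s) * g s).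
  have -> : phi y - phi x = (u y - u x) * w y + u x * (w y - w x) - cint x y h.
    by rewrite /phi (@cint_split _ 0 x y h _ (bm_sub (lexx 0) ya bh)) //; ring.
  rewrite (primitive_increment bf pu) // (primitive_increment bg pw) //.
  rewrite [_ * w y]mulrC -(cintZ _ (B _ _ bf)) -(cintZ _ (B _ _ bg)).
  rewrite -(cintD (bmZ _ (B _ _ bf)) (bmZ _ (B _ _ bg))).
  rewrite -(cintB (bmD (bmZ _ (B _ _ bf)) (bmZ _ (B _ _ bg))) (B _ _ bh)).
  by apply: cint_eq => s _; rewrite /h; ring.
rewrite E.
have bb : bounded_measurable x y (fun s => f s * (w y - w s) + (u x - u s) * g s)
    (4 * Kf * Kg * (y - x)).
  apply: bm_bound.
    apply: bmD.
      by apply: bmM; [exact: B bf|apply: bmB; [exact: bm_cst|exact: B bw]].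
    by apply: bmM; [apply: bmB; [exact: bm_cst|exact: B bu]|exact: B bg].
  move=> s /andP[xs sy]; apply: (le_trans (normcD _ _)); rewrite !normcM.
  have h1 : normc (f s) <= Kf by case: bf => _ _; apply; apply/andP; split; lra.
  have h2 : normc (g s) <= Kg by case: bg => _ _; apply; apply/andP; split; lra.
  have h3 : normc (w y - w s) <= 2 * Kg * (y - s).
    by apply: (primitive_lipschitz bg pw) => //; lra.
  have h4 : normc (u x - u s) <= 2 * Kf * (s - x).
    by rewrite normcBC; apply: (primitive_lipschitz bf pu) => //; lra.
  have h5 := ler_pM (normc_ge0 _) (normc_ge0 _) h1 h3.
  have h6 := ler_pM (normc_ge0 _) (normc_ge0 _) h4 h2.
  apply: (le_trans (lerD h5 h6)).
  have := mulr_ge0 Kf0 Kg0; nra.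
apply: (le_trans (normc_cint_le xy bb)).
by rewrite le_eqVlt; apply/orP; left; apply/eqP; ring.
Qed.

(* The system u' = al v, v' = be u in the Caratheodory sense; K bounds the
   coefficients and S the solution. *)
Definition system_solution a K S (al be u v : R -> R[i]) :=
  [/\ bounded_measurable 0 a al K, bounded_measurable 0 a be K,
      bounded_measurable 0 a u S, bounded_measurable 0 a v S &
      primitive_of a (fun s => al s * v s) u /\
      primitive_of a (fun s => be s * u s) v].

(* With equal coefficients this is the constancy of the determinant, with different
   ones it is the variation of constants formula, and for the conjugate solution
   (conj u, - conj v) it is the balance of energy. *)
Lemma wronskian a K1 S1 K2 S2 al1 be1 u1 v1 al2 be2 u2 v2 :
  system_solution a K1 S1 al1 be1 u1 v1 -> system_solution a K2 S2 al2 be2 u2 v2 ->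
  forall x, 0 <= x <= a -> u1 x * v2 x - v1 x * u2 x =
    u1 0 * v2 0 - v1 0 * u2 0 +
    cint 0 x (fun s => (be2 s - be1 s) * (u1 s * u2 s) - (al2 s - al1 s) * (v1 s * v2 s)).
Proof.
move=> [ba1 bb1 bu1 bv1 [pu1 pv1]] [ba2 bb2 bu2 bv2 [pu2 pv2]] x xa.
have P1 := primitive_mul (bmM ba1 bv1) (bmM bb2 bu2) bu1 bv2 pu1 pv2.
have P2 := primitive_mul (bmM bb1 bu1) (bmM ba2 bv2) bv1 bu2 pv1 pu2.
rewrite (P1 x xa) (P2 x xa).
have L k K : bounded_measurable 0 a k K -> bounded_measurable 0 x k K.
  by move=> bk; apply: bm_sub bk => //; case/andP: xa.
have -> : cint 0 x (fun s => (be2 s - be1 s) * (u1 s * u2 s) - (al2 s - al1 s) * (v1 s * v2 s)) =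
  cint 0 x (fun s => al1 s * v1 s * v2 s + u1 s * (be2 s * u2 s)) -
  cint 0 x (fun s => be1 s * u1 s * u2 s + v1 s * (al2 s * v2 s)).
  rewrite -(cintB (L _ _ (bmD (bmM (bmM ba1 bv1) bv2) (bmM bu1 (bmM bb2 bu2))))
    (L _ _ (bmD (bmM (bmM bb1 bu1) bu2) (bmM bv1 (bmM ba2 bv2))))).
  by apply: cint_eq => s _; ring.
by ring.
Qed.

Lemma continuous_expRM (L : R) : continuous (fun s : R => expR (L * s)).
Proof.
move=> s; apply: continuous_comp; last exact: continuous_expR.
by apply: cvgM; [exact: cvg_cst|exact: cvg_id].
Qed.

Lemma Rintegral_expR (L x : R) : 0 < L -> 0 <= x ->
  \int[mu]_(s in `[0, x]) expR (L * s) = (expR (L * x) - 1) / L.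
Proof.
move=> L0; rewrite le_eqVlt => /orP[/eqP <-|x0].
  rewrite mulr0 expR0 subrr mul0r set_itv1; exact: Rintegral_set1.
have dF (s : R) : is_derive s 1 (fun s => expR (L * s) / L) (expR (L * s)).
  by apply: is_derive_eq; rewrite /GRing.scale /=; field; lra.
have := @continuous_FTC2 R (fun s => expR (L * s)) (fun s => expR (L * s) / L) 0 x x0.
rewrite /Rintegral => -> //=.
- by rewrite mulr0 expR0; ring.
- by apply: continuous_subspaceT; exact: continuous_expRM.
- have cF : continuous (fun s => expR (L * s) / L).
    move=> s; apply: cvgM; last exact: cvg_cst; exact: continuous_expRM.
  split.
  + by move=> s _; exact: ex_derive.
  + by apply: cvg_at_right_filter; exact: cF.
  + by apply: cvg_at_left_filter; exact: cF.
- by move=> s _; rewrite derive1E; exact: derive_val.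
Qed.

Lemma one_le_expR (t : R) : 0 <= t -> 1 <= expR t.
Proof. by move=> t0; apply: le_trans (expR_ge1Dx t); lra. Qed.

(* Iterating the integral equation improves a bound c expR (4 K x) of the solution to
   (A + c / 2) expR (4 K x); the fixed point of the iteration is c = 2 A. *)
Lemma gronwall a K S A al be u v : 0 < K -> 0 <= S ->
  system_solution a K S al be u v -> normc (u 0) <= A -> normc (v 0) <= A ->
  forall x, 0 <= x <= a ->
    normc (u x) <= 2 * A * expR (4 * K * a) /\ normc (v x) <= 2 * A * expR (4 * K * a).
Proof.
move=> K0 S0 [ba bb bu bv [pu pv]] uA vA.
have A0 : 0 <= A by apply: le_trans uA; exact: normc_ge0.
have L0 : 0 < 4 * K by lra.
(* One iteration passes a bound from one component to the other: [2 * K * c] times the integral of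
   [expR (4 * K * s)] over [0, x] is c / 2 times [expR (4 * K * x) - 1]. The rate [4 * K] is chosen
   to produce this 1/2. *)
have step c al' (w z : R -> R[i]) : 0 <= c -> bounded_measurable 0 a al' K ->
    bounded_measurable 0 a w S ->
    primitive_of a (fun s => al' s * w s) z -> normc (z 0) <= A ->
    (forall x, 0 <= x <= a -> normc (w x) <= c * expR (4 * K * x)) ->
    forall x, 0 <= x <= a -> normc (z x) <= (A + c / 2) * expR (4 * K * x).
  move=> c0 bal bw pz zA wc x xa; have /andP[x0 xa'] := xa.
  rewrite (pz x xa); apply: (le_trans (normcD _ _)).
  have e1 : 1 <= expR (4 * K * x) by apply: one_le_expR; apply: mulr_ge0 => //; lra.
  have mI : mu.-integrable `[0, x] (EFin \o (fun s => K * c * expR (4 * K * s))).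
    apply: (@integrable_bounded_itv _ _ _ _ (K * c * expR (4 * K * x))).
      apply: measurable_funM => //; apply: subspace_continuous_measurable_fun => //.
      by apply: continuous_subspaceT; exact: continuous_expRM.
    move=> s /andP[s0 sx]; rewrite ger0_norm; last first.
      by rewrite !mulr_ge0 ?expR_ge0 // ltW.
    by rewrite ler_wpM2l ?mulr_ge0 ?(ltW K0) // ler_expR ler_wpM2l // ltW.
  have := @normc_cint_le_fun _ 0 x (fun s => al' s * w s) _
    (fun s => K * c * expR (4 * K * s)) (bm_sub (lexx 0) xa' (bmM bal bw)) mI.
  have iE : mu.-integrable `[0, x] (EFin \o (fun s => expR (4 * K * s))).
    apply: (@integrable_bounded_itv _ _ _ _ (expR (4 * K * x))).
      apply: subspace_continuous_measurable_fun => //.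
      by apply: continuous_subspaceT; exact: continuous_expRM.
    move=> s /andP[s0 sx]; rewrite ger0_norm ?expR_ge0 //.
    by rewrite ler_expR ler_wpM2l // ltW.
  rewrite RintegralZl // Rintegral_expR // => h.
  have {}h : normc (cint 0 x (fun s => al' s * w s)) <=
      2 * (K * c * ((expR (4 * K * x) - 1) / (4 * K))).
    apply: h => s /andP[s0 sx]; rewrite normcM -mulrA ler_pM ?normc_ge0 //.
    + by case: bal => _ _; apply; apply/andP; split; lra.
    + by apply: wc; apply/andP; split; lra.
  have E : 2 * (K * c * ((expR (4 * K * x) - 1) / (4 * K))) = c / 2 * (expR (4 * K * x) - 1).
    by field; lra.
  rewrite E in h; apply: (le_trans (lerD zA h)).
  by nra.
(* The iteration starts from [c = 2 * A + S], valid because [S] bounds the solution, and each round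
   halves the excess over the fixed point [2 * A]. *)
have main n : forall x, 0 <= x <= a ->
    normc (u x) <= (2 * A + S / 2 ^+ n) * expR (4 * K * x) /\
    normc (v x) <= (2 * A + S / 2 ^+ n) * expR (4 * K * x).
  elim: n => [x xa|n IH x xa].
    have e1 : 1 <= expR (4 * K * x).
      by apply: one_le_expR; apply: mulr_ge0; [exact: ltW|case/andP: xa].
    have hu : normc (u x) <= S by case: bu => _ _; apply.
    have hv : normc (v x) <= S by case: bv => _ _; apply.
    rewrite expr0 divr1.
    have : 2 * A + S <= (2 * A + S) * expR (4 * K * x) by rewrite ler_peMr //; lra.
    by move=> ?; split; lra.
  have c0 : 0 <= 2 * A + S / 2 ^+ n by rewrite addr_ge0 ?mulr_ge0 // divr_ge0 // exprn_ge0.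
  have E : 2 * A + S / 2 ^+ n.+1 = A + (2 * A + S / 2 ^+ n) / 2.
    by rewrite exprS; field; rewrite expf_neq0.
  rewrite E; split.
  - by apply: (step _ al v u) => // s /IH[].
  - by apply: (step _ be u v) => // s /IH[].
move=> x xa.
have e1 : 0 <= expR (4 * K * x) by exact: expR_ge0.
have e2 : expR (4 * K * x) <= expR (4 * K * a).
  by rewrite ler_expR ler_wpM2l ?(ltW L0) //; case/andP: xa.
have fin t : (forall n, t <= (2 * A + S / 2 ^+ n) * expR (4 * K * x)) ->
    t <= 2 * A * expR (4 * K * a).
  move=> H; have : t - 2 * A * expR (4 * K * x) <= 0.
    apply: (@le0_halving _ (S * expR (4 * K * x))) => n.
    by have := H n; rewrite mulrDl mulrAC; lra.
  have : 2 * A * expR (4 * K * x) <= 2 * A * expR (4 * K * a) by rewrite ler_wpM2l // mulr_ge0.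
  lra.
by split; apply: fin => n; have [] := main n x xa.
Qed.

End LinearSystem.

(** * The propagator at a fixed frequency *)

Section Propagator.
Context {R : realType} (a : R) (rho' C' : R -> R[i] -> R[i])
  (M : R -> R[i] -> 'M[R[i]]_2).
Context (ha : 0 < a) (hrho' : slab_parameter a rho') (hC' : slab_parameter a C')
  (hM : is_propagator a rho' C' M).
Notation Co := ((R[i])^o).
Notation mu := (@lebesgue_measure R).
Notation I := (0 +i* 1 : R[i]).

Definition coef (f : R -> R[i] -> R[i]) (w : R[i]) (s : R) : R[i] := I * w * f s w.

Lemma slab_bound : exists2 B : R, 0 < B & forall x w, 0 <= x <= a -> 0 <= complex.Im w ->
  normc (rho' x w) <= B /\ normc (C' x w) <= B.
Proof.
have [[B1 H1] [B2 H2]] := (slab_bounded hrho', slab_bounded hC').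
exists (1 + `|B1| + `|B2|) => [|x w xa w0].
  by have := normr_ge0 B1; have := normr_ge0 B2; lra.
have := H1 x w xa w0; rewrite normrcE lecR => h1.
have := H2 x w xa w0; rewrite normrcE lecR => h2.
have := ler_norm B1; have := ler_norm B2.
by have := normr_ge0 B1; have := normr_ge0 B2; lra.
Qed.

Lemma bm_parameter f (B : R) w : slab_parameter a f -> 0 <= complex.Im w ->
  (forall x, 0 <= x <= a -> normc (f x w) <= B) ->
  bounded_measurable 0 a (f ^~ w) B.
Proof.
move=> hf w0 fB; split=> //; first exact: (slab_measurable_Re hf).
exact: (slab_measurable_Im hf).
Qed.

Lemma bm_coef f (B r : R) w : slab_parameter a f -> 0 <= complex.Im w ->
  (forall x, 0 <= x <= a -> normc (f x w) <= B) -> normc w <= r -> 0 <= B ->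
  bounded_measurable 0 a (coef f w) (r * B).
Proof.
move=> hf w0 fB wr B0; apply: bm_le (bmZ (I * w) (bm_parameter hf w0 fB)).
by rewrite normcM normc_i mul1r ler_wpM2r.
Qed.

Lemma cint00 (g : R -> R[i]) : cint 0 0 g = 0.
Proof. by rewrite cintE set_itv1 !Rintegral_set1. Qed.

Lemma ord2P (i : 'I_2) : i = 0 \/ i = 1.
Proof. by case: i => [[|[|//]]] p; [left|right]; apply/val_inj. Qed.

Lemma sum_ord2 (F : 'I_2 -> R[i]) : \sum_(i < 2) F i = F 0 + F 1.
Proof.
by rewrite big_ord_recl big_ord1; congr (_ + F _); apply/val_inj.
Qed.

Lemma propagator0 w : 0 <= complex.Im w -> M 0 w = 1%:M.
Proof.
move=> w0; apply/matrixP => i j; have [_ H] := hM w0.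
by rewrite (H 0 i j) ?lexx ?(ltW ha) // -/(cint 0 0 _) cint00 addr0.
Qed.

(** A column of [M] is a pair of velocity and pressure: index 0 is driven by [C'], index 1 by
    [rho']. *)
Lemma propagator_primitive w j : 0 <= complex.Im w ->
  primitive_of a (fun s => coef C' w s * M s w 1 j) (fun x => M x w 0 j) /\
  primitive_of a (fun s => coef rho' w s * M s w 0 j) (fun x => M x w 1 j).
Proof.
move=> w0; have [_ H] := hM w0; split=> x xa; rewrite (H x _ _ xa) propagator0 //;
  congr (_ + _); apply: cint_eq => s _.
- by rewrite !mxE sum_ord2 !mxE /= mul0r add0r /coef !mulrA.
- by rewrite !mxE sum_ord2 !mxE /= mul0r addr0 /coef !mulrA.
Qed.

(** The bound is uniform over all frequencies with [normc w <= r], as dominated convergence in [w]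
    requires. Continuity of [M] in [x] first gives a bound that depends on [w]; Gronwall's
    inequality, with initial data of modulus at most 1, replaces it by the uniform one. *)
Lemma propagator_solution (B r : R) : 0 < B -> 0 < r ->
  (forall x w, 0 <= x <= a -> 0 <= complex.Im w ->
     normc (rho' x w) <= B /\ normc (C' x w) <= B) ->
  forall w j, 0 <= complex.Im w -> normc w <= r ->
  system_solution a (r * B) (2 * expR (4 * (r * B) * a))
    (coef C' w) (coef rho' w) (fun x => M x w 0 j) (fun x => M x w 1 j).
Proof.
move=> B0 r0 HB w j w0 wr.
have bC : bounded_measurable 0 a (coef C' w) (r * B).
  by apply: bm_coef => //; [move=> x xa; case: (HB x w xa w0)|exact: ltW].
have brho : bounded_measurable 0 a (coef rho' w) (r * B).
  by apply: bm_coef => //; [move=> x xa; case: (HB x w xa w0)|exact: ltW].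
have [cM _] := hM w0.
have [K0 H0] := within_continuous_bounded (cM 0 j).
have [K1 H1] := within_continuous_bounded (cM 1 j).
have a00 : 0 <= (0 : R) <= a by rewrite lexx ltW.
have K00 : 0 <= K0 by apply: le_trans (H0 0 a00); exact: normc_ge0.
have K10 : 0 <= K1 by apply: le_trans (H1 0 a00); exact: normc_ge0.
have sol : system_solution a (r * B) (K0 + K1)
    (coef C' w) (coef rho' w) (fun x => M x w 0 j) (fun x => M x w 1 j).
  split=> //; last exact: propagator_primitive.
  - by apply: (bm_continuous (cM 0 j)) => x /H0; lra.
  - by apply: (bm_continuous (cM 1 j)) => x /H1; lra.
have d01 i : normc (M 0 w i j) <= 1.
  rewrite propagator0 // mxE; case: eqP => _; rewrite ?normc1 //.
  by rewrite normc0.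
have G := gronwall (mulr_gt0 r0 B0) (addr_ge0 K00 K10) sol (d01 0) (d01 1).
case: sol => b1 b2 b3 b4 b5; split=> //.
- by apply: bm_bound b3 _ => x /G[]; rewrite mulr1.
- by apply: bm_bound b4 _ => x /G[_]; rewrite mulr1.
Qed.

Lemma propagator_solution_ex w j : 0 <= complex.Im w -> exists K S,
  system_solution a K S
    (coef C' w) (coef rho' w) (fun x => M x w 0 j) (fun x => M x w 1 j).
Proof.
move=> w0; have [B B0 HB] := slab_bound.
have r0 : 0 < normc w + 1 by rewrite ltr_wpDl // normc_ge0.
by eexists; eexists; apply: (propagator_solution B0 r0 HB) => //; lra.
Qed.

Lemma propagator_det x w : 0 <= x <= a -> 0 <= complex.Im w ->
  M x w 0 0 * M x w 1 1 - M x w 1 0 * M x w 0 1 = 1.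
Proof.
move=> xa w0; have [K [S s0]] := propagator_solution_ex 0 w0.
have [K' [S' s1]] := propagator_solution_ex 1 w0.
rewrite (wronskian s0 s1 xa) propagator0 // !mxE /= mulr0 subr0 mulr1.
rewrite -[RHS]addr0; congr (_ + _); rewrite -[RHS](mul0r x%:C) -[X in X%:C]subr0.
rewrite -cint_cst; last by case/andP: xa.
by apply: cint_eq => s _; ring.
Qed.

(** The integral term of [wronskian] for column [k] of the propagator at [w] against the solution
    [(u, v)]. *)
Definition duhamel_integral w (al be u v : R -> R[i]) k x :=
  cint 0 x (fun s => (be s - coef rho' w s) * (M s w 0 k * u s) -
                     (al s - coef C' w s) * (M s w 1 k * v s)).

(* Variation of constants; since the determinant is 1, the inverse of the
   fundamental matrix is spelled out as its adjugate. *)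
Lemma duhamel K S al be u v w x : system_solution a K S al be u v ->
  0 <= x <= a -> 0 <= complex.Im w ->
  u x = M x w 0 0 * u 0 + M x w 0 1 * v 0 +
    (M x w 0 1 * duhamel_integral w al be u v 0 x -
     M x w 0 0 * duhamel_integral w al be u v 1 x) /\
  v x = M x w 1 0 * u 0 + M x w 1 1 * v 0 +
    (M x w 1 1 * duhamel_integral w al be u v 0 x -
     M x w 1 0 * duhamel_integral w al be u v 1 x).
Proof.
move=> sol xa w0.
have [K0 [S0 s0]] := propagator_solution_ex 0 w0.
have [K1 [S1 s1]] := propagator_solution_ex 1 w0.
have := wronskian s0 sol xa; have := wronskian s1 sol xa.
rewrite propagator0 // !mxE /= !mul0r !mul1r -!/(duhamel_integral _ _ _ _ _ _ _) => E1 E0.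
have D := propagator_det xa w0.
(* The two Wronskian identities form a linear system for [u x] and [v x], which Cramer's rule solves
   with determinant 1. *)
have F0 : duhamel_integral w al be u v 0 x = M x w 0 0 * v x - M x w 1 0 * u x - v 0.
  by rewrite E0 /duhamel_integral; ring.
have F1 : duhamel_integral w al be u v 1 x = M x w 0 1 * v x - M x w 1 1 * u x + u 0.
  by rewrite E1 /duhamel_integral; ring.
rewrite F0 F1; split.
- by rewrite -[LHS]mul1r -D; ring.
- by rewrite -[LHS]mul1r -D; ring.
Qed.

(** [duhamel] for column [j] at [w']: both propagators start from the identity, so only the integral
    term remains. It contains the differences of the coefficients, which makes it the source of
    continuity and differentiability in the frequency. *)
Lemma propagator_variation x w w' i j : 0 <= x <= a ->
  0 <= complex.Im w -> 0 <= complex.Im w' ->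
  let J := duhamel_integral w (coef C' w') (coef rho' w')
             (fun s => M s w' 0 j) (fun s => M s w' 1 j) in
  M x w' i j - M x w i j = M x w i 1 * J 0 x - M x w i 0 * J 1 x.
Proof.
move=> xa w0 w'0 J; have [K [S s]] := propagator_solution_ex j w'0.
have [E0 E1] := duhamel s xa w0.
rewrite propagator0 // !mxE in E0 E1.
case: (ord2P i) => ->; rewrite ?E0 ?E1 -/(J 0 x) -/(J 1 x);
  by case: (ord2P j) => -> /=; rewrite /J; ring.
Qed.

(** Conjugation carries column [j] at [w] to a solution of the system at [- w^*] with the same real
    initial values; [duhamel] with equal coefficients is uniqueness. *)
Lemma propagator_conj x w i j : 0 <= x <= a -> 0 <= complex.Im w ->
  M x (- w^*) i j = (M x w i j)^*.
Proof.
move=> xa w0; have w'0 : 0 <= complex.Im (- w^*) by rewrite ImCN ImCJ opprK.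
have [K [S [b1 b2 b3 b4 [p1 p2]]]] := propagator_solution_ex j w0.
have cE f s : slab_parameter a f -> 0 <= s <= a -> (coef f w s)^* = coef f (- w^*) s.
  move=> hf sa; rewrite /coef (slab_real_response hf) //.
  have IJ : 0 +i* (- 1) = - I by apply: complex_eq; rewrite /= ?oppr0.
  by rewrite !rmorphM /= IJ; ring.
have sol : system_solution a K S (coef C' (- w^*)) (coef rho' (- w^*))
    (fun s => (M s w 0 j)^*) (fun s => (M s w 1 j)^*).
  split; [| |exact: bmJ|exact: bmJ|split].
  - by apply: (bm_eq _ (bmJ b1)) => s sa; rewrite cE.
  - by apply: (bm_eq _ (bmJ b2)) => s sa; rewrite cE.
  - move=> s sa; have sa' : s <= a by case/andP: sa.
    rewrite (p1 s sa) rmorphD; congr (_ + _).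
    rewrite -[LHS](@cintJ _ _ _ _ _ (bm_sub (lexx 0) sa' (bmM b1 b4))).
    apply: cint_eq => t /andP[t0 ts]; rewrite rmorphM /= cE //; apply/andP; split; lra.
  - move=> s sa; have sa' : s <= a by case/andP: sa.
    rewrite (p2 s sa) rmorphD; congr (_ + _).
    rewrite -[LHS](@cintJ _ _ _ _ _ (bm_sub (lexx 0) sa' (bmM b2 b3))).
    apply: cint_eq => t /andP[t0 ts]; rewrite rmorphM /= cE //; apply/andP; split; lra.
have [E0 E1] := duhamel sol xa w'0.
have J0 k : duhamel_integral (- w^*) (coef C' (- w^*)) (coef rho' (- w^*))
    (fun s => (M s w 0 j)^*) (fun s => (M s w 1 j)^*) k x = 0.
  rewrite /duhamel_integral -[RHS](mul0r x%:C) -[X in X%:C]subr0.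
  rewrite -cint_cst; last by case/andP: xa.
  by apply: cint_eq => s _; ring.
rewrite !J0 propagator0 // !mxE in E0 E1.
case: (ord2P i) => ->; rewrite ?E0 ?E1; by case: (ord2P j) => ->; rewrite !conjc_nat /=; ring.
Qed.

End Propagator.

(** * Energy flux and low-frequency expansion of the propagator *)

Section PropagatorFrequency.
Context {R : realType} (a : R) (rho' C' : R -> R[i] -> R[i])
  (M : R -> R[i] -> 'M[R[i]]_2).
Context (ha : 0 < a) (hrho' : slab_parameter a rho') (hC' : slab_parameter a C')
  (hM : is_propagator a rho' C' M).
Notation Co := ((R[i])^o).
Notation mu := (@lebesgue_measure R).
Notation I := (0 +i* 1 : R[i]).

(** Passivity rotated by the factor i: the form that makes the dissipation nonnegative. *)
Lemma Re_coef_le0 f w s : slab_parameter a f -> 0 <= s <= a -> 0 <= complex.Im w ->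
  complex.Re (coef f w s) <= 0.
Proof.
move=> hf sa w0; have := slab_passive hf sa w0.
by rewrite /coef -mulrA ReCM /= mul0r mul1r sub0r oppr_le0.
Qed.

(** The integrand of [wronskian] for a solution against [(conj u, - conj v)], whose coefficients are
    [- conj al] and [- conj be]. The right-hand side measures dissipation. *)
Lemma flux_density (al be u v : R[i]) :
  complex.Re ((- conjc be - be) * (u * conjc u) - (- conjc al - al) * (v * - conjc v)) =
  2 * - complex.Re be * normc u ^+ 2 + 2 * - complex.Re al * normc v ^+ 2.
Proof.
rewrite !normc_sqr; case: al => al1 al2; case: be => be1 be2.
by case: u => u1 u2; case: v => v1 v2 /=; ring.
Qed.

(** Boundary term of the same Wronskian: minus twice the energy flux. *)
Lemma flux_boundary (u v : R[i]) : complex.Re (u * - conjc v - v * conjc u) =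
  - 2 * (complex.Re u * complex.Re v + complex.Im u * complex.Im v).
Proof. by case: u => u1 u2; case: v => v1 v2 /=; ring. Qed.

(** With [u] the velocity and [v] the pressure, v + z u and v - z u are twice the amplitudes of the
    right-going and left-going waves, so the flux is a difference of two squares. *)
Lemma normc_sqr_polarization (z : R) (u v : R[i]) :
  normc (v + z%:C * u) ^+ 2 - normc (v - z%:C * u) ^+ 2 =
  4 * (z * (complex.Re u * complex.Re v + complex.Im u * complex.Im v)).
Proof. by rewrite !normc_sqr; case: u => u1 u2; case: v => v1 v2 /=; ring. Qed.

(* By passivity the energy flux Re (p conj v) is nonincreasing in x.  Apply this to the
   solution that is purely outgoing at x = a with p = 1, whose flux there is 1 / z. *)
Lemma reflection_flux z w (N := M a w) : 0 < z -> 0 <= complex.Im w ->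
  4 + normc (N 0 0 - N 1 1 + z%:C * N 0 1 - (z%:C)^-1 * N 1 0) ^+ 2 <=
  normc (N 0 0 + N 1 1 - z%:C * N 0 1 - (z%:C)^-1 * N 1 0) ^+ 2.
Proof.
move=> z0 w0.
have aa : 0 <= a <= a by rewrite lexx ltW.
have [B B0 HB] := slab_bound hrho' hC'.
have r0 : 0 < normc w + 1 by rewrite ltr_wpDl // normc_ge0.
have wr : normc w <= normc w + 1 by lra.
have [bal bbe bu0 bv0 [pu0 pv0]] :=
  propagator_solution ha hrho' hC' hM B0 r0 HB 0 w0 wr.
have [_ _ bu1 bv1 [pu1 pv1]] :=
  propagator_solution ha hrho' hC' hM B0 r0 HB 1 w0 wr.
have D : N 0 0 * N 1 1 - N 1 0 * N 0 1 = 1 by apply: (propagator_det ha hrho' hC' hM).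
have zC0 : z%:C != 0 :> R[i] by apply/eqP => /(congr1 (@complex.Re R)) /= h; lra.
(* The adjugate of [N] applied to (1 / z, 1): the velocity and pressure at x = 0 that produce the
   outgoing wave with p = 1 at x = a. *)
pose c0 := N 1 1 * (z%:C)^-1 - N 0 1; pose c1 := N 0 0 - N 1 0 * (z%:C)^-1.
pose u s := c0 * M s w 0 0 + c1 * M s w 0 1.
pose v s := c0 * M s w 1 0 + c1 * M s w 1 1.
have u0 : u 0 = c0 by rewrite /u (propagator0 ha hM) // !mxE /=; ring.
have v0 : v 0 = c1 by rewrite /v (propagator0 ha hM) // !mxE /=; ring.
have ua : u a = (z%:C)^-1.
  rewrite /u -/(N 0 0) -/(N 0 1) /c0 /c1 -[RHS]mul1r -D; by field.
have va : v a = 1 by rewrite /v -/(N 1 0) -/(N 1 1) /c0 /c1 -D; by field.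
have bu := bmD (bmZ c0 bu0) (bmZ c1 bu1); have bv := bmD (bmZ c0 bv0) (bmZ c1 bv1).
have lin al (p0 p1 q0 q1 : R -> R[i]) K S : bounded_measurable 0 a al K ->
    bounded_measurable 0 a q0 S -> bounded_measurable 0 a q1 S ->
    primitive_of a (fun s => al s * q0 s) p0 -> primitive_of a (fun s => al s * q1 s) p1 ->
    primitive_of a (fun s => al s * (c0 * q0 s + c1 * q1 s)) (fun s => c0 * p0 s + c1 * p1 s).
  move=> b b0 b1 h0 h1 x xa; have xa' : x <= a by case/andP: xa.
  have L k kk : bounded_measurable 0 a k kk -> bounded_measurable 0 x k kk.
    by move=> bk; exact: bm_sub bk.
  have -> : cint 0 x (fun s => al s * (c0 * q0 s + c1 * q1 s)) =
    c0 * cint 0 x (fun s => al s * q0 s) + c1 * cint 0 x (fun s => al s * q1 s).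
    rewrite -(cintZ c0 (L _ _ (bmM b b0))) -(cintZ c1 (L _ _ (bmM b b1))).
    rewrite -(cintD (L _ _ (bmZ c0 (bmM b b0))) (L _ _ (bmZ c1 (bmM b b1)))).
    by apply: cint_eq => s _; ring.
  by rewrite (h0 x xa) (h1 x xa); ring.
have sol := And5 bal bbe bu bv (conj (lin _ _ _ _ _ _ _ bal bv0 bv1 pu0 pu1)
  (lin _ _ _ _ _ _ _ bbe bu0 bu1 pv0 pv1)).
rewrite -/u -/v in sol bu bv.
have conjP al (p q : R -> R[i]) K S : bounded_measurable 0 a al K ->
    bounded_measurable 0 a q S ->
    primitive_of a (fun s => al s * q s) p ->
    primitive_of a (fun s => conjc (al s) * conjc (q s)) (fun s => conjc (p s)).
  move=> b bq h x xa; have xa' : x <= a by case/andP: xa.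
  rewrite (h x xa) rmorphD; congr (_ + _).
  rewrite -[LHS](@cintJ _ _ _ _ _ (bm_sub (lexx 0) xa' (bmM b bq))).
  by apply: cint_eq => t _; rewrite rmorphM.
have [_ _ _ _ [pu pv]] := sol.
have puJ : primitive_of a (fun s => - conjc (coef C' w s) * - conjc (v s)) (fun s => conjc (u s)).
  move=> x xa; rewrite (conjP _ _ _ _ _ bal bv pu x xa); congr (_ + _).
  by apply: cint_eq => s _; ring.
have pvJ : primitive_of a (fun s => - conjc (coef rho' w s) * conjc (u s)) (fun s => - conjc (v s)).
  move=> x xa; cbv beta; rewrite (conjP _ _ _ _ _ bbe bu pv x xa) opprD; congr (_ + _).
  rewrite -(cintN (bm_sub (lexx 0) _ (bmM (bmJ bbe) (bmJ bu)))); last by case/andP: xa.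
  by apply: cint_eq => s _; ring.
have solJ := And5 (bmN (bmJ bal)) (bmN (bmJ bbe)) (bmJ bu) (bmN (bmJ bv)) (conj puJ pvJ).
have := wronskian sol solJ aa; cbv beta; rewrite ua va u0 v0 => /(congr1 (@complex.Re R)).
set Int := cint _ _ _ => E.
(* The energy lost inside the slab; passivity enters the whole proof here. *)
have Int0 : 0 <= complex.Re Int.
  rewrite /Int cintE /=; apply: Rintegral_ge0 => s; rewrite /= in_itv /= => sa.
  have h1 := Re_coef_le0 hC' sa w0; have h2 := Re_coef_le0 hrho' sa w0.
  rewrite flux_density.
  by rewrite addr_ge0 // mulr_ge0 ?sqr_ge0 // mulr_ge0 // oppr_ge0.
clearbody Int.
(* Denominator and numerator of the reflection coefficient are, up to a common factor, the incident
   and reflected amplitudes at x = 0, so the polarization identity turns a flux of at least 1 / z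
   there into a difference of squares of at least 4. *)
have Dz : N 0 0 + N 1 1 - z%:C * N 0 1 - (z%:C)^-1 * N 1 0 = c1 + z%:C * c0.
  by rewrite /c0 /c1; field.
have Nz : N 0 0 - N 1 1 + z%:C * N 0 1 - (z%:C)^-1 * N 1 0 = c1 - z%:C * c0.
  by rewrite /c0 /c1; field.
rewrite Dz Nz; move: E; rewrite [in RHS]ReCD !flux_boundary.
have zV : (z%:C)^-1 = (z^-1)%:C :> R[i] by rewrite fmorphV.
rewrite zV /= mulr1 mulr0 addr0 => E.
have {}E : z^-1 <= complex.Re c0 * complex.Re c1 + complex.Im c0 * complex.Im c1 by lra.
have := normc_sqr_polarization z c0 c1.
have : 1 <= z * (complex.Re c0 * complex.Re c1 + complex.Im c0 * complex.Im c1).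
  by rewrite -(mulfV (lt0r_neq0 z0)) ler_wpM2l // ltW.
by move=> ? ?; lra.
Qed.

Lemma static_integral f : slab_parameter a f ->
  cint 0 a (f ^~ 0) = (\int[mu]_(x in `[0, a]) static f x)%:C.
Proof.
move=> hf; rewrite cintE /=; congr (_ +i* _).
rewrite -[RHS](mul0r (a - 0)) -(Rintegral_itv_cst 0 (ltW ha)).
by apply: eq_Rintegral => x; rewrite inE /= in_itv /= => xa; rewrite (slab_static_real hf).
Qed.

(** Repeated use of the integral equations. [u] starts from 0, so u = O(w); the equation for [v]
    then gives v = 1 + O(w^2), with [K] collecting the constants; put back into the equation for
    [u], together with f(s, w) = f(s, 0) + O(w), this isolates the linear term. The pair is abstract
    so that both columns of the propagator are covered. *)
Lemma low_freq_pair f (B S L : R) w (h u v : R -> R[i]) :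
  0 < B -> 0 <= S -> 0 <= L -> 0 <= complex.Im w -> normc w <= 1 -> slab_parameter a f ->
  (forall x w, 0 <= x <= a -> 0 <= complex.Im w -> normc (f x w) <= B) ->
  (forall x, 0 <= x <= a -> normc (f x w - f x 0) <= L * normc w) ->
  bounded_measurable 0 a h (normc w * B) ->
  bounded_measurable 0 a u S -> bounded_measurable 0 a v S ->
  primitive_of a (fun s => coef f w s * v s) u -> primitive_of a (fun s => h s * u s) v ->
  u 0 = 0 -> v 0 = 1 ->
  let K := 4 * B ^+ 2 * a ^+ 2 * S in
  normc (v a - 1) <= K * normc w ^+ 2 /\
  normc (u a - I * w * cint 0 a (f ^~ 0)) <= 2 * (L * S + B * K) * a * normc w ^+ 2.
Proof.
move=> B0 S0 L0 w0 w1 hf fB fL bh bu bv pu pv u0 v1 K.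
have W0 : 0 <= normc w := normc_ge0 w.
have K0 : 0 <= K := mulr_ge0 (mulr_ge0 (mulr_ge0 (ler0n _ 4) (sqr_ge0 B)) (sqr_ge0 a)) S0.
have bf : bounded_measurable 0 a (coef f w) (normc w * B).
  by apply: bm_coef => //; [move=> x xa; exact: fB|exact: ltW].
have hu x : 0 <= x <= a -> normc (u x) <= 2 * (normc w * B * S) * a.
  move=> xa; have /andP[x0 xa'] := xa.
  rewrite (pu x xa) u0 add0r; apply: (le_trans (normc_cint_le x0 (bm_sub (lexx 0) xa' (bmM bf bv)))).
  by rewrite subr0 ler_wpM2l // !mulr_ge0 // ltW.
have hv x : 0 <= x <= a -> normc (v x - 1) <= K * normc w ^+ 2.
  move=> xa; have /andP[x0 xa'] := xa.
  rewrite (pv x xa) v1 addrAC subrr add0r.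
  apply: (le_trans (normc_cint_le x0 (bm_sub (lexx 0) xa' (bmM bh (bm_bound bu hu))))).
  have -> : K * normc w ^+ 2 = 2 * (normc w * B * (2 * (normc w * B * S) * a)) * a by rewrite /K; ring.
  by rewrite subr0 ler_wpM2l // !mulr_ge0 // ltW.
have aa : 0 <= a <= a by rewrite lexx ltW.
split; first exact: hv.
have b0 : bounded_measurable 0 a (f ^~ 0) B by apply: bm_parameter => // x xa; exact: fB.
have b1 : bounded_measurable 0 a (f ^~ w) B by apply: bm_parameter => // x xa; exact: fB.
have bd : bounded_measurable 0 a (fun s => f s w * v s - f s 0) ((L * S + B * K) * normc w).
  apply: bm_bound (bmB (bmM b1 bv) b0) _ => s sa.
  have -> : f s w * v s - f s 0 = (f s w - f s 0) * v s + f s 0 * (v s - 1) by ring.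
  apply: (le_trans (normcD _ _)); rewrite !normcM.
  have h1 : normc (v s) <= S by case: bv => _ _; apply.
  have h2 : normc (f s 0) <= B by apply: fB.
  (* One of the two powers of [normc w] is given up, using [normc w <= 1]. *)
  have h3 : normc (v s - 1) <= K * normc w.
    apply: (le_trans (hv s sa)); rewrite expr2 mulrA ler_piMr // mulr_ge0 //.
  have h4 := ler_pM (normc_ge0 _) (normc_ge0 _) (fL s sa) h1.
  have h5 := ler_pM (normc_ge0 _) (normc_ge0 _) h2 h3.
  by apply: (le_trans (lerD h4 h5)); rewrite le_eqVlt; apply/orP; left; apply/eqP; ring.
have -> : u a - I * w * cint 0 a (f ^~ 0) = I * w * cint 0 a (fun s => f s w * v s - f s 0).
  rewrite (cintB (bmM b1 bv) b0) mulrBr -(cintZ _ (bmM b1 bv)) (pu a aa) u0 add0r.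
  by congr (_ - _); apply: cint_eq => s _; rewrite /coef mulrA.
rewrite !normcM normc_i mul1r.
have := normc_cint_le (ltW ha) bd; rewrite subr0 => hd.
have -> : 2 * (L * S + B * K) * a * normc w ^+ 2 = normc w * (2 * ((L * S + B * K) * normc w) * a) by ring.
by rewrite ler_wpM2l.
Qed.

Lemma propagator_low_freq : exists2 K : R, 0 <= K & exists2 d : R, 0 < d &
  forall w, 0 <= complex.Im w -> normc w < d ->
  let N := M a w in
  [/\ normc (N 0 0 - 1) <= K * normc w ^+ 2, normc (N 1 1 - 1) <= K * normc w ^+ 2,
      normc (N 0 1 - I * w * cint 0 a (C' ^~ 0)) <= K * normc w ^+ 2 &
      normc (N 1 0 - I * w * cint 0 a (rho' ^~ 0)) <= K * normc w ^+ 2].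
Proof.
have [B B0 HB] := slab_bound hrho' hC'.
have [Lr [dr [dr0 Hr]]] := slab_low_freq hrho'.
have [Lc [dc [dc0 Hc]]] := slab_low_freq hC'.
pose L := `|Lr| + `|Lc|; pose S := 2 * expR (4 * (1 * B) * a).
have L0 : 0 <= L by rewrite addr_ge0.
have S0 : 0 <= S by rewrite mulr_ge0 // expR_ge0.
pose K1 := 4 * B ^+ 2 * a ^+ 2 * S; pose K2 := 2 * (L * S + B * K1) * a.
have K10 : 0 <= K1 := mulr_ge0 (mulr_ge0 (mulr_ge0 (ler0n _ 4) (sqr_ge0 B)) (sqr_ge0 a)) S0.
have K20 : 0 <= K2 := mulr_ge0 (mulr_ge0 (ler0n _ 2) (addr_ge0 (mulr_ge0 L0 S0) (mulr_ge0 (ltW B0) K10))) (ltW ha).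
exists (K1 + K2); first exact: addr_ge0.
exists (Num.min 1 (Num.min dr dc)); first by rewrite !lt_min ltr01 dr0.
move=> w w0; rewrite !lt_min => /and3P[w1 wr wc] N.
have W0 : 0 <= normc w := normc_ge0 w.
have fr x : 0 <= x <= a -> normc (rho' x w - rho' x 0) <= L * normc w.
  move=> xa; have := Hr x w xa w0; rewrite !normrcE ltcR wr -rmorphM lecR => /(_ isT) h.
  by apply: (le_trans h); rewrite ler_wpM2r // (le_trans (ler_norm _)) // lerDl.
have fc x : 0 <= x <= a -> normc (C' x w - C' x 0) <= L * normc w.
  move=> xa; have := Hc x w xa w0; rewrite !normrcE ltcR wc -rmorphM lecR => /(_ isT) h.
  by apply: (le_trans h); rewrite ler_wpM2r // (le_trans (ler_norm _)) // lerDr.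
have [_ _ bu0 bv0 [pu0 pv0]] := propagator_solution ha hrho' hC' hM B0 ltr01 HB 0 w0 (ltW w1).
have [_ _ bu1 bv1 [pu1 pv1]] := propagator_solution ha hrho' hC' hM B0 ltr01 HB 1 w0 (ltW w1).
rewrite -/S in bu0 bv0 bu1 bv1.
have brho : bounded_measurable 0 a (coef rho' w) (normc w * B).
  by apply: bm_coef => //; [move=> x xa; case: (HB x w xa w0)|exact: ltW].
have bC : bounded_measurable 0 a (coef C' w) (normc w * B).
  by apply: bm_coef => //; [move=> x xa; case: (HB x w xa w0)|exact: ltW].
have [h1 h2] := low_freq_pair B0 S0 L0 w0 (ltW w1) hC'
  (fun x w xa w0 => proj2 (HB x w xa w0)) fc brho bu1 bv1 pu1 pv1
  (ltac:(by cbv beta; rewrite (propagator0 ha hM) // !mxE)) (ltac:(by cbv beta; rewrite (propagator0 ha hM) // !mxE)).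
(* The first column starts from (1, 0), so velocity and pressure exchange roles, and with them [C']
   and [rho']. *)
have [h3 h4] := low_freq_pair B0 S0 L0 w0 (ltW w1) hrho'
  (fun x w xa w0 => proj1 (HB x w xa w0)) fr bC bv0 bu0 pv0 pu0
  (ltac:(by cbv beta; rewrite (propagator0 ha hM) // !mxE)) (ltac:(by cbv beta; rewrite (propagator0 ha hM) // !mxE)).
rewrite -/K1 -/K2 in h1 h2 h3 h4.
have q : 0 <= normc w ^+ 2 by rewrite sqr_ge0.
split.
- by apply: (le_trans h3); rewrite ler_wpM2r // lerDl.
- by apply: (le_trans h1); rewrite ler_wpM2r // lerDl.
- by apply: (le_trans h2); rewrite ler_wpM2r // lerDr.
- by apply: (le_trans h4); rewrite ler_wpM2r // lerDr.
Qed.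

End PropagatorFrequency.

(** * Complex derivatives *)

Section ComplexDerivative.
Context {R : realType}.
Notation Co := ((R[i])^o).

Lemma cvgc0P (f : Co -> Co) (l : Co) : f h @[h --> (0:Co)] --> l <->
  forall e : R, 0 < e -> \forall h \near (0:Co), normc (f h - l) < e.
Proof. exact: (@cvgcP R Co (nbhs (0 : Co)) (nbhs_filter _) f l). Qed.

Lemma cvgc0_cst (c : Co) : (fun=> c) h @[h --> (0:Co)] --> c.
Proof. exact: (@cvgc_cst R Co (nbhs (0 : Co)) (nbhs_filter _)). Qed.

Lemma cvgc0D (f g : Co -> Co) (k l : Co) : f h @[h --> (0:Co)] --> k ->
  g h @[h --> (0:Co)] --> l -> f h + g h @[h --> (0:Co)] --> k + l.
Proof. exact: (@cvgcD R Co (nbhs (0 : Co)) (nbhs_filter _)). Qed.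

Lemma cvgc0N (f : Co -> Co) (k : Co) : f h @[h --> (0:Co)] --> k ->
  - f h @[h --> (0:Co)] --> - k.
Proof. exact: (@cvgcN R Co (nbhs (0 : Co)) (nbhs_filter _)). Qed.

Lemma cvgc0M (f g : Co -> Co) (k l : Co) : f h @[h --> (0:Co)] --> k ->
  g h @[h --> (0:Co)] --> l -> f h * g h @[h --> (0:Co)] --> k * l.
Proof. exact: (@cvgcM R Co (nbhs (0 : Co)) (nbhs_filter _)). Qed.

Lemma cvgc0V (f : Co -> Co) (k : Co) : k != 0 -> f h @[h --> (0:Co)] --> k ->
  (f h)^-1 @[h --> (0:Co)] --> k^-1.
Proof. exact: (@cvgcV R Co (nbhs (0 : Co)) (nbhs_filter _)). Qed.

Lemma cvgc0_id : h @[h --> (0:Co)] --> (0:Co).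
Proof. exact: cvg_id. Qed.

(* Caratheodory's form of complex differentiability: phi is the difference quotient. *)
Definition has_cderiv (f : Co -> Co) (w D : Co) :=
  exists2 phi : Co -> Co, phi h @[h --> (0 : Co)] --> D &
    \forall h \near (0 : Co), f (w + h) = f w + phi h * h.

Lemma has_cderivP f w D : has_cderiv f w D <->
  forall e : R, 0 < e -> \forall h \near (0 : Co),
    normc (f (w + h) - f w - D * h) <= e * normc h.
Proof.
split=> [[phi /cvgc0P phiD phiE] e e0|H].
  near=> h; have -> : f (w + h) = f w + phi h * h by near: h.
  have -> : f w + phi h * h - f w - D * h = (phi h - D) * h by ring.
  rewrite normcM ler_wpM2r ?normc_ge0 // ltW //; near: h; exact: phiD.
(* At [h = 0] the quotient gets the value [D], so that its limit holds along full neighbourhoods of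
   0. *)
exists (fun h => if h == 0 then D else (f (w + h) - f w) / h); last first.
  near=> h; case: eqVneq => [->|h0]; first by rewrite addr0 mulr0 addr0.
  by rewrite divfK //; ring.
apply/cvgc0P => e e0; have e2 : 0 < e / 2 by rewrite divr_gt0.
near=> h; case: eqVneq => [_|h0]; first by rewrite subrr normc0.
have -> : (f (w + h) - f w) / h - D = (f (w + h) - f w - D * h) / h.
  by field.
rewrite normcM normcV ltr_pdivrMr ?normc_gt0 //.
apply: le_lt_trans (_ : e / 2 * normc h < _); first by near: h; exact: H.
by rewrite ltr_pM2r ?normc_gt0 //; lra.
Unshelve. all: by end_near. Qed.

Lemma has_cderiv_cvg f w D : has_cderiv f w D -> f (w + h) @[h --> (0:Co)] --> f w.
Proof.
move=> [phi phiD phiE].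
have : f w + phi h * h @[h --> (0:Co)] --> f w + D * 0.
  exact: (cvgc0D (@cvgc0_cst (f w)) (cvgc0M phiD cvgc0_id)).
rewrite mulr0 addr0 => /cvgc0P H; apply/cvgc0P => e e0.
near=> h; have -> : f (w + h) = f w + phi h * h by near: h.
by near: h; exact: H.
Unshelve. all: by end_near. Qed.

Lemma has_cderivM f g w D1 D2 : has_cderiv f w D1 -> has_cderiv g w D2 ->
  has_cderiv (fun z => f z * g z) w (D1 * g w + f w * D2).
Proof.
move=> Hf Hg; have cg := has_cderiv_cvg Hg.
case: Hf => phi phiD phiE; case: Hg => psi psiD psiE.
exists (fun h => phi h * g (w + h) + f w * psi h).
  exact: (cvgc0D (cvgc0M phiD cg) (cvgc0M (@cvgc0_cst (f w)) psiD)).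
near=> h; have -> : f (w + h) = f w + phi h * h by near: h.
have -> : g (w + h) = g w + psi h * h by near: h.
by ring.
Unshelve. all: by end_near. Qed.

Lemma has_cderivD f g w D1 D2 : has_cderiv f w D1 -> has_cderiv g w D2 ->
  has_cderiv (fun z => f z + g z) w (D1 + D2).
Proof.
move=> [phi phiD phiE] [psi psiD psiE].
exists (fun h => phi h + psi h); first exact: (cvgc0D phiD psiD).
near=> h; have -> : f (w + h) = f w + phi h * h by near: h.
have -> : g (w + h) = g w + psi h * h by near: h.
by ring.
Unshelve. all: by end_near. Qed.

Lemma has_cderiv_cst c w : has_cderiv (fun=> c) w 0.
Proof.
exists (fun=> 0); first exact: (@cvgc0_cst 0).
by near=> h; rewrite mul0r addr0.
Unshelve. all: by end_near. Qed.

Lemma has_cderivZ c f w D : has_cderiv f w D -> has_cderiv (fun z => c * f z) w (c * D).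
Proof.
move=> Hf; have := has_cderivM (has_cderiv_cst c w) Hf.
by rewrite mul0r add0r.
Qed.

Lemma has_cderivV g w D : has_cderiv g w D -> g w != 0 ->
  has_cderiv (fun z => (g z)^-1) w (- D / (g w * g w)).
Proof.
move=> Hg g0; have cg := has_cderiv_cvg Hg; case: Hg => phi phiD phiE.
exists (fun h => - phi h / (g (w + h) * g w)).
  have n0 : g w * g w != 0 by rewrite mulf_neq0.
  exact: (cvgc0M (cvgc0N phiD) (cvgc0V n0 (cvgc0M cg (@cvgc0_cst (g w))))).
have gn0 : \forall h \near (0:Co), g (w + h) != 0.
  have ng0 : 0 < normc (g w) by rewrite normc_gt0.
  have H := (cvgc0P _ _).1 cg _ ng0.
  near=> h; have : normc (g (w + h) - g w) < normc (g w) by near: h.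
  by apply: contraTneq => ->; rewrite sub0r normcNE ltxx.
near=> h; have gh : g (w + h) != 0 by near: h.
have E : g (w + h) = g w + phi h * h by near: h.
have -> : - phi h / (g (w + h) * g w) * h = - (phi h * h) / (g (w + h) * g w) by ring.
have -> : phi h * h = g (w + h) - g w by rewrite E addrC addKr.
by field; rewrite gh g0.
Unshelve. all: by end_near. Qed.

Lemma has_cderiv_comp f g w D1 D2 : has_cderiv f (g w) D1 -> has_cderiv g w D2 ->
  has_cderiv (f \o g) w (D1 * D2).
Proof.
move=> [phi phiD phiE] [psi psiD psiE].
have c0 : psi h * h @[h --> (0:Co)] --> (0:Co).
  by have := cvgc0M psiD cvgc0_id; rewrite mulr0.
exists (fun h => phi (psi h * h) * psi h).
  exact: (cvgc0M (cvg_comp _ _ c0 phiD) psiD).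
have phiE' : \forall h \near (0:Co), f (g w + psi h * h) = f (g w) + phi (psi h * h) * (psi h * h).
  exact: (c0 _ phiE).
near=> h; rewrite /=; have -> : g (w + h) = g w + psi h * h by near: h.
have -> : f (g w + psi h * h) = f (g w) + phi (psi h * h) * (psi h * h) by near: h.
by rewrite mulrA.
Unshelve. all: by end_near. Qed.

Lemma derivable_has_cderiv (f : Co -> Co) (w : Co) : derivable f w 1 ->
  exists D, has_cderiv f w D.
Proof.
move=> df; exists ('D_1 f w); apply/has_cderivP => e e0.
have := df; rewrite /derivable => /cvg_ex[l fl].
have El : l = 'D_1 f w by apply/esym/cvg_lim.
move/cvgcP : fl => /(_ e e0); rewrite El near_withinE => H.
near=> h; have [->|h0] := eqVneq h 0.
  by rewrite addr0 subrr mulr0 subr0 normc0 mulr0.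
have : normc (h^-1 *: (f (h *: (1:Co) + w) - f w) - 'D_1 f w) < e.
  by move: h0; near: h; apply: filterS H => h; exact.
rewrite [h *: _]mulr1 [_ + w]addrC => hh.
have -> : f (w + h) - f w - 'D_1 f w * h = (h^-1 *: (f (w + h) - f w) - 'D_1 f w) * h.
  by rewrite mulrBl /GRing.scale /= mulrAC mulVf // mul1r.
by rewrite normcM ler_wpM2r ?normc_ge0 // ltW.
Unshelve. all: by end_near. Qed.

Lemma is_derive_littleo (f : R -> R) (x df : R) : is_derive x 1 f df ->
  forall e : R, 0 < e -> \forall h \near (0:R), `|f (x + h) - f x - df * h| <= e * `|h|.
Proof.
move=> [dfx E] e e0; move: dfx; rewrite /derivable => /cvg_ex[l fl].
have El : l = df by rewrite -E; apply/esym/cvg_lim.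
move/cvgrPdist_lt : fl => /(_ e e0); rewrite El near_withinE => H.
near=> h; have [->|h0] := eqVneq h 0.
  by rewrite addr0 subrr mulr0 subr0 normr0 mulr0.
have : `|df - h^-1 *: (f (h *: (1:R) + x) - f x)| < e.
  by move: h0; near: h; apply: filterS H => h; exact.
rewrite [h *: _]mulr1 [_ + x]addrC distrC => hh.
have -> : f (x + h) - f x - df * h = (h^-1 *: (f (x + h) - f x) - df) * h.
  by rewrite mulrBl /GRing.scale /= mulrAC mulVf // mul1r.
by rewrite normrM ler_wpM2r // ltW.
Unshelve. all: by end_near. Qed.

Definition cexp (z : Co) : Co :=
  (expR (complex.Re z) * cos (complex.Im z)) +i* (expR (complex.Re z) * sin (complex.Im z)).

Lemma cexpD z w : cexp (z + w) = cexp z * cexp w.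
Proof.
rewrite /cexp ReCD ImCD expRD cosD sinD.
by apply: complex_eq; rewrite ?ReCM ?ImCM /=; ring.
Qed.

Lemma normc_cexp z : normc (cexp z) = expR (complex.Re z).
Proof.
rewrite /cexp /normc !exprMn -mulrDr cos2Dsin2 mulr1 sqrtr_sqr.
by rewrite ger0_norm // expR_ge0.
Qed.

Lemma cexp_neq0 z : cexp z != 0.
Proof. by rewrite -normc_gt0 normc_cexp expR_gt0. Qed.

Lemma near0_Re (P : R -> Prop) : (\forall x \near (0:R), P x) ->
  \forall h \near (0:Co), P (complex.Re h).
Proof. by move=> H; have := @cvg_Re R Co (nbhs (0:Co)) _ id 0 cvg_id; apply. Qed.

Lemma near0_Im (P : R -> Prop) : (\forall x \near (0:R), P x) ->
  \forall h \near (0:Co), P (complex.Im h).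
Proof. by move=> H; have := @cvg_Im R Co (nbhs (0:Co)) _ id 0 cvg_id; apply. Qed.

(** The functional equation reduces the claim to cexp h - 1 - h = o(h), which is assembled from the
    derivatives of [expR], [cos] and [sin] at 0. *)
Lemma has_cderiv_cexp z : has_cderiv cexp z (cexp z).
Proof.
apply/has_cderivP => e e0.
have nz : 0 < normc (cexp z) by rewrite normc_cexp expR_gt0.
(* The bounds [b1] and [b2] below add up to at most [6 * k * normc h]; the 10 leaves room. *)
pose k := e / (10 * normc (cexp z)).
have k0 : 0 < k by rewrite divr_gt0 // mulr_gt0.
have hexp := is_derive_littleo (is_derive_expR (0:R)) k0.
have hcos := is_derive_littleo (is_derive_cos (0:R)) k0.
have hsin := is_derive_littleo (is_derive_sin (0:R)) k0.
have cexpR : \forall x \near (0:R), `|expR x - 1| <= k /\ `|expR x| <= 2.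
  have h1 : expR x @[x --> (0:R)] --> expR 0 by exact: continuous_expR.
  rewrite expR0 in h1; move/cvgrPdist_le : h1 => h1.
  near=> x; split; first by rewrite distrC; near: x; exact: h1.
  have : `|1 - expR x| <= 1 by near: x; exact: h1.
  have := expR_ge0 x => h2; rewrite ler_norml => /andP[h3 h4].
  by rewrite ger0_norm //; lra.
near=> h; rewrite cexpD.
have -> : cexp z * cexp h - cexp z - cexp z * h = cexp z * (cexp h - 1 - h) by ring.
rewrite normcM mulrC -ler_pdivlMr //.
set x := complex.Re h; set y := complex.Im h.
have a1 : `|expR (0 + x) - expR 0 - expR 0 * x| <= k * `|x|.
  by rewrite /x; near: h; exact: near0_Re hexp.
have a2 : `|cos (0 + y) - cos 0 - - sin 0 * y| <= k * `|y|.
  by rewrite /y; near: h; exact: near0_Im hcos.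
have a3 : `|sin (0 + y) - sin 0 - cos 0 * y| <= k * `|y|.
  by rewrite /y; near: h; exact: near0_Im hsin.
have [a4 a5] : `|expR x - 1| <= k /\ `|expR x| <= 2.
  by rewrite /x; near: h; exact: near0_Re cexpR.
have a6 : `|x| <= 1.
  rewrite /x; near: h; exact: (@near0_Re (fun t => `|t| <= 1) (nbhs0_le ltr01)).
rewrite add0r expR0 mul1r in a1; rewrite add0r cos0 sin0 oppr0 mul0r subr0 in a2.
rewrite add0r sin0 cos0 subr0 mul1r in a3.
apply: (le_trans (normc_le_ReIm _)); rewrite !(ReCD, ImCD, ReCN, ImCN) /= -/x -/y oppr0 addr0.
have b1 : `|expR x * cos y - 1 - x| <= k * `|x| + 2 * (k * `|y|).
  have -> : expR x * cos y - 1 - x = (expR x - 1 - x) + expR x * (cos y - 1) by ring.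
  apply: (le_trans (ler_normD _ _)); apply: lerD => //.
  by rewrite normrM ler_pM.
have b2 : `|expR x * sin y - y| <= 2 * (k * `|y|) + k * `|y|.
  have -> : expR x * sin y - y = expR x * (sin y - y) + (expR x - 1) * y by ring.
  apply: (le_trans (ler_normD _ _)); apply: lerD => //.
    by rewrite normrM ler_pM.
  by rewrite normrM ler_wpM2r.
have c1 : `|x| <= normc h by exact: ler_Re_normc.
have c2 : `|y| <= normc h by exact: ler_Im_normc.
have -> : e * normc h / normc (cexp z) = 10 * (k * normc h) by rewrite /k; field; rewrite lt0r_neq0.
apply: (le_trans (lerD b1 b2)).
have d1 : k * `|x| <= k * normc h by rewrite ler_pM2l.
have d2 : k * `|y| <= k * normc h by rewrite ler_pM2l.
by have := mulr_ge0 (ltW k0) (normc_ge0 h); lra.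
Unshelve. all: by end_near. Qed.

End ComplexDerivative.

(** * Goursat's lemma and the Cauchy estimate *)

Section Goursat.
Context {R : realType}.
Notation Co := ((R[i])^o).
Notation I := (0 +i* 1 : R[i]).
Implicit Types (g : Co -> Co) (K x y e : R).

(** A derivative at every point, with no continuity in the point: this is what the pointwise
    assumptions supply and what Goursat's argument can handle. [K] provides integrability along the
    edges. *)
Definition regular_on g K x1 x2 y1 y2 := forall p : Co,
  x1 <= complex.Re p <= x2 -> y1 <= complex.Im p <= y2 ->
  (exists D, has_cderiv g p D) /\ normc (g p) <= K.

Lemma regular_on_sub g K x1 x2 y1 y2 x1' x2' y1' y2' :
  x1 <= x1' -> x2' <= x2 -> y1 <= y1' -> y2' <= y2 ->
  regular_on g K x1 x2 y1 y2 -> regular_on g K x1' x2' y1' y2'.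
Proof. by move=> h1 h2 h3 h4 H p /andP[? ?] /andP[? ?]; apply: H; lra. Qed.

Lemma has_cderiv_along g (p : R -> Co) s D : has_cderiv g (p s) D ->
  p t @[t --> s] --> p s -> g (p t) @[t --> s] --> g (p s).
Proof.
move=> /has_cderiv_cvg/(cvgc0P (fun h => g (p s + h)) _).1 H /cvgcP ps.
apply/cvgcP => e e0; have /near0_normcP[d d0 hd] := H e e0.
near=> t; have := hd (p t - p s); rewrite subrKC; apply.
by near: t; exact: ps.
Unshelve. all: by end_near. Qed.

Lemma bm_horizontal g K x1 x2 y1 y2 y : regular_on g K x1 x2 y1 y2 -> y1 <= y <= y2 ->
  bounded_measurable x1 x2 (fun s => g (s +i* y)) K.
Proof.
move=> H yy; apply: bm_continuous => [|s sx]; last by case: (H (s +i* y)).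
apply: continuous_in_subspaceT => s; rewrite inE /= in_itv /= => sx.
have [[D hD] _] := H (s +i* y) sx yy.
apply: (@has_cderiv_along g (fun t => t +i* y) s D hD).
by apply: cvg_ReIm; [exact: cvg_id|exact: cvg_cst].
Qed.

Lemma bm_vertical g K x1 x2 y1 y2 x : regular_on g K x1 x2 y1 y2 -> x1 <= x <= x2 ->
  bounded_measurable y1 y2 (fun t => g (x +i* t)) K.
Proof.
move=> H xx; apply: bm_continuous => [|t ty]; last by case: (H (x +i* t)).
apply: continuous_in_subspaceT => t; rewrite inE /= in_itv /= => ty.
have [[D hD] _] := H (x +i* t) xx ty.
apply: (@has_cderiv_along g (fun s => x +i* s) t D hD).
by apply: cvg_ReIm; [exact: cvg_cst|exact: cvg_id].
Qed.

(** The contour integral of [g] counterclockwise around the rectangle. *)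
Definition rect_integral g x1 x2 y1 y2 : R[i] :=
  cint x1 x2 (fun s => g (s +i* y1)) - cint x1 x2 (fun s => g (s +i* y2)) +
  I * (cint y1 y2 (fun t => g (x2 +i* t)) - cint y1 y2 (fun t => g (x1 +i* t))).

Lemma rect_integral_split g K x1 x2 y1 y2 x y : regular_on g K x1 x2 y1 y2 ->
  x1 <= x <= x2 -> y1 <= y <= y2 ->
  rect_integral g x1 x2 y1 y2 = rect_integral g x1 x y1 y + rect_integral g x x2 y1 y +
    rect_integral g x1 x y y2 + rect_integral g x x2 y y2.
Proof.
move=> H xx yy; have /andP[xa xb] := xx; have /andP[ya yb] := yy.
have y12 : y1 <= y2 by lra.
have x12 : x1 <= x2 by lra.
have hh z : y1 <= z <= y2 -> cint x1 x2 (fun s => g (s +i* z)) =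
  cint x1 x (fun s => g (s +i* z)) + cint x x2 (fun s => g (s +i* z)).
  by move=> zz; apply: (cint_split (bm_horizontal H zz)).
have vv z : x1 <= z <= x2 -> cint y1 y2 (fun s => g (z +i* s)) =
  cint y1 y (fun s => g (z +i* s)) + cint y y2 (fun s => g (z +i* s)).
  by move=> zz; apply: (cint_split (bm_vertical H zz)).
rewrite /rect_integral hh ?lexx ?y12 // hh ?lexx ?y12 // vv ?lexx ?x12 // vv ?lexx ?x12 //.
by ring.
Qed.

(** Opposite sides are paired. For an affine [g] their differences are the constants [- DH] and
    [DV], whose contributions cancel. What is left is at most [2 * (e * d)] pointwise, with [d] the
    sum of the two side lengths, and [normc_cint_le] doubles the constant to 4. *)
Lemma rect_integral_local g K x1 x2 y1 y2 (p D : Co) e : regular_on g K x1 x2 y1 y2 ->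
  x1 <= x2 -> y1 <= y2 ->
  (forall q : Co, x1 <= complex.Re q <= x2 -> y1 <= complex.Im q <= y2 ->
     normc (g q - g p - D * (q - p)) <= e * (x2 - x1 + (y2 - y1))) ->
  normc (rect_integral g x1 x2 y1 y2) <= 4 * e * (x2 - x1 + (y2 - y1)) ^+ 2.
Proof.
move=> H x12 y12 He.
set d := x2 - x1 + (y2 - y1) in He *.
have xx1 : x1 <= x1 <= x2 by lra.
have xx2 : x1 <= x2 <= x2 by lra.
have yy1 : y1 <= y1 <= y2 by lra.
have yy2 : y1 <= y2 <= y2 by lra.
have h1 := bm_horizontal H yy1; have h2 := bm_horizontal H yy2.
have v1 := bm_vertical H xx1; have v2 := bm_vertical H xx2.
pose DH := D * (I * (y2 - y1)%:C); pose DV := D * (x2 - x1)%:C.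
have sub2 (q1 q2 : Co) : x1 <= complex.Re q1 <= x2 -> y1 <= complex.Im q1 <= y2 ->
   x1 <= complex.Re q2 <= x2 -> y1 <= complex.Im q2 <= y2 ->
   normc (g q1 - g q2 - D * (q1 - q2)) <= 2 * (e * d).
  move=> a1 a2 a3 a4.
  have -> : g q1 - g q2 - D * (q1 - q2) =
    (g q1 - g p - D * (q1 - p)) - (g q2 - g p - D * (q2 - p)) by ring.
  apply: (le_trans (normcD _ _)); rewrite normcNE.
  by have := lerD (He q1 a1 a2) (He q2 a3 a4); lra.
have bH : bounded_measurable x1 x2 (fun s => g (s +i* y1) - g (s +i* y2) + DH) (2 * (e * d)).
  apply: bm_bound (bmD (bmB h1 h2) (bm_cst _ _ DH)) _ => s sx.
  have := sub2 (s +i* y1) (s +i* y2) sx yy1 sx yy2.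
  congr (normc _ <= _); rewrite -mulrN; congr (_ + D * _).
  by apply: complex_eq; rewrite !(ReCD, ImCD, ReCN, ImCN, ReCM, ImCM) /=; ring.
have bV : bounded_measurable y1 y2 (fun t => g (x2 +i* t) - g (x1 +i* t) - DV) (2 * (e * d)).
  apply: bm_bound (bmB (bmB v2 v1) (bm_cst _ _ DV)) _ => t ty.
  have := sub2 (x2 +i* t) (x1 +i* t) xx2 ty xx1 ty.
  congr (normc (_ - D * _) <= _).
  by apply: complex_eq; rewrite !(ReCD, ImCD, ReCN, ImCN, ReCM, ImCM) /=; ring.
have -> : rect_integral g x1 x2 y1 y2 =
   cint x1 x2 (fun s => g (s +i* y1) - g (s +i* y2) + DH) +
   I * cint y1 y2 (fun t => g (x2 +i* t) - g (x1 +i* t) - DV).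
  rewrite (cintD (bmB h1 h2) (bm_cst _ _ DH)) (cintB h1 h2) cint_cst //.
  rewrite (cintB (bmB v2 v1) (bm_cst _ _ DV)) (cintB v2 v1) cint_cst //.
  by rewrite /rect_integral /DH /DV; ring.
apply: (le_trans (normcD _ _)); rewrite normcM normc_i mul1r.
apply: (le_trans (lerD (normc_cint_le x12 bH) (normc_cint_le y12 bV))).
by rewrite -mulrDr -/d le_eqVlt; apply/orP; left; apply/eqP; ring.
Qed.

(** The quarter kept carries at least a quarter of the contour integral; when the three tests fail,
    the triangle inequality forces this for the last one. *)
Definition next_quarter g (r : R * R * R * R) : R * R * R * R :=
  let: (x1, x2, y1, y2) := r in
  let x := (x1 + x2) / 2 in let y := (y1 + y2) / 2 in
  let N := normc (rect_integral g x1 x2 y1 y2) in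
  if N <= 4 * normc (rect_integral g x1 x y1 y) then (x1, x, y1, y)
  else if N <= 4 * normc (rect_integral g x x2 y1 y) then (x, x2, y1, y)
  else if N <= 4 * normc (rect_integral g x1 x y y2) then (x1, x, y, y2)
  else (x, x2, y, y2).

Lemma next_quarterP g K x1 x2 y1 y2 : x1 <= x2 -> y1 <= y2 ->
  regular_on g K x1 x2 y1 y2 ->
  exists x1' x2' y1' y2', next_quarter g (x1, x2, y1, y2) = (x1', x2', y1', y2') /\
   [/\ x1 <= x1', x1' <= x2', x2' <= x2 & x2' - x1' = (x2 - x1) / 2] /\
   [/\ y1 <= y1', y1' <= y2', y2' <= y2 & y2' - y1' = (y2 - y1) / 2] /\
   normc (rect_integral g x1 x2 y1 y2) <= 4 * normc (rect_integral g x1' x2' y1' y2').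
Proof.
move=> x12 y12 H; rewrite /next_quarter.
set x := (x1 + x2) / 2; set y := (y1 + y2) / 2.
have xx : x1 <= x <= x2 by rewrite /x; lra.
have yy : y1 <= y <= y2 by rewrite /y; lra.
have E := rect_integral_split H xx yy.
have L : normc (rect_integral g x1 x2 y1 y2) <= normc (rect_integral g x1 x y1 y) +
  normc (rect_integral g x x2 y1 y) + normc (rect_integral g x1 x y y2) +
  normc (rect_integral g x x2 y y2).
  rewrite E; apply: (le_trans (normcD _ _)); rewrite lerD2r.
  by apply: (le_trans (normcD _ _)); rewrite lerD2r; exact: normcD.
have hx1 : [/\ x1 <= x1, x1 <= x, x <= x2 & x - x1 = (x2 - x1) / 2].
  by clear -x12; rewrite /x; split; lra.
have hx2 : [/\ x1 <= x, x <= x2, x2 <= x2 & x2 - x = (x2 - x1) / 2].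
  by clear -x12; rewrite /x; split; lra.
have hy1 : [/\ y1 <= y1, y1 <= y, y <= y2 & y - y1 = (y2 - y1) / 2].
  by clear -y12; rewrite /y; split; lra.
have hy2 : [/\ y1 <= y, y <= y2, y2 <= y2 & y2 - y = (y2 - y1) / 2].
  by clear -y12; rewrite /y; split; lra.
case: leP => [h1|h1]; first by exists x1, x, y1, y.
case: leP => [h2|h2]; first by exists x, x2, y1, y.
case: leP => [h3|h3]; first by exists x1, x, y, y2.
exists x, x2, y, y2; do 3 split => //.
move: L h1 h2 h3; clear; move: (normc _) (normc _) (normc _) (normc _) (normc _).
by move=> N n1 n2 n3 n4 L h1 h2 h3; lra.
Qed.

(** After [n] bisections the integral has lost at most a factor 4^n, while differentiability at the
    common point of the rectangles bounds it by an arbitrarily small multiple of 4^(-n). *)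
Lemma goursat g K x1 x2 y1 y2 : x1 <= x2 -> y1 <= y2 ->
  regular_on g K x1 x2 y1 y2 -> rect_integral g x1 x2 y1 y2 = 0.
Proof.
move=> x12 y12 H.
pose r n := iter n (next_quarter g) (x1, x2, y1, y2).
pose X1 n := (r n).1.1.1; pose X2 n := (r n).1.1.2; pose Y1 n := (r n).1.2; pose Y2 n := (r n).2.
have rE n : r n = (X1 n, X2 n, Y1 n, Y2 n) by rewrite /X1 /X2 /Y1 /Y2; case: (r n) => [[[? ?] ?] ?].
have inv n : [/\ x1 <= X1 n, X1 n <= X2 n, X2 n <= x2 & X2 n - X1 n = (x2 - x1) / 2 ^+ n] /\
   [/\ y1 <= Y1 n, Y1 n <= Y2 n, Y2 n <= y2 & Y2 n - Y1 n = (y2 - y1) / 2 ^+ n] /\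
   normc (rect_integral g x1 x2 y1 y2) <= 4 ^+ n * normc (rect_integral g (X1 n) (X2 n) (Y1 n) (Y2 n)) /\
   [/\ X1 n <= X1 n.+1, X2 n.+1 <= X2 n, Y1 n <= Y1 n.+1 & Y2 n.+1 <= Y2 n].
  have step m : [/\ x1 <= X1 m, X1 m <= X2 m, X2 m <= x2 & X2 m - X1 m = (x2 - x1) / 2 ^+ m] ->
     [/\ y1 <= Y1 m, Y1 m <= Y2 m, Y2 m <= y2 & Y2 m - Y1 m = (y2 - y1) / 2 ^+ m] ->
     exists x1' x2' y1' y2', r m.+1 = (x1', x2', y1', y2') /\
     [/\ X1 m <= x1', x1' <= x2', x2' <= X2 m & x2' - x1' = (X2 m - X1 m) / 2] /\
     [/\ Y1 m <= y1', y1' <= y2', y2' <= Y2 m & y2' - y1' = (Y2 m - Y1 m) / 2] /\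
     normc (rect_integral g (X1 m) (X2 m) (Y1 m) (Y2 m)) <= 4 * normc (rect_integral g x1' x2' y1' y2').
    move=> [a1 a2 a3 a4] [b1 b2 b3 b4]; rewrite /r iterS -/(r m) rE.
    exact: next_quarterP a2 b2 (regular_on_sub a1 a3 b1 b3 H).
  have sE m x1' x2' y1' y2' : r m = (x1', x2', y1', y2') ->
    [/\ X1 m = x1', X2 m = x2', Y1 m = y1' & Y2 m = y2'].
    by rewrite /X1 /X2 /Y1 /Y2 => ->.
  have base : [/\ x1 <= X1 n, X1 n <= X2 n, X2 n <= x2 & X2 n - X1 n = (x2 - x1) / 2 ^+ n] /\
   [/\ y1 <= Y1 n, Y1 n <= Y2 n, Y2 n <= y2 & Y2 n - Y1 n = (y2 - y1) / 2 ^+ n] /\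
   normc (rect_integral g x1 x2 y1 y2) <= 4 ^+ n * normc (rect_integral g (X1 n) (X2 n) (Y1 n) (Y2 n)).
    elim: n => [|n [IH1 [IH2 IH3]]].
      by rewrite /X1 /X2 /Y1 /Y2 /= !expr0 !divr1 mul1r.
    have [x1' [x2' [y1' [y2' [/sE[-> -> -> ->] [[c1 c2 c3 c4] [[d1 d2 d3 d4] f1]]]]]]] := step n IH1 IH2.
    case: IH1 => a1 a2 a3 a4; case: IH2 => b1 b2 b3 b4.
    split; first by split; [lra|lra|lra|rewrite c4 a4 exprSr invfM mulrA].
    split; first by split; [lra|lra|lra|rewrite d4 b4 exprSr invfM mulrA].
    by apply: (le_trans IH3); rewrite exprSr -mulrA ler_wpM2l // exprn_ge0.
  have [B1 [B2 B3]] := base.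
  have [x1' [x2' [y1' [y2' [/sE[-> -> -> ->] [[c1 c2 c3 c4] [[d1 d2 d3 d4] f1]]]]]]] := step n B1 B2.
  by [].
have mono (u : nat -> R) : (forall n, u n <= u n.+1) -> forall m n, (m <= n)%N -> u m <= u n.
  by move=> hu m n; apply: (homo_leq (r := fun x y : R => x <= y)) => //; exact: le_trans.
have X1m := mono X1 (fun n => let: conj _ (conj _ (conj _ (And4 h _ _ _))) := inv n in h).
have Y1m := mono Y1 (fun n => let: conj _ (conj _ (conj _ (And4 _ _ h _))) := inv n in h).
have X2m : forall m n, (m <= n)%N -> X2 n <= X2 m.
  move=> m n mn; rewrite -lerN2; apply: (mono (fun n => - X2 n)) mn => k.
  by rewrite lerN2; have [_ [_ [_ []]]] := inv k.
have Y2m : forall m n, (m <= n)%N -> Y2 n <= Y2 m.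
  move=> m n mn; rewrite -lerN2; apply: (mono (fun n => - Y2 n)) mn => k.
  by rewrite lerN2; have [_ [_ [_ []]]] := inv k.
have X12 m n : X1 m <= X2 n.
  apply: le_trans (X1m m (maxn m n) (leq_maxl _ _)) _.
  apply: le_trans (X2m n (maxn m n) (leq_maxr _ _)).
  by have [[]] := inv (maxn m n).
have Y12 m n : Y1 m <= Y2 n.
  apply: le_trans (Y1m m (maxn m n) (leq_maxl _ _)) _.
  apply: le_trans (Y2m n (maxn m n) (leq_maxr _ _)).
  by have [_ [[]]] := inv (maxn m n).
(* Nested intervals meet: the supremum of the left ends lies below every right end. *)
have sandwich (u v : nat -> R) : (forall m n, u m <= v n) ->
    exists s, forall n, u n <= s <= v n.
  move=> uv; exists (sup (range u)) => n; apply/andP; split.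
  - by apply: ub_le_sup; [exists (v 0%N) => _ [m _ <-]|exists n].
  - by apply: ge_sup; [exists (u 0%N), 0%N|move=> _ [m _ <-]].
have [px hpx] := sandwich _ _ X12; have [py hpy] := sandwich _ _ Y12.
pose p : Co := px +i* py.
have [[D hD] _] : (exists D, has_cderiv g p D) /\ normc (g p) <= K.
  by apply: H; [have := hpx 0%N|have := hpy 0%N].
set d := x2 - x1 + (y2 - y1).
have d0 : 0 <= d by rewrite /d; lra.
have key e : 0 < e -> normc (rect_integral g x1 x2 y1 y2) <= 4 * e * d ^+ 2.
  move=> e0; have /has_cderivP/(_ e e0)/near0_normcP[dl dl0 hdl] := hD.
  have [n hn] : exists n, d / 2 ^+ n < dl.
    apply: contrapT => /forallNP N.
    have : dl <= 0 by apply: (@le0_halving _ dl d) => n; rewrite leNgt; apply/negP; exact: N.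
    by rewrite leNgt dl0.
  have [[a1 a2 a3 a4] [[b1 b2 b3 b4] [N _]]] := inv n.
  have En : X2 n - X1 n + (Y2 n - Y1 n) = d / 2 ^+ n by rewrite a4 b4 -mulrDl.
  have := @rect_integral_local g K (X1 n) (X2 n) (Y1 n) (Y2 n) p D e
    (regular_on_sub a1 a3 b1 b3 H) a2 b2.
  rewrite En => loc; have {}loc := loc _; apply: (le_trans N).
  have L : normc (rect_integral g (X1 n) (X2 n) (Y1 n) (Y2 n)) <= 4 * e * (d / 2 ^+ n) ^+ 2.
    apply: loc => q qx qy.
    have hq : normc (q - p) <= d / 2 ^+ n.
      apply: (le_trans (normc_le_ReIm _)); rewrite !(ReCD, ImCD, ReCN, ImCN) /= -En.
      have /andP[u1 u2] := hpx n; have /andP[u3 u4] := hpy n.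
      move/andP : qx => [u5 u6]; move/andP : qy => [u7 u8].
      by apply: lerD; rewrite ler_norml; apply/andP; split; lra.
    have := hdl (q - p) (le_lt_trans hq hn).
    rewrite subrKC => /le_trans; apply; by rewrite ler_wpM2l // ltW.
  apply: (le_trans (ler_wpM2l (exprn_ge0 _ (ler0n _ 4)) L)).
  have -> : 4 ^+ n = 2 ^+ n * 2 ^+ n :> R by rewrite -exprMn; congr (_ ^+ _); ring.
  rewrite le_eqVlt; apply/orP; left; apply/eqP; field.
  by rewrite expf_neq0.
apply/eqP; rewrite -normc_eq0 eq_le normc_ge0 andbT.
apply: (@le0_halving _ _ (4 * d ^+ 2)) => n.
have -> : 4 * d ^+ 2 / 2 ^+ n = 4 * (2 ^+ n)^-1 * d ^+ 2 by rewrite mulrAC.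
by apply: key; rewrite invr_gt0 exprn_gt0.
Qed.

End Goursat.

(** * Cauchy's estimate for the derivative and the Lipschitz bound it implies *)

Section CauchyEstimate.
Context {R : realType}.
Notation Co := ((R[i])^o).
Notation I := (0 +i* 1 : R[i]).

Lemma normc_i_mul (z : R[i]) : normc (I * z) = normc z.
Proof. by rewrite normcM normc_i mul1r. Qed.

Lemma near0_normrP (P : set R) :
  (\forall h \near (0:R), P h) <-> exists2 d : R, 0 < d & forall h : R, `|h| < d -> P h.
Proof.
split=> [/nbhs_ballP[d /= d0 H]|[d d0 H]].
  by exists d => // h hd; apply: H; rewrite /ball /= sub0r normrN.
apply/nbhs_ballP; exists d => //= h; rewrite /ball /= sub0r normrN; exact: H.
Qed.

(* In logarithmic coordinates the circle of radius r around w becomes a vertical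
   segment of length 2 pi, which the 2 pi i-periodicity allows to be moved to -oo. *)
Lemma cauchy_estimate (f : Co -> Co) (w D : Co) (r B : R) : 0 < r -> 0 <= B ->
  (forall p : Co, normc (p - w) <= r -> (exists D', has_cderiv f p D') /\ normc (f p) <= B) ->
  has_cderiv f w D -> normc D <= 4 * B / r.
Proof.
move=> r0 B0 H hD.
(* The difference quotient of [f] at [w] in logarithmic coordinates. Its integral over a vertical
   segment of length 2 pi tends to 2 pi D as the real part goes to -oo. *)
pose g (z : Co) : Co := (f (w + cexp z) - f w) * (cexp z)^-1.
pose t2 : R := pi *+ 2.
have t20 : 0 < t2 by rewrite /t2 mulrn_wgt0 // pi_gt0.
have fw : normc (f w) <= B by case: (H w); rewrite ?subrr ?normc0 ?(ltW r0).
have gB (z : Co) : complex.Re z <= ln r -> normc (g z) <= 2 * B / expR (complex.Re z).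
  move=> zr; rewrite /g normcM normcV normc_cexp ler_wpM2r ?invr_ge0 ?expR_ge0 //.
  have : normc (f (w + cexp z)) <= B.
    have [] // := H (w + cexp z); rewrite addrAC subrr add0r normc_cexp.
    by rewrite -[leRHS]lnK ?posrE // ler_expR.
  by have := normcD (f (w + cexp z)) (- f w); rewrite normcNE; lra.
have greg s1 : regular_on g (2 * B / expR s1) s1 (ln r) 0 t2.
  move=> p /andP[p1 p2] _; split; last first.
    apply: (le_trans (gB p p2)).
    by rewrite ler_wpM2l ?mulr_ge0 // lef_pV2 ?posrE ?expR_gt0 // ler_expR.
  have [D' hD'] : exists D', has_cderiv f (w + cexp p) D'.
    have [] // := H (w + cexp p); rewrite addrAC subrr add0r normc_cexp.
    by rewrite -[leRHS]lnK ?posrE // ler_expR.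
  have h1 : has_cderiv (fun z => w + cexp z) p (0 + cexp p).
    by apply: has_cderivD; [exact: has_cderiv_cst|exact: has_cderiv_cexp].
  have h2 := has_cderivD (@has_cderiv_comp R f (fun z => w + cexp z) p _ _ hD' h1) (has_cderiv_cst (- f w) p).
  have h3 := has_cderivM h2 (has_cderivV (has_cderiv_cexp p) (cexp_neq0 p)).
  by eexists; exact: h3.
have per s : g (s +i* t2) = g (s +i* 0).
  by rewrite /g /cexp /= /t2 cos2pi sin2pi cos0 sin0.
have E s1 : s1 <= ln r -> cint 0 t2 (fun t => g (ln r +i* t)) = cint 0 t2 (fun t => g (s1 +i* t)).
  move=> s1r; have := goursat s1r (ltW t20) (greg s1).
  rewrite /rect_integral.
  have -> : cint s1 (ln r) (fun s => g (s +i* t2)) = cint s1 (ln r) (fun s => g (s +i* 0)).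
    by apply: cint_eq => s _; exact: per.
  rewrite subrr add0r => /(congr1 (@normc R)); rewrite normc_i_mul normc0 => /eqP.
  by rewrite normc_eq0 subr_eq0 => /eqP.
have V2 : normc (cint 0 t2 (fun t => g (ln r +i* t))) <= 2 * (2 * B / r) * t2.
  have lr : ln r <= ln r <= ln r by rewrite lexx.
  have bm := bm_vertical (greg (ln r)) lr.
  by have := normc_cint_le (ltW t20) bm; rewrite lnK ?posrE // subr0.
have key e : 0 < e -> normc D * t2 <= 2 * (2 * B / r) * t2 + 2 * e * t2.
  move=> e0; have /has_cderivP/(_ e e0)/near0_normcP[d d0 hd] := hD.
  (* [s1] is so far to the left that on the circle of radius [expR s1] the quotient is within [e] of
     [D]. *)
  pose s1 := Num.min (ln r) (ln (d / 2)).
  have s1r : s1 <= ln r by rewrite /s1 ge_min lexx.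
  have s1d : expR s1 < d.
    apply: (@le_lt_trans _ _ (d / 2)); last by lra.
    by rewrite -[leRHS]lnK ?posrE ?divr_gt0 // ler_expR /s1 ge_min lexx orbT.
  have ss : s1 <= s1 <= ln r by rewrite lexx.
  have bm := bm_vertical (greg s1) ss.
  have bm2 : bounded_measurable 0 t2 (fun t => g (s1 +i* t) - D) e.
    apply: bm_bound (bmB bm (bm_cst _ _ D)) _ => t _.
    have nz := cexp_neq0 (s1 +i* t : Co).
    have -> : g (s1 +i* t) - D =
      (f (w + cexp (s1 +i* t)) - f w - D * cexp (s1 +i* t)) * (cexp (s1 +i* t))^-1.
      by rewrite /g; field.
    rewrite normcM normcV ler_pdivrMr ?normc_gt0 //; apply: hd.
    by rewrite normc_cexp.
  have := normc_cint_le (ltW t20) bm2.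
  rewrite (cintB bm (bm_cst _ _ D)) cint_cst ?(ltW t20) // subr0 -E // => h.
  have := normcD (cint 0 t2 (fun t => g (ln r +i* t)))
    (- (cint 0 t2 (fun t => g (ln r +i* t)) - D * t2%:C)).
  rewrite opprB subrKC normcM normc_real ger0_norm ?(ltW t20) // normcBC => h'.
  by lra.
apply/ler_addgt0Pr => e e0; have e2 : 0 < e / 2 by lra.
rewrite -(ler_pM2r t20); apply: (le_trans (key _ e2)).
by rewrite le_eqVlt; apply/orP; left; apply/eqP; field; rewrite lt0r_neq0.
Qed.

Lemma littleo_is_derive (f : R -> R) (x df : R) :
  (forall e : R, 0 < e -> \forall h \near (0:R), `|f (x + h) - f x - df * h| <= e * `|h|) ->
  is_derive x 1 f df.
Proof.
move=> H.
have L : h^-1 *: (f (h *: (1:R) + x) - f x) @[h --> 0^'] --> df.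
  apply/cvgrPdist_le => e e0; rewrite near_withinE; apply: filterS (H e e0) => h hh h0.
  rewrite [h *: _]mulr1 [_ + x]addrC distrC.
  have -> : h^-1 *: (f (x + h) - f x) - df = (f (x + h) - f x - df * h) / h.
    by rewrite /GRing.scale /=; field.
  by rewrite normrM normfV ler_pdivrMr ?normr_gt0.
split; first by apply/cvg_ex; exists df.
exact: cvg_lim L.
Qed.

Lemma mean_value_bound (f : R -> R) (K : R) :
  (forall x : R, 0 <= x <= 1 -> exists2 df : R, is_derive x 1 f df & `|df| <= K) ->
  `|f 1 - f 0| <= K.
Proof.
move=> H.
have /choice[df hdf] : forall x : R, exists d : R, 0 <= x <= 1 -> is_derive x 1 f d /\ `|d| <= K.
  move=> x; have [xx|_] := boolP (0 <= x <= 1); last by exists 0.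
  by have [d h1 h2] := H x xx; exists d.
have [x x01| |c c01 ->] := @MVT_segment R f df 0 1 ler01.
- by apply: (hdf x _).1; move: x01; rewrite in_itv /= => /andP[/ltW -> /ltW ->].
- apply: continuous_in_subspaceT => x; rewrite inE /= in_itv /= => xx.
  have [[dx _] _] := hdf x xx.
  by apply: differentiable_continuous; apply/derivable1_diffP.
rewrite subr0 mulr1; apply: (hdf c _).2.
by move: c01; rewrite in_itv.
Qed.

(** Discs of radius [r] around the points of the segment stay in the disc of radius [2 * r], so
    Cauchy's estimate bounds the derivative along it by 4 B / r; the mean value theorem, applied to
    real and imaginary part separately, doubles the constant. Only [r] and [B] enter, so the bound
    is uniform over a family with a common [B]. *)
Lemma lipschitz_of_bounded (f : Co -> Co) (w : Co) (r B : R) : 0 < r -> 0 <= B ->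
  (forall p : Co, normc (p - w) <= 2 * r -> (exists D, has_cderiv f p D) /\ normc (f p) <= B) ->
  forall h, normc h <= r -> normc (f (w + h) - f w) <= 8 * B / r * normc h.
Proof.
move=> r0 B0 H h hr.
pose p (t : R) : Co := w + t%:C * h.
have pr t : 0 <= t <= 1 -> normc (p t - w) <= r.
  move=> /andP[t0 t1]; rewrite /p addrAC subrr add0r normcM normc_real ger0_norm //.
  by apply: le_trans hr; rewrite ler_piMl // normc_ge0.
have r2 : r <= 2 * r by lra.
have dp t : 0 <= t <= 1 -> exists2 D, has_cderiv f (p t) D & normc (D * h) <= 4 * B / r * normc h.
  move=> t01; have [[D hD] _] := H (p t) (le_trans (pr t t01) r2); exists D => //.
  rewrite normcM ler_wpM2r ?normc_ge0 //; apply: (cauchy_estimate r0 B0 _ hD) => q qr.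
  apply: H; have -> : q - w = (q - p t) + (p t - w) by ring.
  by apply: (le_trans (normcD _ _)); have := pr t t01; lra.
have small t D e : has_cderiv f (p t) D -> 0 < e -> \forall s \near (0 : R),
    normc (f (p (t + s)) - f (p t) - D * h * s%:C) <= e * `|s|.
  move=> hD e0; pose e' := e / (normc h + 1).
  have h1 : 0 < normc h + 1 by rewrite ltr_wpDl // normc_ge0.
  have e'0 : 0 < e' by rewrite divr_gt0.
  have /has_cderivP/(_ e' e'0)/near0_normcP[d d0 hd] := hD.
  have d1 : 0 < d / (normc h + 1) by rewrite divr_gt0.
  have hs : \forall s \near (0 : R), `|s| < d / (normc h + 1).
    by apply/near0_normrP; exists (d / (normc h + 1)).
  near=> s.
  have sd : `|s| < d / (normc h + 1) by near: s.
  have nsh : normc (s%:C * h) <= `|s| * (normc h + 1).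
    by rewrite normcM normc_real ler_wpM2l // lerDl.
  have := hd (s%:C * h); rewrite ltr_pdivlMr // in sd.
  move=> /(_ (le_lt_trans nsh sd)).
  have -> : p t + s%:C * h = p (t + s) by rewrite /p rmorphD /=; ring.
  have -> : D * (s%:C * h) = D * h * s%:C by ring.
  move=> /le_trans; apply; apply: (le_trans (ler_wpM2l (ltW e'0) nsh)).
  by rewrite /e' le_eqVlt; apply/orP; left; apply/eqP; field; rewrite lt0r_neq0.
have bRe := @mean_value_bound (fun t => complex.Re (f (p t))) (4 * B / r * normc h).
have bIm := @mean_value_bound (fun t => complex.Im (f (p t))) (4 * B / r * normc h).
have p1 : p 1 = w + h by rewrite /p mul1r.
have p0 : p 0 = w by rewrite /p mul0r addr0.
rewrite p1 p0 in bRe bIm.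
apply: (le_trans (normc_le_ReIm _)); rewrite ReCD ImCD ReCN ImCN.
have -> : 8 * B / r * normc h = 4 * B / r * normc h + 4 * B / r * normc h by ring.
apply: lerD.
- apply: bRe => t t01; have [D hD Dh] := dp t t01.
  exists (complex.Re (D * h)); last by apply: le_trans Dh; exact: ler_Re_normc.
  apply: littleo_is_derive => e e0; near=> s.
  have hs : normc (f (p (t + s)) - f (p t) - D * h * s%:C) <= e * `|s|.
    by near: s; exact: small.
  apply: le_trans hs; apply: le_trans (ler_Re_normc _).
  by rewrite le_eqVlt; apply/orP; left; apply/eqP; congr `|_|; rewrite !(ReCD, ReCN, ReCM, ImCM) /=; ring.
- apply: bIm => t t01; have [D hD Dh] := dp t t01.
  exists (complex.Im (D * h)); last by apply: le_trans Dh; exact: ler_Im_normc.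
  apply: littleo_is_derive => e e0; near=> s.
  have hs : normc (f (p (t + s)) - f (p t) - D * h * s%:C) <= e * `|s|.
    by near: s; exact: small.
  apply: le_trans hs; apply: le_trans (ler_Im_normc _).
  by rewrite le_eqVlt; apply/orP; left; apply/eqP; congr `|_|; rewrite !(ImCD, ImCN, ReCM, ImCM) /=; ring.
Unshelve. all: by end_near. Qed.

End CauchyEstimate.

(** * Analyticity of the propagator in the frequency *)

Section ComplexSequences.
Context {R : realType}.
Notation Co := ((R[i])^o).

Lemma cvgs_cst (c : Co) : (fun _ : nat => c) @ \oo --> c.
Proof. exact: (@cvgc_cst R nat \oo (@filter_filter _ _ eventually_filter) c). Qed.

Lemma cvgsD (f g : nat -> Co) (k l : Co) : f @ \oo --> k -> g @ \oo --> l ->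
  f n + g n @[n --> \oo] --> k + l.
Proof. exact: (@cvgcD R nat \oo (@filter_filter _ _ eventually_filter)). Qed.

Lemma cvgsM (f g : nat -> Co) (k l : Co) : f @ \oo --> k -> g @ \oo --> l ->
  f n * g n @[n --> \oo] --> k * l.
Proof. exact: (@cvgcM R nat \oo (@filter_filter _ _ eventually_filter)). Qed.

Lemma cvgsN (f : nat -> Co) (k : Co) : f @ \oo --> k -> - f n @[n --> \oo] --> - k.
Proof. exact: (@cvgcN R nat \oo (@filter_filter _ _ eventually_filter)). Qed.

Lemma cvgsV (f : nat -> Co) (k : Co) : k != 0 -> f @ \oo --> k ->
  (f n)^-1 @[n --> \oo] --> k^-1.
Proof. exact: (@cvgcV R nat \oo (@filter_filter _ _ eventually_filter)). Qed.

Lemma cvgsMl (k : Co) (f : nat -> Co) (l : Co) : f @ \oo --> l -> k * f n @[n --> \oo] --> k * l.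
Proof. exact: (cvgsM (@cvgs_cst k)). Qed.

Lemma cvgs_eq (f g : nat -> Co) (k l : Co) : f =1 g -> k = l -> f @ \oo --> k -> g @ \oo --> l.
Proof. by move=> /funext -> ->. Qed.

End ComplexSequences.

Section PropagatorAnalytic.
Context {R : realType} (a : R) (rho' C' : R -> R[i] -> R[i])
  (M : R -> R[i] -> 'M[R[i]]_2).
Context (ha : 0 < a) (hrho' : slab_parameter a rho') (hC' : slab_parameter a C')
  (hM : is_propagator a rho' C' M).
Notation Co := ((R[i])^o).
Notation I := (0 +i* 1 : R[i]).

Lemma slab_seq_continuous f x (w : Co) (u : nat -> Co) : slab_parameter a f ->
  0 <= x <= a -> 0 <= complex.Im w -> (forall n, 0 <= complex.Im (u n)) ->
  u n @[n --> \oo] --> w -> (f x (u n) : Co) @[n --> \oo] --> (f x w : Co).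
Proof.
move=> hf xa w0 un uw.
have /subspace_continuousP/(_ w w0) cf := slab_continuous hf xa.
have uw' : u n @[n --> \oo] --> within (@closed_uhp R) (nbhs w).
  move=> A /= /uw; rewrite !near_simpl => hA.
  near=> n; have H : closed_uhp (u n) -> A (u n) by near: n; exact: hA.
  exact: H (un n).
exact: cvg_comp _ _ uw' cf.
Unshelve. all: by end_near. Qed.

Lemma cvgc_mul0 (f g : nat -> Co) (S : R) : f n @[n --> \oo] --> (0:Co) ->
  (forall n, normc (g n) <= S) -> f n * g n @[n --> \oo] --> (0:Co).
Proof.
move=> /cvgcP f0 gS; apply/cvgcP => e e0.
have S0 : 0 <= S := le_trans (normc_ge0 _) (gS 0%N).
have e1 : 0 < e / (S + 1) by rewrite divr_gt0 // ltr_wpDl.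
near=> n; rewrite subr0 normcM.
have h : normc (f n - 0) < e / (S + 1) by near: n; exact: f0.
rewrite subr0 ltr_pdivlMr ?ltr_wpDl // in h; apply: le_lt_trans h.
by rewrite ler_wpM2l ?normc_ge0 // (le_trans (gS n)) // lerDl.
Unshelve. all: by end_near. Qed.

Lemma cvgc_addl (w : Co) (h : nat -> Co) : h n @[n --> \oo] --> (0:Co) ->
  w + h n @[n --> \oo] --> w.
Proof. by move=> h0; apply: cvgs_eq (cvgsD (@cvgs_cst R w) h0) => //; rewrite addr0. Qed.

Lemma coef_seq_continuous f x (w : Co) (h : nat -> Co) : slab_parameter a f ->
  0 <= x <= a -> 0 <= complex.Im w -> (forall n, 0 <= complex.Im (w + h n)) ->
  h n @[n --> \oo] --> (0:Co) ->
  (coef f (w + h n) x : Co) @[n --> \oo] --> (coef f w x : Co).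
Proof.
move=> hf xa w0 hn h0; have c1 := @cvgc_addl w h h0.
apply: (@cvgsM R (fun n => I * (w + h n)) (fun n => f x (w + h n))).
  exact: (@cvgsMl R I _ _ c1).
exact: slab_seq_continuous.
Qed.

(** In [propagator_variation] the differences of coefficients tend to 0 at each point of the slab
    and are uniformly bounded, so the integrals vanish in the limit by dominated convergence. *)
Lemma propagator_continuous x i j (w : Co) (h : nat -> Co) :
  0 <= x <= a -> 0 <= complex.Im w ->
  (forall n, 0 <= complex.Im (w + h n) /\ normc (h n) <= 1) ->
  h n @[n --> \oo] --> (0:Co) ->
  (M x (w + h n) i j : Co) @[n --> \oo] --> (M x w i j : Co).
Proof.
move=> xa w0 hn h0; have /andP[x0 xa'] := xa.
have [B B0 HB] := slab_bound hrho' hC'.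
have r0 : 0 < normc w + 1 by rewrite ltr_wpDl // normc_ge0.
have wr : normc w <= normc w + 1 by lra.
have whr n : normc (w + h n) <= normc w + 1.
  by apply: (le_trans (normcD _ _)); rewrite lerD2l; case: (hn n).
have sol n k := propagator_solution ha hrho' hC' hM B0 r0 HB k (proj1 (hn n)) (whr n).
have sol0 k := propagator_solution ha hrho' hC' hM B0 r0 HB k w0 wr.
set r := normc w + 1 in sol sol0; set S := 2 * expR _ in sol sol0.
pose J k n := duhamel_integral rho' C' M w (coef C' (w + h n)) (coef rho' (w + h n))
   (fun s => M s (w + h n) 0 j) (fun s => M s (w + h n) 1 j) k x.
have J0 k : (J k n : Co) @[n --> \oo] --> (0 : Co).
  rewrite /J /duhamel_integral.
  set F := fun n s => (coef rho' (w + h n) s - coef rho' w s) * (M s w 0 k * M s (w + h n) 0 j) -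
    (coef C' (w + h n) s - coef C' w s) * (M s w 1 k * M s (w + h n) 1 j).
  have bF n : bounded_measurable 0 x (F n) ((r * B + r * B) * (S * S) + (r * B + r * B) * (S * S)).
    have [a1 a2 a3 a4 _] := sol n j; have [b1 b2 b3 b4 _] := sol0 k.
    apply: (bm_sub (lexx 0) xa').
    by apply: bmB; apply: bmM; [exact: bmB|exact: bmM|exact: bmB|exact: bmM].
  have cF s : 0 <= s <= x -> F n s @[n --> \oo] --> (0 : Co).
    move=> /andP[s0 sx]; have sa : 0 <= s <= a by rewrite s0 (le_trans sx).
    have c1 f : slab_parameter a f -> coef f (w + h n) s - coef f w s @[n --> \oo] --> (0:Co).
      move=> hf; have := @coef_seq_continuous f s w h hf sa w0 (fun n => proj1 (hn n)) h0.
      move=> H; apply: cvgs_eq (cvgsD H (@cvgs_cst R (- coef f w s))) => //.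
      by rewrite subrr.
    have bb i' n : normc (M s w i' k * M s (w + h n) i' j) <= S * S.
      have [_ _ [_ _ a3] [_ _ a4] _] := sol n j; have [_ _ [_ _ b3] [_ _ b4] _] := sol0 k.
      rewrite normcM; apply: ler_pM; rewrite ?normc_ge0 //.
      - by case: (ord2P i') => ->; [exact: b3|exact: b4].
      - by case: (ord2P i') => ->; [exact: a3|exact: a4].
    apply: cvgs_eq (cvgsD (cvgc_mul0 (c1 _ hrho') (bb 0)) (cvgsN (cvgc_mul0 (c1 _ hC') (bb 1)))) => //.
    by rewrite oppr0 addr0.
  have [_ H] := @cint_cvg R 0 x _ F (fun=> 0) bF cF.
  by apply: cvgs_eq H => //; rewrite (cint_cst 0 x0) mul0r.
have E n : M x (w + h n) i j = M x w i j + (M x w i 1 * J 0 n - M x w i 0 * J 1 n).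
  have := propagator_variation ha hrho' hC' hM i j xa w0 (proj1 (hn n)).
  by rewrite -/(J 0 n) -/(J 1 n) => <-; rewrite subrKC.
apply: cvgs_eq (cvgsD (@cvgs_cst R (M x w i j))
  (cvgsD (@cvgsMl R (M x w i 1) _ _ (J0 0)) (cvgsN (@cvgsMl R (M x w i 0) _ _ (J0 1))))).
- by move=> n; rewrite E.
- by rewrite !mulr0 oppr0 !addr0.
Qed.

Lemma slab_has_cderiv f x (w : Co) : slab_parameter a f -> 0 <= x <= a ->
  0 < complex.Im w -> exists D, has_cderiv (f x) w D.
Proof. by move=> hf xa w0; apply: derivable_has_cderiv; exact: (slab_analytic hf xa w0). Qed.

(** The radius [complex.Im w / 4] keeps the doubled disc of [lipschitz_of_bounded] in the open half
    plane and turns its 8 into 32. The constant is the same for all [x], so it can dominate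
    difference quotients under the integral. *)
Lemma slab_lipschitz f (B : R) (w : Co) : slab_parameter a f -> 0 < complex.Im w -> 0 <= B ->
  (forall x w, 0 <= x <= a -> 0 <= complex.Im w -> normc (f x w) <= B) ->
  forall x h, 0 <= x <= a -> normc h <= complex.Im w / 4 ->
    normc (f x (w + h) - f x w) <= 32 * B / complex.Im w * normc h.
Proof.
move=> hf w0 B0 fB x h xa hr.
have -> : 32 * B / complex.Im w = 8 * B / (complex.Im w / 4).
  by field; rewrite lt0r_neq0.
have r0 : 0 < complex.Im w / 4 by rewrite divr_gt0.
apply: (@lipschitz_of_bounded R (f x) w (complex.Im w / 4) B r0 B0) => // p pw.
have p0 : 0 < complex.Im p.
  have := le_trans (ler_Im_normc _) pw; rewrite ImCD ImCN ler_norml => /andP[h1 _]; lra.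
by split; [exact: slab_has_cderiv|apply: fB => //; exact: ltW].
Qed.

(** Dividing [propagator_variation] by the increment turns differences of coefficients into
    difference quotients, which converge at each point of the slab and are dominated through
    [slab_lipschitz]. *)
Lemma propagator_has_cderiv i j (w : Co) : 0 < complex.Im w ->
  exists D, has_cderiv (fun w => M a w i j) w D.
Proof.
move=> w0; have w0' := ltW w0.
have aa : 0 <= a <= a by rewrite lexx ltW.
have [B B0 HB] := slab_bound hrho' hC'.
have r0 : 0 < normc w + 1 by rewrite ltr_wpDl // normc_ge0.
have wr : normc w <= normc w + 1 by lra.
pose L := 32 * B / complex.Im w.
have deriv f : slab_parameter a f -> exists d : R -> Co,
    forall s, 0 <= s <= a -> has_cderiv (f s) w (d s).
  move=> hf; have /choice[d hd] : forall s, exists D : Co, 0 <= s <= a -> has_cderiv (f s) w D.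
    move=> s; have [sa|_] := boolP (0 <= s <= a); last by exists 0.
    by have [D hD] := slab_has_cderiv hf sa w0; exists D.
  by exists d.
have [dr hdr] := deriv _ hrho'; have [dc hdc] := deriv _ hC'.
(* [G f d] is the frequency derivative of [coef f], and [J] is the Duhamel integral with it in place
   of the differences of coefficients. *)
pose G f (d : R -> Co) s : Co := I * (f s w + w * d s).
pose J k := cint 0 a (fun s => G rho' dr s * (M s w 0 k * M s w 0 j) - G C' dc s * (M s w 1 k * M s w 1 j)).
exists (M a w i 1 * J 0 - M a w i 0 * J 1).
apply/has_cderivP => e e0.
(* Increments are nonzero to allow division; the bound 1 keeps the frequencies in a fixed disc, and
   the last bound keeps them in the half plane and within reach of [slab_lipschitz]. *)
pose P (h : Co) := [/\ h != 0, normc h <= 1 & normc h <= complex.Im w / 4].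
have PI h : P h -> 0 <= complex.Im (w + h).
  move=> [_ _ hw]; rewrite ImCD; have := le_trans (ler_Im_normc h) hw.
  by rewrite ler_norml => /andP[h1 _]; lra.
pose Q (h : Co) : Co := (M a (w + h) i j - M a w i j) / h.
have main : exists2 d : R, 0 < d & forall h, P h -> normc h < d ->
    normc (Q h - (M a w i 1 * J 0 - M a w i 0 * J 1)) < e.
  apply: (@seq_cvgc R P Q _ _ _ e0) => h Ph h0.
  have hn n : 0 <= complex.Im (w + h n) /\ normc (h n) <= 1.
    by split; [exact: PI|case: (Ph n)].
  have hne n : h n != 0 by case: (Ph n).
  have whr n : normc (w + h n) <= normc w + 1.
    by apply: (le_trans (normcD _ _)); rewrite lerD2l; case: (hn n).
  have sol n k := propagator_solution ha hrho' hC' hM B0 r0 HB k (proj1 (hn n)) (whr n).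
  have sol0 k := propagator_solution ha hrho' hC' hM B0 r0 HB k w0' wr.
  set r := normc w + 1 in sol sol0; set S := 2 * expR _ in sol sol0.
  pose Jn k n := duhamel_integral rho' C' M w (coef C' (w + h n)) (coef rho' (w + h n))
     (fun s => M s (w + h n) 0 j) (fun s => M s (w + h n) 1 j) k a.
  pose q f n s := (h n)^-1 * (coef f (w + h n) s - coef f w s).
  have qB f n s : slab_parameter a f ->
     (forall x w, 0 <= x <= a -> 0 <= complex.Im w -> normc (f x w) <= B) ->
     0 <= s <= a -> normc (q f n s) <= B + r * L.
    move=> hf fB sa.
    have -> : q f n s = I * (f s (w + h n) + w * ((f s (w + h n) - f s w) / h n)).
      by rewrite /q /coef; field.
    rewrite normcM normc_i mul1r; apply: (le_trans (normcD _ _)).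
    apply: lerD; first by apply: fB => //; case: (hn n).
    rewrite normcM ler_pM ?normc_ge0 // normcM normcV ler_pdivrMr ?normc_gt0 //.
    by apply: slab_lipschitz => //; [exact: ltW|case: (Ph n)].
  have qc f d s : slab_parameter a f -> has_cderiv (f s) w (d s) -> 0 <= s <= a ->
     q f n s @[n --> \oo] --> G f d s.
    move=> hf hd sa.
    have E n : q f n s = I * (f s (w + h n) + w * ((f s (w + h n) - f s w) / h n)).
      by rewrite /q /coef; field.
    have c1 : (f s (w + h n) : Co) @[n --> \oo] --> (f s w : Co).
      exact: (@slab_seq_continuous f s w _ hf sa w0' (fun n => proj1 (hn n)) (@cvgc_addl w h h0)).
    have c2 : ((f s (w + h n) - f s w) / h n : Co) @[n --> \oo] --> (d s : Co).
      apply/cvgcP => e' e'0; have e2 : 0 < e' / 2 by rewrite divr_gt0.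
      have /has_cderivP/(_ _ e2)/near0_normcP[dl dl0 hdl] := hd.
      move/cvgcP : h0 => h0.
      near=> n; have hnn : normc (h n - 0) < dl by near: n; exact: h0.
      rewrite subr0 in hnn; have := hdl _ hnn.
      have -> : (f s (w + h n) - f s w) / h n - d s = (f s (w + h n) - f s w - d s * h n) / h n.
        by field.
      move=> hh; rewrite normcM normcV ltr_pdivrMr ?normc_gt0 //; apply: (le_lt_trans hh).
      by rewrite ltr_pM2r ?normc_gt0 //; lra.
    by apply: cvgs_eq (@cvgsMl R I _ _ (cvgsD c1 (@cvgsMl R w _ _ c2))) => // n; rewrite E.
  have Jc k : ((h n)^-1 * Jn k n : Co) @[n --> \oo] --> (J k : Co).
    set F := fun n s => q rho' n s * (M s w 0 k * M s (w + h n) 0 j) -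
      q C' n s * (M s w 1 k * M s (w + h n) 1 j).
    have bq f n : bounded_measurable 0 a (coef f (w + h n)) (r * B) ->
        bounded_measurable 0 a (coef f w) (r * B) -> slab_parameter a f ->
        (forall x w, 0 <= x <= a -> 0 <= complex.Im w -> normc (f x w) <= B) ->
        bounded_measurable 0 a (q f n) (B + r * L).
      move=> b1 b2 hf fB; apply: bm_bound (bmZ (h n)^-1 (bmB b1 b2)) _ => s sa.
      exact: qB.
    have bF n : bounded_measurable 0 a (F n) ((B + r * L) * (S * S) + (B + r * L) * (S * S)).
      have [a1 a2 a3 a4 _] := sol n j; have [b1 b2 b3 b4 _] := sol0 k.
      apply: bmB; apply: bmM; [|exact: bmM| |exact: bmM].
      - by apply: bq => // x v xa v0; case: (HB x v xa v0).
      - by apply: bq => // x v xa v0; case: (HB x v xa v0).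
    have cF s : 0 <= s <= a -> F n s @[n --> \oo] -->
        (G rho' dr s * (M s w 0 k * M s w 0 j) - G C' dc s * (M s w 1 k * M s w 1 j) : Co).
      move=> sa.
      have cM i' := @propagator_continuous s i' j w h sa w0' hn h0.
      have t i' f d : slab_parameter a f -> has_cderiv (f s) w (d s) ->
        q f n s * (M s w i' k * M s (w + h n) i' j) @[n --> \oo] --> (G f d s * (M s w i' k * M s w i' j) : Co).
        move=> hf hd; exact: (cvgsM (qc f d s hf hd sa) (@cvgsMl R (M s w i' k) _ _ (cM i'))).
      exact: (cvgsD (t 0 rho' dr hrho' (hdr s sa)) (cvgsN (t 1 C' dc hC' (hdc s sa)))).
    have [_] := @cint_cvg R 0 a _ F _ bF cF.
    apply: cvgs_eq => // n; rewrite /Jn /duhamel_integral.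
    have [a1 a2 a3 a4 _] := sol n j; have [b1 b2 b3 b4 _] := sol0 k.
    rewrite -(cintZ (h n)^-1 (bmB (bmM (bmB a2 b2) (bmM b3 a3)) (bmM (bmB a1 b1) (bmM b4 a4)))).
    by apply: cint_eq => s _; rewrite /F /q; ring.
  have QE n : Q (h n) = M a w i 1 * ((h n)^-1 * Jn 0 n) + - (M a w i 0 * ((h n)^-1 * Jn 1 n)).
    rewrite /Q (propagator_variation ha hrho' hC' hM i j aa w0' (proj1 (hn n))).
    by rewrite -/(Jn 0 n) -/(Jn 1 n); ring.
  by apply: cvgs_eq (cvgsD (@cvgsMl R (M a w i 1) _ _ (Jc 0)) (cvgsN (@cvgsMl R (M a w i 0) _ _ (Jc 1)))) => //.
have [d d0 hd] := main.
apply: (proj2 (near0_normcP _)); exists (Num.min d (Num.min 1 (complex.Im w / 4))).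
  by rewrite !lt_min d0 ltr01 divr_gt0.
move=> h; rewrite !lt_min => /and3P[h1 h2 h3].
have [->|hne] := eqVneq h 0.
  by rewrite addr0 subrr mulr0 subr0 normc0 mulr0.
have := hd h (And3 hne (ltW h2) (ltW h3)) h1; rewrite /Q => hh.
set D := M a w i 1 * J 0 - M a w i 0 * J 1 in hh *.
have -> : M a (w + h) i j - M a w i j - D * h = ((M a (w + h) i j - M a w i j) / h - D) * h.
  by field.
by rewrite normcM ler_wpM2r ?normc_ge0 // ltW.
Unshelve. all: by end_near. Qed.

End PropagatorAnalytic.

(** * The sum rule for functions on the half plane *)

Section HalfPlane.
Context {R : realType}.
Notation Co := ((R[i])^o).
Notation I := (0 +i* 1 : R[i]).
Notation mu := (@lebesgue_measure R).
Context (F : Co -> Co) (B K d al : R).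
Context (F_bounded : forall w : Co, 0 <= complex.Im w -> normc (F w) <= B).
Context (F_continuous : forall w : Co, 0 <= complex.Im w -> forall e : R, 0 < e ->
  exists2 dl : R, 0 < dl & forall w' : Co, 0 <= complex.Im w' -> normc (w' - w) < dl ->
    normc (F w' - F w) < e).
Context (F_analytic : forall w : Co, 0 < complex.Im w -> exists D, has_cderiv F w D).
Context (F_real : forall x : R, F (- x%:C) = conjc (F x%:C)).
Context (d_gt0 : 0 < d).
Context (F_low_freq : forall w : Co, 0 <= complex.Im w -> normc w < d ->
  normc (F w - I * al%:C * w) <= K * normc w ^+ 2).

Lemma halfplane_cvg (T : Type) (U : set_system T) {FU : Filter U} (u : T -> Co) (w : Co) :
  (forall x, 0 <= complex.Im (u x)) -> 0 <= complex.Im w -> u @ U --> w ->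
  F (u x) @[x --> U] --> F w.
Proof.
move=> u0 w0 /cvgcP uw; apply/cvgcP => e e0; have [dl dl0 hdl] := F_continuous w0 e0.
near=> x; apply: hdl => //; near: x; exact: uw.
Unshelve. all: by end_near. Qed.

(** With w = exp z, the form F(w) / w^2 dw becomes G(z) dz. *)
Let G (z : Co) : Co := F (cexp z) * (cexp z)^-1.

Lemma Im_cexp_ge0 (z : Co) : 0 <= complex.Im z <= pi -> 0 <= complex.Im (cexp z).
Proof. by move=> zpi; rewrite /= mulr_ge0 ?expR_ge0 ?sin_ge0_pi. Qed.

Lemma Im_cexp_gt0 (z : Co) : 0 < complex.Im z < pi -> 0 < complex.Im (cexp z).
Proof. by move=> zpi; rewrite /= mulr_gt0 ?expR_gt0 ?sin_gt0_pi. Qed.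

Lemma halfplane_bound_ge0 : 0 <= B.
Proof. by apply: (le_trans (normc_ge0 (F 0))); apply: F_bounded. Qed.

Lemma polar_bound (z : Co) : 0 <= complex.Im z <= pi -> normc (G z) <= B / expR (complex.Re z).
Proof.
move=> zpi; rewrite /G normcM normcV normc_cexp ler_wpM2r ?invr_ge0 ?expR_ge0 //.
by apply: F_bounded; exact: Im_cexp_ge0.
Qed.

(** The margin [e] at both ends of the angle keeps [cexp] in the open half plane, where [F] is
    differentiable. *)
Lemma polar_regular (s1 s2 e : R) : 0 < e ->
  regular_on G (B / expR s1) s1 s2 e (pi - e).
Proof.
move=> e0 p /andP[p1 p2] /andP[q1 q2].
have qpi : 0 < complex.Im p < pi by lra.
split; last first.
  apply: (le_trans (polar_bound _)); first by lra.
  by rewrite ler_wpM2l ?halfplane_bound_ge0 // lef_pV2 ?posrE ?expR_gt0 // ler_expR.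
have [D hD] := F_analytic (Im_cexp_gt0 qpi).
have h1 := @has_cderiv_comp R F cexp p _ _ hD (has_cderiv_cexp p).
by eexists; exact: (has_cderivM h1 (has_cderivV (has_cderiv_cexp p) (cexp_neq0 p))).
Qed.

Lemma low_freq_const_ge0 : 0 <= K.
Proof.
have h := @F_low_freq (d / 2)%:C (lexx 0).
rewrite normc_real ger0_norm in h; last by have := d_gt0; lra.
have d2 : 0 < (d / 2) ^+ 2 by rewrite exprn_gt0 //; have := d_gt0; lra.
rewrite -(ler_pM2r d2) mul0r; apply: (le_trans (normc_ge0 _) (h _)).
by have := d_gt0; lra.
Qed.

(* Contour integral of F(w)/w^2 along the boundary of a half annulus, from which a
   neighbourhood of the real axis is removed. *)
Lemma polar_contour (N e : R) : 0 <= N -> expR (- N) < d -> 0 < e -> 2 * e <= pi ->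
  normc (cint (- N) N (fun s => G (s +i* e)) - cint (- N) N (fun s => G (s +i* (pi - e))) +
         (al * (pi - 2 * e))%:C) <= 2 * (B + K) * pi * expR (- N).
Proof.
move=> N0 Nd e0 epi.
have NN : - N <= N by lra.
have ee : e <= pi - e by lra.
have reg := @polar_regular (- N) N e e0.
have := goursat NN ee reg; rewrite /rect_integral.
set A := cint _ _ _ - cint _ _ _; set V2 := cint _ _ _; set V1 := cint _ _ _ => E.
have len : (pi - e) - e = pi - 2 * e by ring.
(* Outer half circle: [F] is bounded and the radius is [expR N]. *)
have b2 : bounded_measurable e (pi - e) (fun t => G (N +i* t)) (B * expR (- N)).
  have NNN : - N <= N <= N by rewrite NN lexx.
  apply: bm_bound (bm_vertical reg NNN) _ => t /andP[t1 t2].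
  by rewrite expRN; apply: polar_bound => /=; lra.
have h2 : normc V2 <= 2 * (B * expR (- N)) * pi.
  apply: (le_trans (normc_cint_le ee b2)); rewrite len ler_wpM2l ?mulr_ge0 ?halfplane_bound_ge0 ?expR_ge0 //.
  by lra.
have b1' : bounded_measurable e (pi - e) (fun t => G ((- N) +i* t)) (B / expR (- N)).
  have NNN : - N <= - N <= N by rewrite NN lexx.
  exact: (bm_vertical reg NNN).
(* Inner half circle: F(w) / w differs from i al by at most [K] times the radius [expR (- N)]. *)
have b1 : bounded_measurable e (pi - e) (fun t => G ((- N) +i* t) - I * al%:C) (K * expR (- N)).
  apply: bm_bound (bmB b1' (bm_cst _ _ (I * al%:C))) _ => t /andP[t1 t2].
  set z : Co := (- N) +i* t; have nz := cexp_neq0 z.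
  have zi : 0 <= complex.Im z <= pi by rewrite /z /=; lra.
  have nE : normc (cexp z) = expR (- N) by rewrite normc_cexp.
  have -> : G z - I * al%:C = (F (cexp z) - I * al%:C * cexp z) * (cexp z)^-1.
    by rewrite /G; field.
  rewrite normcM normcV ler_pdivrMr ?normc_gt0 //.
  have := F_low_freq (Im_cexp_ge0 zi); rewrite nE => /(_ Nd) h.
  by apply: (le_trans h); rewrite expr2 mulrA.
have h1 : normc (V1 - I * al%:C * (pi - 2 * e)%:C) <= 2 * (K * expR (- N)) * pi.
  have := normc_cint_le ee b1; rewrite (cintB b1' (bm_cst _ _ (I * al%:C))) cint_cst // len.
  move=> h; apply: (le_trans h); rewrite ler_wpM2l ?mulr_ge0 ?low_freq_const_ge0 ?expR_ge0 //.
  by lra.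
(* The main term of the inner arc is i times i al (pi - 2 e), whence its sign. *)
have -> : A + (al * (pi - 2 * e))%:C = I * (V1 - I * al%:C * (pi - 2 * e)%:C) - I * V2.
  have -> : A = - (I * (V2 - V1)) by apply/eqP; rewrite -addr_eq0; apply/eqP.
  have II : I * I = -1 by apply: complex_eq; rewrite ?ReCM ?ImCM /=; ring.
  rewrite rmorphM /=.
  have -> : I * (V1 - I * al%:C * (pi - 2 * e)%:C) - I * V2 =
    I * V1 - (I * I) * (al%:C * (pi - 2 * e)%:C) - I * V2 by ring.
  by rewrite II; ring.
apply: (le_trans (normcD _ _)); rewrite normcNE !normc_i_mul.
apply: (le_trans (lerD h1 h2)).
by rewrite le_eqVlt; apply/orP; left; apply/eqP; ring.
Qed.

Lemma cexp_seq_cvg (s l : R) (u : nat -> R) : u n @[n --> \oo] --> l ->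
  cexp (s +i* u n) @[n --> \oo] --> cexp (s +i* l).
Proof.
move=> ul; apply: (@cvg_ReIm R nat \oo (@filter_filter _ _ eventually_filter)) => /=.
- by apply: cvgM; [exact: cvg_cst|apply: (continuous_cvg _ _ ul); exact: continuous_cos].
- by apply: cvgM; [exact: cvg_cst|apply: (continuous_cvg _ _ ul); exact: continuous_sin].
Qed.

Lemma polar_seq_cvg (s l : R) (u : nat -> R) : u n @[n --> \oo] --> l ->
  (forall n, 0 <= u n <= pi) -> 0 <= l <= pi ->
  G (s +i* u n) @[n --> \oo] --> G (s +i* l).
Proof.
move=> ul un lpi; have c := @cexp_seq_cvg s l u ul.
have := @halfplane_cvg nat \oo (@filter_filter _ _ eventually_filter) _ _
  (fun n => Im_cexp_ge0 (un n : 0 <= complex.Im (s +i* u n : Co) <= pi))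
  (Im_cexp_ge0 (lpi : 0 <= complex.Im (s +i* l : Co) <= pi)) c.
by move=> cF; apply: (cvgsM cF (cvgsV (cexp_neq0 _) c)).
Qed.

Lemma cvgs_normc_le (u : nat -> Co) (l : Co) (c : R) : u n @[n --> \oo] --> l ->
  (forall n, normc (u n) <= c) -> normc l <= c.
Proof.
move=> /cvgcP ul uc; apply/ler_addgt0Pr => e e0.
have [n0 _ /(_ n0 (leqnn _)) /= h] := ul e e0.
have := normcD (u n0) (- (u n0 - l)); rewrite normcNE opprB subrKC => h'.
by have := uc n0; lra.
Qed.

(** The two edges of the strip lie over the positive and the negative real axis; by the symmetry of
    [F] their contributions are conjugate, so twice the real part survives. *)
Lemma polar_real_axis (s : R) : G (s +i* 0) - G (s +i* pi) =
  (2 * (complex.Re (F (expR s)%:C) / expR s))%:C.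
Proof.
have e0 : cexp (s +i* 0) = (expR s)%:C by rewrite /cexp /= cos0 sin0 mulr1 mulr0.
have e1 : cexp (s +i* pi) = - (expR s)%:C.
  by rewrite /cexp /= cospi sinpi mulrN1 mulr0; apply: complex_eq => /=; rewrite ?oppr0.
rewrite /G e0 e1 F_real.
have nz : (expR s)%:C != 0 :> R[i].
  by apply/eqP => /(congr1 (@complex.Re R))/= h; have := expR_gt0 s; rewrite h ltxx.
have -> : F (expR s)%:C * (expR s)%:C^-1 - conjc (F (expR s)%:C) * (- (expR s)%:C)^-1 =
  (F (expR s)%:C + conjc (F (expR s)%:C)) / (expR s)%:C by field.
rewrite -fmorphV; apply: complex_eq; rewrite ?ReCM ?ImCM ?ReCD ?ImCD ?ReCJ ?ImCJ /=; ring.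
Qed.

(** [F] is only continuous up to the real axis, so the edges are reached as a limit of angles [e n]
    tending to 0, with [B / expR (- N)] as the dominating constant. *)
Lemma half_annulus (N : R) : 0 <= N -> expR (- N) < d ->
  bounded_measurable (- N) N (fun s => G (s +i* 0) - G (s +i* pi)) (B / expR (- N) + B / expR (- N)) /\
  `| \int[mu]_(s in `[(- N), N]) (2 * (complex.Re (F (expR s)%:C) / expR s)) + al * pi |
   <= 2 * (B + K) * pi * expR (- N).
Proof.
move=> N0 Nd; have pi0 : 0 < pi :> R := pi_gt0 R.
(* The factor pi / 3 keeps every angle within the condition [2 * e <= pi] of [polar_contour]. *)
pose e n : R := pi / 3 * n.+1%:R^-1.
have e0 n : 0 < e n by rewrite /e mulr_gt0 ?divr_gt0 ?invr_gt0.
have e1 n : 3 * e n <= pi.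
  have : (n.+1%:R : R)^-1 <= 1 by rewrite invf_le1 // ler1n.
  move=> h; have -> : 3 * e n = pi * n.+1%:R^-1 by rewrite /e; field; rewrite gt_eqF.
  by rewrite ler_piMr // ltW.
have ce : e n @[n --> \oo] --> (0 : R).
  have : e n @[n --> \oo] --> pi / 3 * 0 by apply: cvgM; [exact: cvg_cst|exact: cvg_harmonic].
  by rewrite mulr0.
have cpe : pi - e n @[n --> \oo] --> (pi : R).
  have : pi - e n @[n --> \oo] --> pi - 0 by apply: cvgB => //; exact: cvg_cst.
  by rewrite subr0.
have reg n := @polar_regular (- N) N (e n) (e0 n).
have b0 n : bounded_measurable (- N) N (fun s => G (s +i* e n)) (B / expR (- N)).
  by apply: (bm_horizontal (reg n)); have := e0 n; have := e1 n; lra.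
have b1 n : bounded_measurable (- N) N (fun s => G (s +i* (pi - e n))) (B / expR (- N)).
  by apply: (bm_horizontal (reg n)); have := e0 n; have := e1 n; lra.
have [bb0 c0] := @cint_cvg R (- N) N _ _ (fun s => G (s +i* 0)) b0
  (fun s _ => @polar_seq_cvg s 0 e ce (fun n => ltac:(have := e0 n; have := e1 n; lra)) ltac:(lra)).
have [bb1 c1] := @cint_cvg R (- N) N _ _ (fun s => G (s +i* pi)) b1
  (fun s _ => @polar_seq_cvg s pi (fun n => pi - e n) cpe
     (fun n => ltac:(have := e0 n; have := e1 n; lra)) ltac:(lra)).
split; first exact: bmB.
have cc : ((al * (pi - 2 * e n))%:C : Co) @[n --> \oo] --> ((al * pi)%:C : Co).
  apply: (@cvg_ReIm R nat \oo (@filter_filter _ _ eventually_filter)) => /=; last exact: cvg_cst.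
  have : al * (pi - 2 * e n) @[n --> \oo] --> al * (pi - 2 * 0).
    apply: cvgM; first exact: cvg_cst.
    apply: cvgB; first exact: cvg_cst.
    by apply: cvgM => //; exact: cvg_cst.
  by rewrite mulr0 subr0.
have := cvgs_normc_le (cvgsD (cvgsD c0 (cvgsN c1)) cc)
  (fun n => polar_contour N0 Nd (e0 n) ltac:(have := e0 n; have := e1 n; lra)).
rewrite -(cintB bb0 bb1) => h.
apply: le_trans h; apply: le_trans (ler_Re_normc _).
rewrite ReCD /= le_eqVlt; apply/orP; left; apply/eqP; congr `| _ + _ |.
by apply: eq_Rintegral => s _; rewrite polar_real_axis.
Qed.

End HalfPlane.

(** * From half annuli to the integral over the half line *)

Section ImproperIntegral.
Context {R : realType}.
Notation mu := (@lebesgue_measure R).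

Lemma integrable_oneDsqrV (K : R) :
  mu.-integrable `]0, +oo[ (EFin \o (fun x => K * (oneDsqr x)^-1)).
Proof.
have i0 : mu.-integrable `[0, +oo[ (EFin \o (fun x : R => (oneDsqr x)^-1)).
  apply/integrableP; split.
    apply/measurable_EFinP; apply: subspace_continuous_measurable_fun => //.
    by apply: continuous_subspaceT; exact: continuous_oneDsqrV.
  under eq_integral => x _.
    rewrite /= ger0_norm; last by rewrite invr_ge0 addr_ge0 // sqr_ge0.
    over.
  by rewrite integral0y_oneDsqr ltry.
have i1 : mu.-integrable `]0, +oo[ (EFin \o (fun x : R => (oneDsqr x)^-1)).
  apply: (integrableS _ _ _ i0); [exact: measurable_itv|exact: measurable_itv|].
  by move=> x /=; rewrite !in_itv /= !andbT => /ltW.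
by have := @integrableZl _ _ _ mu `]0, +oo[%classic (measurable_itv _) K _ i1; apply: eq_integrable.
Qed.

Lemma integral_exp_substitution (f : R -> R) (n : R) : 0 <= n ->
  (forall x, 0 < x -> {for x, continuous f}) ->
  (\int[mu]_(x in `[expR (- n), expR n]) (f x)%:E =
   \int[mu]_(s in `[(- n)%R, n]) (f (expR s) * expR s)%:E)%E.
Proof.
move=> n0 cf.
have dE : derive1 (@expR R) = expR by apply/funext => x; rewrite derive1E; exact: derive_val.
rewrite (@integration_by_substitution_increasing R expR f (- n) n).
- by rewrite dE.
- lra.
- by move=> x y _ _ xy; rewrite ltr_expR.
- by rewrite dE => x _; exact: continuous_expR.
- by rewrite dE; apply/cvg_ex; exists (expR (- n)); apply: cvg_at_right_filter; exact: continuous_expR.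
- by rewrite dE; apply/cvg_ex; exists (expR n); apply: cvg_at_left_filter; exact: continuous_expR.
- split.
  + by move=> x _; exact: ex_derive.
  + by apply: cvg_at_right_filter; exact: continuous_expR.
  + by apply: cvg_at_left_filter; exact: continuous_expR.
- apply: continuous_in_subspaceT => x; rewrite inE /= in_itv /= => /andP[x0 _].
  by apply: cf; apply: lt_le_trans x0; exact: expR_gt0.
Qed.

(** Under x = exp s the sets [exp (- n), exp n], which exhaust the half line, become the intervals
    [- n, n] of the last hypothesis. Domination by a multiple of 1 / (1 + x^2), which is integrable
    at both ends, makes the integrals over them converge to the whole. *)
Lemma improper_integral (phi : R -> R) (K C c d : R) : 0 < d ->
  (forall x, 0 < x -> {for x, continuous phi}) ->
  (forall x, 0 < x -> `|phi x / x ^+ 2| <= K / oneDsqr x) ->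
  (forall n : nat, expR (- n%:R) < d ->
    `| \int[mu]_(s in `[(- n%:R), n%:R]) (2 * (phi (expR s) / expR s)) + c | <= C * expR (- n%:R)) ->
  mu.-integrable `]0, +oo[ (fun x => (phi x / x ^+ 2)%:E) /\
  (\int[mu]_(x in `]0%R, +oo[) (phi x / x ^+ 2)%:E = (- (c / 2))%:E)%E.
Proof.
move=> d0 cphi bphi H.
pose f (x : R) := phi x / x ^+ 2.
have cf (x : R) : 0 < x -> {for x, continuous f}.
  move=> x0; apply: cvgM; first exact: cphi.
  by apply: cvgV; [rewrite expf_neq0 // gt_eqF|exact: exprn_continuous].
have mf : measurable_fun (`]0, +oo[ : set R) f.
  apply: subspace_continuous_measurable_fun => //.
  apply: continuous_in_subspaceT => x; rewrite inE /= in_itv /= andbT; exact: cf.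
have fi : mu.-integrable `]0, +oo[ (EFin \o f).
  apply: le_integrable (integrable_oneDsqrV K) => //.
    by apply/measurable_EFinP; exact: mf.
  move=> x /=; rewrite in_itv /= andbT => x0; rewrite lee_fin.
  by apply: (le_trans (bphi x x0)); exact: ler_norm.
split; first exact: fi.
pose E n := `[expR (- n%:R), expR n%:R]%classic : set R.
pose a n := \int[mu]_(s in `[(- n%:R), n%:R]) (phi (expR s) / expR s).
have gi n : mu.-integrable `[(- n%:R), n%:R] (EFin \o (fun s => phi (expR s) / expR s)).
  apply: continuous_compact_integrable; first exact: segment_compact.
  apply: continuous_subspaceT => s; apply: cvgM.
    apply: (@continuous_comp _ _ _ (@expR R) phi); first exact: continuous_expR.
    by apply: cphi; exact: expR_gt0.
  by apply: cvgV; [rewrite gt_eqF // expR_gt0|exact: continuous_expR].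
have aE n : (\int[mu]_(x in `]0%R, +oo[) ((EFin \o f) \_ (E n)) x = (a n)%:E)%E.
  rewrite -integral_mkcondr.
  have -> : `]0, +oo[ `&` E n = E n.
    apply/setIidPr => x; rewrite /E /= !in_itv /= andbT => /andP[x0 _].
    by apply: lt_le_trans x0; exact: expR_gt0.
  rewrite /E integral_exp_substitution // /a /Rintegral fineK; last first.
    by apply: integrable_fin_num (gi n); exact: measurable_itv.
  apply: eq_integral => s _; congr (_%:E); rewrite /f.
  by field; rewrite gt_eqF // expR_gt0.
have c1 : (a n)%:E @[n --> \oo] --> (\int[mu]_(x in `]0%R, +oo[) (f x)%:E)%E.
  have [] := @dominated_convergence _ _ _ mu `]0, +oo[%classic (measurable_itv _)
    (fun n => (EFin \o f) \_ (E n)) (EFin \o f) (abse \o (EFin \o f)).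
  - move=> n; apply/measurable_restrict; [exact: measurable_itv|exact: measurable_itv|].
    apply: measurable_funS (_ : measurable_fun (`]0, +oo[ : set R) (EFin \o f)).
    + exact: measurable_itv.
    + exact: subIsetl.
    + by apply/measurable_EFinP; exact: mf.
  - by apply/measurable_EFinP; exact: mf.
  - apply: aeW => x; rewrite /= in_itv /= andbT => x0.
    apply: cvg_near_cst; near=> n.
    have h1 : x <= n%:R by near: n; exact: nbhs_infty_ger.
    have h2 : x^-1 <= n%:R by near: n; exact: nbhs_infty_ger.
    rewrite /patch mem_set // /E /= in_itv /=; apply/andP; split.
      rewrite -[x]invrK expRN lef_pV2 ?posrE ?expR_gt0 ?invr_gt0 //.
      by apply: (le_trans h2); apply: le_trans (expR_ge1Dx _); rewrite lerDr.
    by apply: (le_trans h1); apply: le_trans (expR_ge1Dx _); rewrite lerDr.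
  - exact: (integrable_abse fi).
  - apply: aeW => x n _; rewrite /patch; case: ifP => _ //.
    by rewrite abse0 abse_ge0.
  by move=> _ _; under eq_fun do rewrite aE.
have c2 : a n @[n --> \oo] --> - (c / 2).
  apply/cvgrPdist_le => e e0; near=> n.
  have h1 : d^-1 <= n%:R by near: n; exact: nbhs_infty_ger.
  have h2 : `|C| / e <= n%:R by near: n; exact: nbhs_infty_ger.
  have nn : 0 < 1 + n%:R :> R by rewrite ltr_pwDl.
  (* The elementary bound 1 + n <= exp n gives an explicit rate, enough both for the radius to drop
     below [d] and for the error to drop below [e]. *)
  have en : expR (- n%:R : R) <= (1 + n%:R)^-1.
    by rewrite expRN lef_pV2 ?posrE ?expR_gt0 // expR_ge1Dx.
  have nd : expR (- n%:R : R) < d.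
    apply: (le_lt_trans en); rewrite -[d]invrK ltf_pV2 ?posrE ?invr_gt0 //.
    by apply: (le_lt_trans h1); rewrite ltrDr.
  have Cn : C * expR (- n%:R : R) <= e.
    apply: (@le_trans _ _ (`|C| * (1 + n%:R)^-1)).
      apply: (le_trans (ler_wpM2r (expR_ge0 _) (ler_norm C))).
      by rewrite ler_wpM2l.
    rewrite ler_pdivrMr // mulrDr mulr1.
    by rewrite ler_pdivrMr // mulrC in h2; rewrite (le_trans h2) // lerDr ltW.
  have aZ : \int[mu]_(s in `[(- n%:R), n%:R]) (2 * (phi (expR s) / expR s)) = 2 * a n.
    by apply: RintegralZl; [exact: measurable_itv|exact: gi].
  have := H n nd; rewrite aZ => h; have {}h := le_trans h Cn.
  by move: h; rewrite !ler_norml => /andP[? ?]; apply/andP; split; lra.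
have c3 : (a n)%:E @[n --> \oo] --> (- (c / 2))%:E by apply: cvg_EFin => //; exact: nearW.
exact: (cvg_unique _ c1 c3).
Unshelve. all: by end_near. Qed.

End ImproperIntegral.

(** * The sum rule for a bounded function on the half plane *)

Section SumRule.
Context {R : realType}.
Notation Co := ((R[i])^o).
Notation I := (0 +i* 1 : R[i]).
Notation mu := (@lebesgue_measure R).

Lemma halfplane_sum_rule (F : Co -> Co) (B K d al : R) :
  (forall w : Co, 0 <= complex.Im w -> normc (F w) <= B) ->
  (forall w : Co, 0 <= complex.Im w -> forall e : R, 0 < e ->
    exists2 dl : R, 0 < dl & forall w' : Co, 0 <= complex.Im w' -> normc (w' - w) < dl ->
      normc (F w' - F w) < e) ->
  (forall w : Co, 0 < complex.Im w -> exists D, has_cderiv F w D) ->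
  (forall x : R, F (- x%:C) = conjc (F x%:C)) ->
  0 < d ->
  (forall w : Co, 0 <= complex.Im w -> normc w < d ->
    normc (F w - I * al%:C * w) <= K * normc w ^+ 2) ->
  mu.-integrable `]0, +oo[ (fun x => (complex.Re (F x%:C) / x ^+ 2)%:E) /\
  (\int[mu]_(x in `]0%R, +oo[) (complex.Re (F x%:C) / x ^+ 2)%:E = (- (al * pi / 2))%:E)%E.
Proof.
move=> bF cF aF rF d0 lF.
have B0 := halfplane_bound_ge0 bF; have K0 := low_freq_const_ge0 d0 lF.
(* [K'] serves on both sides of [d]: below it the real part is at most K x^2 and 1 + x^2 <= 1 + d^2;
   above it the real part is at most B and (1 + x^2) / x^2 <= 1 + 1 / d^2. *)
pose K' := K * (1 + d ^+ 2) + B * (1 + (d ^+ 2)^-1).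
apply: (@improper_integral R (fun x => complex.Re (F x%:C)) K' (2 * (B + K) * pi) (al * pi) d d0).
- move=> x x0; apply: (@cvg_Re R R (nbhs x) _ (fun t => F t%:C) (F x%:C)).
  apply: (@halfplane_cvg R F cF R (nbhs x) _ (fun t => t%:C) x%:C) => //.
  by apply: cvg_ReIm => /=; [exact: cvg_id|exact: cvg_cst].
- move=> x x0; have x2 : 0 < x ^+ 2 by rewrite exprn_gt0.
  have xo : 0 < oneDsqr x by rewrite /oneDsqr; lra.
  have d2 : 0 < d ^+ 2 by rewrite exprn_gt0.
  have Bd : 0 <= B * (1 + (d ^+ 2)^-1) by rewrite mulr_ge0 // addr_ge0 // invr_ge0 ltW.
  have Kd : 0 <= K * (1 + d ^+ 2) by rewrite mulr_ge0 // addr_ge0 // ltW.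
  rewrite normrM normfV (ger0_norm (ltW x2)) ler_pdivrMr // mulrAC ler_pdivlMr //.
  have [xd|dx] := ltP x d.
  (* The linear term i al x is purely imaginary, so it drops out of the real part. *)
  + have h : `|complex.Re (F x%:C)| <= K * x ^+ 2.
      have := lF x%:C (lexx 0); rewrite normc_real (ger0_norm (ltW x0)) => /(_ xd) h.
      apply: le_trans h; apply: le_trans (ler_Re_normc _).
      rewrite ReCD ReCN !ReCM ImCM /= le_eqVlt; apply/orP; left; apply/eqP.
      by congr `| _ |; ring.
    have xd2 : x ^+ 2 <= d ^+ 2 by rewrite lerXn2r // ?nnegrE ?(ltW x0) ?(ltW d0) // ltW.
    apply: (le_trans (ler_wpM2r (ltW xo) h)).
    have -> : K * x ^+ 2 * oneDsqr x = K * (1 + x ^+ 2) * x ^+ 2 by rewrite /oneDsqr; ring.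
    rewrite ler_pM2r // /K'.
    have : K * (1 + x ^+ 2) <= K * (1 + d ^+ 2) by rewrite ler_wpM2l // lerD2l.
    lra.
  + have h : `|complex.Re (F x%:C)| <= B.
      by apply: (le_trans (ler_Re_normc _)); apply: bF.
    have xd2 : d ^+ 2 <= x ^+ 2 by rewrite lerXn2r // ?nnegrE ?(ltW x0) ?(ltW d0).
    apply: (le_trans (ler_wpM2r (ltW xo) h)).
    have h2 : oneDsqr x <= (1 + (d ^+ 2)^-1) * x ^+ 2.
      rewrite /oneDsqr mulrDl mul1r addrC lerD2l mulrC ler_pdivlMr // mul1r //.
    apply: (le_trans (ler_wpM2l B0 h2)); rewrite mulrA ler_pM2r // /K'.
    lra.
- move=> n nd; have [_] := half_annulus bF cF aF rF d0 lF (ler0n R n) nd.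
  by [].
Qed.

End SumRule.

(** * The reflection coefficient *)

Section Reflection.
Context {R : realType} (a z : R) (rho' C' : R -> R[i] -> R[i])
  (M : R -> R[i] -> 'M[R[i]]_2).
Context (ha : 0 < a) (z0 : 0 < z)
  (hrho' : slab_parameter a rho') (hC' : slab_parameter a C')
  (hM : is_propagator a rho' C' M).
Notation Co := ((R[i])^o).
Notation I := (0 +i* 1 : R[i]).
Notation mu := (@lebesgue_measure R).

Let Num (w : Co) : Co :=
  M a w 0 0 - M a w 1 1 + z%:C * M a w 0 1 - (z%:C)^-1 * M a w 1 0.
Let Den (w : Co) : Co :=
  M a w 0 0 + M a w 1 1 - z%:C * M a w 0 1 - (z%:C)^-1 * M a w 1 0.

Lemma reflectionE w : reflection z (M a w) = Num w * (Den w)^-1.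
Proof. by []. Qed.

Lemma slab_end : 0 <= a <= a. Proof. by rewrite lexx ltW. Qed.

(** The flux inequality with the square of the numerator dropped; the reflection coefficient thus
    has no pole in the closed half plane, the real axis included. *)
Lemma reflection_den_ge w : 0 <= complex.Im w -> 2 <= normc (Den w).
Proof.
move=> w0; have := reflection_flux ha hrho' hC' hM z0 w0; rewrite -/(Num w) -/(Den w) => h.
rewrite -(@ler_pXn2r R 2) ?nnegrE ?normc_ge0 //.
by have := sqr_ge0 (normc (Num w)); lra.
Qed.

Lemma reflection_den_neq0 w : 0 <= complex.Im w -> Den w != 0.
Proof. by move=> w0; rewrite -normc_gt0; have := reflection_den_ge w0; lra. Qed.

Lemma reflection_bounded w : 0 <= complex.Im w -> normc (reflection z (M a w)) <= 1.
Proof.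
move=> w0; have := reflection_flux ha hrho' hC' hM z0 w0; rewrite -/(Num w) -/(Den w) => h.
have D2 := reflection_den_ge w0.
rewrite reflectionE normcM normcV ler_pdivrMr ?mul1r; last by lra.
rewrite -(@ler_pXn2r R 2) ?nnegrE ?normc_ge0 //.
by lra.
Qed.

Lemma reflection_continuous (w : Co) : 0 <= complex.Im w -> forall e : R, 0 < e ->
  exists2 dl : R, 0 < dl & forall w' : Co, 0 <= complex.Im w' -> normc (w' - w) < dl ->
    normc (reflection z (M a w') - reflection z (M a w)) < e.
Proof.
move=> w0 e e0.
pose P (h : Co) := 0 <= complex.Im (w + h) /\ normc h <= 1.
have [d d0 hd] : exists2 d : R, 0 < d & forall h, P h -> normc h < d ->
    normc (reflection z (M a (w + h)) - reflection z (M a w)) < e.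
  apply: (@seq_cvgc R P (fun h => reflection z (M a (w + h))) _ _ _ e0) => h Ph h0.
  have cM i j := @propagator_continuous R a rho' C' M ha hrho' hC' hM a i j w h slab_end w0 Ph h0.
  have c12 := cvgsN (@cvgsMl R (z%:C)^-1 _ _ (cM 1 0)).
  have c21 := @cvgsMl R z%:C _ _ (cM 0 1).
  have cN := cvgsD (cvgsD (cvgsD (cM 0 0) (cvgsN (cM 1 1))) c21) c12.
  have cD := cvgsD (cvgsD (cvgsD (cM 0 0) (cM 1 1)) (cvgsN c21)) c12.
  exact: (cvgsM cN (cvgsV (reflection_den_neq0 w0) cD)).
exists (Num.min d 1); first by rewrite lt_min d0 ltr01.
move=> w' w'0; rewrite lt_min => /andP[h1 h2].
have := hd (w' - w); rewrite subrKC; apply=> //.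
by split; [rewrite subrKC|exact: ltW].
Qed.

Lemma reflection_has_cderiv (w : Co) : 0 < complex.Im w ->
  exists D, has_cderiv (fun w => reflection z (M a w) : Co) w D.
Proof.
move=> w0.
have dM i j := propagator_has_cderiv ha hrho' hC' hM i j w0.
have [D00 h00] := dM 0 0; have [D01 h01] := dM 0 1.
have [D10 h10] := dM 1 0; have [D11 h11] := dM 1 1.
have n11 := has_cderivZ (-1) h11.
have z01 := has_cderivZ z%:C h01; have nz01 := has_cderivZ (-1) z01.
have nz10 := has_cderivZ (- (z%:C)^-1) h10.
have hN := has_cderivD (has_cderivD (has_cderivD h00 n11) z01) nz10.
have hD := has_cderivD (has_cderivD (has_cderivD h00 h11) nz01) nz10.
set N1 := (fun z0 => _) in hN; set D1 := (fun z0 => _) in hD.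
have NE : N1 = Num by apply/funext => u; rewrite /N1 /Num; ring.
have DE : D1 = Den by apply/funext => u; rewrite /D1 /Den; ring.
rewrite NE in hN; rewrite DE in hD.
by eexists; exact: (has_cderivM hN (has_cderivV hD (reflection_den_neq0 (ltW w0)))).
Qed.

Lemma reflection_conj (x : R) :
  reflection z (M a (- x%:C)) = conjc (reflection z (M a x%:C)).
Proof.
have x0 : 0 <= complex.Im (x%:C : R[i]) by [].
have E i j : M a (- x%:C) i j = conjc (M a x%:C i j).
  have := propagator_conj ha hrho' hC' hM i j slab_end x0.
  by congr (M a _ i j = _); congr (- _); exact: conjc_real.
have zr : conjc (z%:C) = z%:C :> R[i] by exact: conjc_real.
have cM (u v : R[i]) : conjc (u * v) = conjc u * conjc v by exact: rmorphM.
have cD (u v : R[i]) : conjc (u + v) = conjc u + conjc v by exact: rmorphD.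
have cN (u : R[i]) : conjc (- u) = - conjc u by exact: rmorphN.
by rewrite /reflection !E !(cM, cD, cN, conjc_inv) zr.
Qed.

(** A numerator 2 i al w + O(w^2) over a denominator 2 + O(w), where [al] is the coefficient in the
    statement; its 2 is the limit of the denominator. *)
Lemma reflection_low_freq :
  let c0 := \int[mu]_(x in `[0, a]) static C' x in
  let r0 := \int[mu]_(x in `[0, a]) static rho' x in
  exists K d : R, 0 < d /\ forall w : Co, 0 <= complex.Im w -> normc w < d ->
    normc (reflection z (M a w) - I * ((z * c0 - z^-1 * r0) / 2)%:C * w) <= K * normc w ^+ 2.
Proof.
move=> c0 r0; set al := (z * c0 - z^-1 * r0) / 2.
have [K K0 [d d0 H]] := propagator_low_freq ha hrho' hC' hM.
(* [K1] bounds the deviation of the denominator from 2 per unit of [normc w], and [K2] the error of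
   the numerator per unit of [normc w ^+ 2]. *)
pose K1 := 2 * K + z * (`|c0| + K) + z^-1 * (`|r0| + K).
pose K2 := K * (2 + z + z^-1).
have zV0 : 0 < z^-1 by rewrite invr_gt0.
exists (K2 + `|al| * K1), (Num.min d 1); split; first by rewrite lt_min d0 ltr01.
move=> w w0; rewrite lt_min => /andP[wd w1].
have [h00 h11 h01 h10] := H w w0 wd.
rewrite (static_integral ha hC') -/c0 in h01; rewrite (static_integral ha hrho') -/r0 in h10.
have D2 := reflection_den_ge w0; have Dn := reflection_den_neq0 w0.
have W0 := normc_ge0 w.
set t := normc w in W0 h00 h11 h01 h10 w1 wd *.
have zC0 : z%:C != 0 :> R[i] by rewrite -normc_gt0 normc_real normr_gt0 gt_eqF.
have nz : normc (z%:C : R[i]) = z by rewrite normc_real ger0_norm // ltW.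
have nzV : normc ((z%:C)^-1 : R[i]) = z^-1 by rewrite normcV nz.
have t2 : 0 <= t ^+ 2 by exact: sqr_ge0.
have tt : t ^+ 2 <= t by rewrite expr2 ler_piMr // ltW.
have m01 : normc (M a w 0 1) <= (`|c0| + K) * t.
  have -> : M a w 0 1 = I * w * c0%:C + (M a w 0 1 - I * w * c0%:C) by ring.
  apply: (le_trans (normcD _ _)); rewrite !normcM normc_i mul1r normc_real -/t.
  by rewrite mulrDl [t * _]mulrC lerD2l (le_trans h01) // ler_wpM2l.
have m10 : normc (M a w 1 0) <= (`|r0| + K) * t.
  have -> : M a w 1 0 = I * w * r0%:C + (M a w 1 0 - I * w * r0%:C) by ring.
  apply: (le_trans (normcD _ _)); rewrite !normcM normc_i mul1r normc_real -/t.
  by rewrite mulrDl [t * _]mulrC lerD2l (le_trans h10) // ler_wpM2l.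
have D1 : normc (Den w - 2) <= K1 * t.
  have -> : Den w - 2 = (M a w 0 0 - 1) + (M a w 1 1 - 1) + - (z%:C * M a w 0 1) + - ((z%:C)^-1 * M a w 1 0).
    by rewrite /Den; ring.
  apply: (le_trans (normcD _ _)); rewrite normcNE normcM nzV.
  have n1 := normcD (M a w 0 0 - 1 + (M a w 1 1 - 1)) (- (z%:C * M a w 0 1)).
  rewrite normcNE normcM nz in n1.
  have n2 := normcD (M a w 0 0 - 1) (M a w 1 1 - 1).
  have n3 : z * normc (M a w 0 1) <= z * ((`|c0| + K) * t) by rewrite ler_pM2l.
  have n4 : z^-1 * normc (M a w 1 0) <= z^-1 * ((`|r0| + K) * t) by rewrite ler_pM2l.
  have : K * t ^+ 2 <= K * t by rewrite ler_wpM2l.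
  have -> : K1 * t = 2 * (K * t) + z * ((`|c0| + K) * t) + z^-1 * ((`|r0| + K) * t).
    by rewrite /K1; ring.
  by lra.
have alE : I * al%:C * w * 2 = z%:C * (I * w * c0%:C) - (z%:C)^-1 * (I * w * r0%:C).
  have -> : al%:C = (z%:C * c0%:C - (z%:C)^-1 * r0%:C) / 2 :> R[i].
    by rewrite /al rmorphM rmorphB !rmorphM /= !fmorphV /= rmorph_nat.
  by field; rewrite zC0.
have N1 : normc (Num w - I * al%:C * w * 2) <= K2 * t ^+ 2.
  have -> : Num w - I * al%:C * w * 2 = (M a w 0 0 - 1) + - (M a w 1 1 - 1) +
     z%:C * (M a w 0 1 - I * w * c0%:C) + - ((z%:C)^-1 * (M a w 1 0 - I * w * r0%:C)).
    by rewrite alE /Num; ring.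
  apply: (le_trans (normcD _ _)); rewrite normcNE normcM nzV.
  have n1 := normcD (M a w 0 0 - 1 + - (M a w 1 1 - 1)) (z%:C * (M a w 0 1 - I * w * c0%:C)).
  rewrite normcM nz in n1.
  have n2 := normcD (M a w 0 0 - 1) (- (M a w 1 1 - 1)).
  rewrite normcNE in n2.
  have n3 : z * normc (M a w 0 1 - I * w * c0%:C) <= z * (K * t ^+ 2) by rewrite ler_pM2l.
  have n4 : z^-1 * normc (M a w 1 0 - I * w * r0%:C) <= z^-1 * (K * t ^+ 2) by rewrite ler_pM2l.
  have -> : K2 * t ^+ 2 = 2 * (K * t ^+ 2) + z * (K * t ^+ 2) + z^-1 * (K * t ^+ 2).
    by rewrite /K2; ring.
  by lra.
(* The error of the quotient is that of the numerator minus i al w times that of the denominator;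
   the division can only shrink it, since [Den w] has modulus at least 2. *)
have -> : reflection z (M a w) - I * al%:C * w =
   ((Num w - I * al%:C * w * 2) + - (I * al%:C * w * (Den w - 2))) / Den w.
  by rewrite reflectionE; field.
rewrite normcM normcV ler_pdivrMr; last by lra.
have K20 : 0 <= K2.
  by apply: mulr_ge0 => //; rewrite !addr_ge0 // ltW.
have K10 : 0 <= K1.
  by rewrite /K1 !addr_ge0 ?mulr_ge0 ?addr_ge0 // ltW.
have KK : 0 <= (K2 + `|al| * K1) * t ^+ 2 by rewrite mulr_ge0 // addr_ge0 // mulr_ge0.
apply: (@le_trans _ _ ((K2 + `|al| * K1) * t ^+ 2)); last by rewrite ler_peMr //; lra.
apply: (le_trans (normcD _ _)); rewrite normcNE !normcM normc_i mul1r normc_real -/t.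
have n5 : `|al| * t * normc (Den w - 2) <= `|al| * t * (K1 * t) by rewrite ler_wpM2l // mulr_ge0.
have -> : (K2 + `|al| * K1) * t ^+ 2 = K2 * t ^+ 2 + `|al| * t * (K1 * t) by ring.
exact: lerD.
Qed.

End Reflection.

Theorem mainTheorem1 (R : realType) (rho C a : R)
    (rho' C' : R -> R[i] -> R[i]) (M : R -> R[i] -> 'M[R[i]]_2)
    (hrho : 0 < rho) (hC : 0 < C) (ha : 0 < a)
    (hrho' : slab_parameter a rho') (hC' : slab_parameter a C')
    (hM : is_propagator a rho' C' M) :
  let z := impedance rho C in
  let c := sound_speed rho C in
  let integrand := fun w : R =>
    (complex.Re (reflection z (M a w%:C)) / w ^+ 2)%:E in
  (@lebesgue_measure R).-integrable `]0, +oo[ integrand /\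
  (\int[@lebesgue_measure R]_(w in `]0%R, +oo[) integrand w)%E =
    (pi * a / (4 * c) *
     (slab_mean a (static rho') / rho - slab_mean a (static C') / C))%:E.
Proof.
move=> z c integrand.
have z0 : 0 < z by rewrite sqrtr_gt0 divr_gt0.
(* The relations rho = C z^2 and c = 1 / (C z) eliminate both square roots, after which the claimed
   value is a rational identity in [C] and [z]. *)
have zz : C * z ^+ 2 = rho.
  by rewrite /z /impedance sqr_sqrtr ?divr_ge0 ?ltW // mulrC divfK // gt_eqF.
have cE : c = (C * z)^-1.
  rewrite /c /sound_speed -zz mulrA -expr2 -exprMn sqrtr_sqr ger0_norm //.
  by rewrite mulr_ge0 // ltW.
have [K [d [d0 low]]] := reflection_low_freq ha z0 hrho' hC' hM.
have [int E] := halfplane_sum_rule (reflection_bounded ha z0 hrho' hC' hM)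
  (reflection_continuous ha z0 hrho' hC' hM) (reflection_has_cderiv ha z0 hrho' hC' hM)
  (reflection_conj z ha hrho' hC' hM) d0 low.
split; first exact: int.
rewrite /integrand E; congr (_%:E).
rewrite cE /slab_mean -zz; field.
by rewrite !gt_eqF.
Qed.
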